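(* Let $\epsilon \in (n^{-1/4}, 1)$, and let $d = \lceil 3 \ln \epsilon^{-1} \rceil + 1$. The basic bubble-up algorithm is a $d$-ary eviction policy that supports $(1-\epsilon)n$ insertions with probability $1 - O(1/n)$, and where, for any $\delta \ge \epsilon$, the expected time for the $(1-\delta)n$-th insertion is $O(\delta^{-1} + \log \epsilon^{-1})$.
   Context: A $d$-ary cuckoo hash table stores elements in an array of $n$ slots (each holding at most one element) using $d$ hash functions $h_1,\dots,h_d : U \to [n]$ that are fully independent and uniformly random; each stored element $x$ resides in one of $h_1(x),\dots,h_d(x)$. For a stored element $x$, $\texttt{choice}(x)$ is the index $i$ such that $x$ currently resides at $h_i(x)$, and $\texttt{choice}(x) = 0$ if $x$ is not stored (e.g., a newly inserted element); $\texttt{choice}$ is assumed evaluable in $O(1)$ time. Elements are inserted one at a time. The basic bubble-up algorithm inserts/re-places an element $x$ (a newly inserted element or one that has just been evicted) as follows: (Type 1) if $\texttt{choice}(x) = d$, move $x$ to $h_{d-1}(x)$, evicting any element there; (Type 2) if $\texttt{choice}(x) = d-1$, move $x$ to $h_d(x)$, evicting any element there; (Type 3/4) if $\texttt{choice}(x) < d-1$, sequentially check whether any of $h_{\texttt{choice}(x)+1}(x), \dots, h_{d-2}(x)$ is a free slot and, if so, place $x$ in the first free one found (Type 3); otherwise move $x$ to $h_{d-1}(x)$, evicting any element there (Type 4). Any evicted element is then re-placed by the same rule. If $c\log n$ Type 1 or Type 2 moves occur in a row without finding a free slot (for a sufficiently large constant $c$), the algorithm declares failure. *)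

(* Defs.v *)
From mathcomp Require Import all_boot all_order all_algebra.
From mathcomp Require Import all_classical all_reals all_analysis.

Set Implicit Arguments.
Unset Strict Implicit.
Unset Printing Implicit Defensive.

Import Order.TTheory GRing.Theory Num.Theory.

Section Uniform.
Local Open Scope ring_scope.
Variables (R : realType) (T : finType).

(* Probability and expectation for a uniformly random element of T. *)
Definition Pr (A : pred T) : R := #|A|%:R / #|T|%:R.
Definition Ex (f : T -> nat) : R := (\sum_t (f t)%:R) / #|T|%:R.

End Uniform.

Section Cuckoo.
Local Open Scope nat_scope.
(* The number of hash functions is d = p.+1; U is the universe of elements and
   'I_n the set of slots. *)
Variables (U : finType) (n p : nat).
Local Notation d := p.+1.

(* A uniformly random point of this type is a family of d fully independent,
   uniformly random functions U -> 'I_n. *)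
Definition hashes := {ffun 'I_d * U -> 'I_n}.

(* Hash functions are numbered 1, ..., d; only these values of i are used. *)
Definition hash (h : hashes) (i : nat) (x : U) : 'I_n := h (inord i.-1, x).

(* [choice s x] is 0 for an element that was never inserted.  An element that
   has just been evicted keeps its last value of [choice] until it is
   placed again. *)
Record table := Table {
  occ : 'I_n -> option U;
  choice : U -> nat }.

Definition empty_table : table := Table (fun=> None) (fun=> 0).

Definition place (h : hashes) (s : table) (x : U) (i : nat) : table :=
  Table [eta occ s with hash h i x |-> Some x] [eta choice s with x |-> i].

(* [s] is a cuckoo hash table storing exactly the elements of [S]. *)
Definition valid_table (h : hashes) (s : table) (S : seq U) : Prop :=
  [/\ forall x, x \in S ->
        1 <= choice s x <= d /\ occ s (hash h (choice s x) x) = Some x,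
      forall x, x \notin S -> choice s x = 0
    & forall j x, occ s j = Some x -> x \in S /\ j = hash h (choice s x) x].

(* [evictions h s x s']: starting from table [s] with the element [x] to be
   (re-)placed, a chain of evictions ends in the table [s']. *)
Inductive evictions (h : hashes) : table -> U -> table -> Prop :=
| evictions_free s x i :
    1 <= i <= d -> occ s (hash h i x) = None -> evictions h s x (place h s x i)
| evictions_evict s x i y s' :
    1 <= i <= d -> occ s (hash h i x) = Some y ->
    evictions h (place h s x i) y s' -> evictions h s x s'.

(* An insertion returns the new table, or None if it declares failure, together
   with the time it took. *)
Definition insertion := hashes -> table -> U -> option table * nat.

Definition eviction_policy (ins : insertion) : Prop :=
  forall h s S x s', valid_table h s S -> x \notin S ->
    (ins h s x).1 = Some s' -> evictions h s x s' /\ valid_table h s' (x :: S).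

Definition run (ins : insertion) (h : hashes) (xs : seq U) : option table :=
  foldl (fun os x => obind (fun s => (ins h s x).1) os) (Some empty_table) xs.

(* Time of the k-th insertion (k >= 1) in the sequence [xs]; it is 0 if an
   earlier insertion has already declared failure, as the process then stops. *)
Definition insertion_time (ins : insertion) (h : hashes) (xs : seq U) (k : nat)
    : nat :=
  if (run ins h (take k.-1 xs), drop k.-1 xs) is (Some s, x :: _)
  then (ins h s x).2 else 0.

(* The rule for (re-)placing x: the index i of the slot h_i(x) to which x is
   moved, the number of slots inspected (including h_i(x)), and whether the move
   is of Type 1 or 2, i.e. takes x from h_d(x) to h_{d-1}(x) or conversely. *)
Definition next_move (h : hashes) (s : table) (x : U) : nat * nat * bool :=
  let c := choice s x in
  if c == d then (d.-1, 1, true)                               (* Type 1 *)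
  else if c == d.-1 then (d, 1, true)                          (* Type 2 *)
  else
    let cand := iota c.+1 (d.-2 - c) in               (* c + 1, ..., d - 2 *)
    let j := find (fun i => ~~ isSome (occ s (hash h i x))) cand in
    if j < size cand then (nth 0 cand j, j.+1, false)          (* Type 3 *)
    else (d.-1, (size cand).+1, false).                        (* Type 4 *)

(* [r] counts the latest consecutive Type 1 and Type 2 moves, all of which
   evicted an element; failure is declared when it reaches [lim].  The time is
   the number of slots inspected. *)
Fixpoint bubble_up_loop (lim : nat) (h : hashes) (fuel r : nat) (s : table)
    (x : U) (time : nat) : option table * nat :=
  if fuel is fuel'.+1 then
    let: (i, probes, core) := next_move h s x in
    let s' := place h s x i in
    if occ s (hash h i x) is Some y then
      let r' := if core then r.+1 else 0 in
      if core && (lim <= r') then (None, time + probes)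
      else bubble_up_loop lim h fuel' r' s' y (time + probes)
    else (Some s', time + probes)
  else (None, time).

(* The fuel never runs out, see [bubble_up_fuel]: a Type 4 move permanently
   raises the choice of an element to at least d - 1. *)
Definition bubble_up (lim : nat) : insertion :=
  fun h s x => bubble_up_loop lim h (#|U|.+1 * lim.+1) 0 s x 0.

Lemma bubble_up_loop_fuel lim h fuel fuel' r s x time :
  let V := #|[pred y | (choice s y != d) && (choice s y != d.-1)]| in
  V * lim.+1 + (lim - r) < fuel -> fuel <= fuel' ->
  bubble_up_loop lim h fuel' r s x time = bubble_up_loop lim h fuel r s x time.
Proof.
elim: fuel fuel' r s x time => [|f IH] [|f'] r s x time //=.
set V := #|_| => Vf ff'.
rewrite /next_move; set c := choice s x.
have core i b : (i == d) || (i == d.-1) ->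
    #|[pred y | (choice (place h s x i) y != d) &&
                (choice (place h s x i) y != d.-1)]| + ~~ b <= V
    \/ ~~ b /\ ((c == d) || (c == d.-1)).
  move=> /= ip; case: (boolP ((c == d) || (c == d.-1))) => [cc|cN].
    case: b; last by right.
    left; rewrite addn0; apply: subset_leq_card; apply/fintype.subsetP => y.
    rewrite !inE /=; case: (y =P x) => // _.
    by rewrite -negb_or ip.
  have xV : x \in [pred y | (choice s y != d) && (choice s y != d.-1)].
    by rewrite inE -negb_or.
  left; rewrite /V [X in _ <= X](cardD1 x) xV addnC leq_add //; first by case: b.
  apply: subset_leq_card; apply/fintype.subsetP => y.
  by rewrite !inE /=; case: (y =P x) => //= _; rewrite -negb_or ip.
case: ifP => [cd|cd]; last case: ifP => [cd1|cd1].
- case: (occ s _) => // y; case: ifP => //= lr.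
  have [|le|[]//] := core d.-1 true; first by rewrite eqxx orbT.
  apply: IH => //=; move: le; rewrite addn0 => le.
  move/negbT: lr; rewrite -ltnNge => lr.
  apply: leq_trans (_ : V * lim.+1 + (lim - r) <= f); last by [].
  apply: (@leq_ltn_trans (V * lim.+1 + (lim - r.+1))).
    by rewrite leq_add2r leq_mul2r le orbT.
  by rewrite ltn_add2l subnSK // ltnW.
- case: (occ s _) => // y; case: ifP => //= lr.
  have [|le|[]//] := core d true; first by rewrite eqxx.
  apply: IH => //=; move: le; rewrite addn0 => le.
  move/negbT: lr; rewrite -ltnNge => lr.
  apply: leq_trans (_ : V * lim.+1 + (lim - r) <= f); last by [].
  apply: (@leq_ltn_trans (V * lim.+1 + (lim - r.+1))).
    by rewrite leq_add2r leq_mul2r le orbT.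
  by rewrite ltn_add2l subnSK // ltnW.
- case: ifP => [fs|_].
    have hs : has (fun i => ~~ isSome (occ s (hash h i x))) (iota c.+1 (d.-2 - c)).
      by rewrite has_find.
    by have := nth_find 0 hs; case: (occ s _).
  case: (occ s _) => // y /=.
  have [|le|[_]] := core d.-1 false; first by rewrite eqxx orbT.
    apply: IH => //=; move: le; rewrite subn0 addn1 => le.
    apply: leq_trans (_ : V * lim.+1 + (lim - r) <= f); last by [].
    apply: leq_trans (leq_addr _ _); move: le; rewrite -(leq_pmul2r (ltn0Sn lim)).
    by apply: leq_trans; rewrite mulSn addSn ltnS addnC.
  by rewrite cd cd1.
Qed.

Lemma bubble_up_fuel lim h s x fuel :
  #|U|.+1 * lim.+1 <= fuel ->
  bubble_up_loop lim h fuel 0 s x 0 = bubble_up lim h s x.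
Proof.
apply: bubble_up_loop_fuel; rewrite subn0 mulSn addnC addSn ltnS leq_add2l.
by rewrite leq_mul2r max_card orbT.
Qed.

End Cuckoo.

(* Main.v *)
(* Reveal hash values lazily: every probe of h_1, ..., h_{d-2} is made at most
   once, and h_{d-1}(x), h_d(x) are revealed together when x joins the core, i.e.
   is first moved to h_{d-1}(x).  Each fresh probe succeeds with probability
   (number of free slots) / n, and a core element has used d - 1 >= 3 ln (1/eps)
   of them; an exponential potential shows that filling (1 - eps) n slots takes at
   most (2/5) n (d - 1) fresh probes, hence that at most (2/5) n elements join the
   core, except with probability O(1/n).  The slots with the edges
   {h_{d-1}(x), h_d(x)} of the core elements x then form a subcritical random
   graph.  Type 1 and 2 moves walk along its edges.  A walk of c log n moves
   yields either a path of logarithmic length or a subgraph with more edges than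
   vertices, and each of these occurs with probability O(1/n).  During the
   insertion with free fraction delta, fewer than 1/delta elements are expected to
   join the core, each at a fresh uniform slot, and the walk that follows is at
   most as long as the number of slots reachable from there, whose mean is O(1). *)

Require Import Defs.
From mathcomp Require Import all_boot all_order all_algebra.
From mathcomp Require Import all_classical all_reals all_analysis.
From mathcomp Require Import ring lra zify.
Import Order.TTheory GRing.Theory Num.Theory.
Local Open Scope ring_scope.
Set Implicit Arguments.
Unset Strict Implicit.
Unset Printing Implicit Defensive.
Local Notation choice := Defs.choice.

(** * Uniform means and lazy sampling *)

(** Who joins the core, and where a walk leads, depends on all earlier hash values; what stays
    simple is that every query is new. One function [h] therefore drives the whole run, the machine
    reads it only at coordinates never read before, and each probability bound is a one-step
    inequality for a potential, averaged over a new [h] at every step. Patterns in the core graph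
    are indexed by order of arrival and not by elements, because the universe may be arbitrarily
    large; given the past, the edge of the next arrival is uniform. The constant 2/5 lies between
    two thresholds. Filling takes about n ln (1/eps) probes, which allows about n/3 core elements,
    and m edges on n slots branch with mean 2m/n, which has to stay below 1. Edges that arrive
    during the timed insertion are not covered by the bounds on the core at its start. A walk that
    meets such an edge is charged the full limit [lim], which is affordable since [lim] is O(eps
    n). *)

Lemma sum_cst (R : realType) (T : finType) (c : R) : \sum_(t : T) c = c * #|T|%:R.
Proof. by rewrite sumr_const mulr_natr; congr (_ *+ _); apply: eq_card. Qed.

Lemma sum_cst_snd (R : realType) (T : finType) (f : T -> R) :
  \sum_(tt : T * T) f tt.2 = (\sum_t f t) * #|T|%:R.
Proof. by rewrite -(pair_big predT predT (fun _ => f)) /= sum_cst. Qed.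

Section Mean.
Variables (R : realType) (Q V : finType) (v0 : V).
Local Notation H := {ffun Q -> V}.

Definition mean (f : H -> R) : R := (\sum_h f h) / #|H|%:R.

Lemma card_ffun_gt0 : 0 < #|H|%:R :> R.
Proof. by rewrite ltr0n; apply/card_gt0P; exists [ffun=> v0]. Qed.

Lemma eq_mean f g : f =1 g -> mean f = mean g.
Proof. by move=> fg; rewrite /mean; congr (_ / _); apply: eq_bigr => h _; apply: fg. Qed.

Lemma mean_cst c : mean (fun=> c) = c.
Proof.
by rewrite /mean sum_cst mulfK // gt_eqF ?card_ffun_gt0.
Qed.

Lemma meanD f g : mean (fun h => f h + g h) = mean f + mean g.
Proof. by rewrite /mean big_split mulrDl. Qed.

Lemma meanZ c f : mean (fun h => c * f h) = c * mean f.
Proof. by rewrite /mean -mulr_sumr mulrA. Qed.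

Lemma le_mean f g : (forall h, f h <= g h) -> mean f <= mean g.
Proof.
by move=> fg; rewrite /mean ler_wpM2r ?invr_ge0 ?ler0n //; apply: ler_sum => h _.
Qed.

Lemma mean_ge0 f : (forall h, 0 <= f h) -> 0 <= mean f.
Proof. by move=> f0; rewrite -(mean_cst 0); apply: le_mean. Qed.

Lemma mean_sum (I : Type) (r : seq I) (P : pred I) (f : I -> H -> R) :
  mean (fun h => \sum_(i <- r | P i) f i h) = \sum_(i <- r | P i) mean (f i).
Proof. by rewrite /mean exchange_big /= -mulr_suml. Qed.

Definition mix (A : {set Q}) (h h' : H) : H :=
  [ffun q => if q \in A then h q else h' q].

(** Independence of the coordinates in [A] from the others. In use, [A] holds the values about to be
    read and [h2] supplies those still hidden. *)
Lemma mean_resample (A : {set Q}) (g : H -> H -> R) :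
  (forall h1 h1' h2 : H, {in A, h1 =1 h1'} -> g h1 h2 = g h1' h2) ->
  (forall h1 h2 h2' : H, {in [predC A], h2 =1 h2'} -> g h1 h2 = g h1 h2') ->
  mean (fun h => g h h) = mean (fun h => mean (g h)).
Proof.
move=> gA gC; (* The involution sw exchanges the coordinates in A. *)
pose sw (hh : H * H) := (mix A hh.2 hh.1, mix A hh.1 hh.2).
have swK : involutive sw.
  by case=> h h'; rewrite /sw /=; congr (_, _); apply/ffunP => q; rewrite !ffunE; case: (q \in A).
have E : \sum_h \sum_h' g h h' = #|H|%:R * \sum_h g h h.
  rewrite pair_big /= mulrC -sum_cst_snd.
  rewrite [RHS](reindex_inj (inv_inj swK)) /=; apply: eq_bigr; case=> h h' _ /=.
  rewrite (gA _ (mix A h h')); last by move=> q qA; rewrite ffunE qA.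
  by apply: gC => q; rewrite inE /= ffunE => /negbTE ->.
by rewrite /mean -mulr_suml E [_%:R * _]mulrC mulfK // gt_eqF ?card_ffun_gt0.
Qed.

Lemma mean_at (q : Q) (f : V -> R) :
  mean (fun h => f (h q)) = (\sum_v f v) / #|V|%:R.
Proof.
(* The factor 1 at all other coordinates makes [f (h q)] a product over [Q], so that the sum over
   functions factorises. *)
pose F q' v := if q' == q then f v else 1.
have V0 : #|V|%:R != 0 :> R by rewrite gt_eqF // ltr0n; apply/card_gt0P; exists v0.
rewrite /mean (eq_bigr (fun h : H => \prod_q' F q' (h q'))); last first.
  move=> h _; rewrite (bigD1 q) //= /F eqxx big1 ?mulr1 //.
  by move=> q'; case: eqP.
rewrite -bigA_distr_bigA (bigD1 q) //= {1}/F eqxx.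
rewrite [X in _ * X / _](eq_bigr (fun=> #|V|%:R)); last first.
  by move=> q' /negbTE q'q; rewrite /F q'q sum_cst mul1r.
rewrite prodr_const card_ffun (_ : #|Q| = #|[pred i | i != q]|.+1).
  by rewrite expnS natrM natrX invfM mulrA mulrAC mulfK // expf_neq0.
by rewrite (cardD1 q) inE add1n; congr _.+1; apply: eq_card => i; rewrite !inE andbT.
Qed.

Lemma mean_at2 (q q' : Q) (f : V -> V -> R) : q != q' ->
  mean (fun h => f (h q) (h q')) = (\sum_v \sum_w f v w) / #|V|%:R ^+ 2.
Proof.
move=> qq'; rewrite (@mean_resample [set q] (fun h1 h2 : H => f (h1 q) (h2 q'))).
- rewrite (eq_mean (g := fun h => (\sum_w f (h q) w) / #|V|%:R)); last first.
    by move=> h; rewrite mean_at.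
  by rewrite (mean_at q (fun v => (\sum_w f v w) / #|V|%:R)) -mulr_suml -mulrA -invfM expr2.
- by move=> h1 h1' h2 hh; rewrite hh // inE.
- by move=> h1 h2 h2' hh; rewrite hh // !inE eq_sym.
Qed.

End Mean.

(** * Chains that query a random function without repetition *)

Section Chain.
Variables (R : realType) (Q V : finType) (v0 : V) (S : Type).
Local Notation H := {ffun Q -> V}.
Variables (nxt : S -> H -> S) (ask dom : S -> {set Q}) (Inv : S -> Prop).
Hypothesis nxt_ask : forall s (h h' : H), Inv s -> {in ask s, h =1 h'} -> nxt s h = nxt s h'.
Hypothesis nxt_inv : forall s h, Inv s -> Inv (nxt s h).
Hypothesis ask_dom : forall s q, Inv s -> q \in ask s -> q \notin dom s.
Hypothesis dom_nxt : forall s h q, Inv s -> q \in dom s -> q \in dom (nxt s h).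
Hypothesis ask_nxt : forall s h q, Inv s -> q \in ask s -> q \in dom (nxt s h).

Definition exec (h : H) (t : nat) (s : S) : S := iter t (nxt^~ h) s.

Lemma exec_inv h t s : Inv s -> Inv (exec h t s).
Proof. by move=> Is; elim: t => //= t IH; apply: nxt_inv. Qed.

Lemma exec_off_dom (h h' : H) t s : Inv s ->
  {in [predC dom s], h =1 h'} -> exec h t s = exec h' t s.
Proof.
rewrite /exec; elim: t s => // t IH s Is hh; rewrite !iterSr.
rewrite (nxt_ask (h' := h') Is); last first.
  by move=> q /(ask_dom Is) qd; apply: hh.
apply: IH => [|q qd]; first exact: nxt_inv.
by apply: hh; apply: contra qd; apply: dom_nxt.
Qed.

(** Supermartingale induction with a single [h]: after a step the chain reads only outside [dom], so
    the rest of the run may use an independent copy, to which the induction hypothesis applies. *)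
Lemma mean_exec_le (Phi : S -> R) t s :
  (forall s, Inv s -> mean (fun h => Phi (nxt s h)) <= Phi s) ->
  Inv s -> mean (fun h => Phi (exec h t s)) <= Phi s.
Proof.
move=> Phi_le; elim: t s => [|t IH] s Is; first by rewrite /exec /= mean_cst.
pose g h1 h2 := Phi (exec h2 t (nxt s h1)).
rewrite (eq_mean (g := fun h => g h h)); last by move=> h; rewrite /exec iterSr.
rewrite (mean_resample v0 (A := ask s)).
- apply: le_trans (Phi_le _ Is); apply: le_mean => h; apply: IH; exact: nxt_inv.
- by move=> h1 h1' h2 hh; rewrite /g (nxt_ask Is hh).
- move=> h1 h2 h2' hh; rewrite /g (@exec_off_dom h2 h2') //; first exact: nxt_inv.
  by move=> q qd; apply: hh; apply: contra qd; apply: ask_nxt.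
Qed.

(** A Markov property: a quantity that reads nothing revealed so far may be evaluated on an
    independent copy. This allows conditioning on the table before an insertion. *)
Lemma mean_exec_resample (g : S -> H -> R) t s :
  (forall s (h h' : H), Inv s -> {in [predC dom s], h =1 h'} -> g s h = g s h') ->
  Inv s ->
  mean (fun h => g (exec h t s) h) = mean (fun h => mean (g (exec h t s))).
Proof.
move=> g_dom; elim: t s => [|t IH] s Is; first by rewrite /exec /= mean_cst.
pose f h1 h2 := g (exec h2 t (nxt s h1)) h2.
have off h1 (h2 h2' : H) : {in [predC ask s], h2 =1 h2'} ->
    {in [predC dom (nxt s h1)], h2 =1 h2'}.
  by move=> hh q qd; apply: hh; apply: contra qd; apply: ask_nxt.
rewrite (eq_mean (g := fun h => f h h)); last by move=> h; rewrite /exec iterSr.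
rewrite (mean_resample v0 (A := ask s)).
- rewrite (eq_mean (g := fun h1 => mean (fun h2 => mean (g (exec h2 t (nxt s h1)))))).
    (* Resampling read backwards puts the first step and the later ones on the same [h] again. *)
    by rewrite -(@mean_resample R Q V v0 (ask s) (fun h1 h2 => mean (g (exec h2 t (nxt s h1)))));
      [apply: eq_mean => h; rewrite /exec iterSr
      |move=> h1 h1' h2 hh; rewrite (nxt_ask Is hh)
      |move=> h1 h2 h2' /off hh; rewrite (@exec_off_dom h2 h2') //; apply: nxt_inv].
  by move=> h1; apply: IH; apply: nxt_inv.
- by move=> h1 h1' h2 hh; rewrite /f (nxt_ask Is hh).
- move=> h1 h2 h2' /off hh; rewrite /f (@exec_off_dom h2 h2') //; last exact: nxt_inv.
  apply: g_dom; first by apply: exec_inv; apply: nxt_inv.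
  have dexec t' s' q : Inv s' -> q \in dom s' -> q \in dom (exec h2' t' s').
    by move=> Is' qs'; elim: t' => //= t' IHt; apply: dom_nxt => //; apply: exec_inv.
  by move=> q qd; apply: (hh h1); apply: contra qd; apply: dexec; apply: nxt_inv.
Qed.

End Chain.

(** * The insertion process with lazily revealed hash values *)

Section Walk.
Local Open Scope nat_scope.
Variables (U : finType) (n p : nat).
Local Notation H := (hashes U n p).
Local Notation table := (table U n).
Hypothesis p_gt0 : 0 < p.

Definition free_slots (s : table) : {set 'I_n} := [set j | ~~ occ s j].

(** Only occupied slots are constrained: an evicted element keeps its [choice] while it waits for a
    slot, and a failure leaves one element without a slot for good. *)
Definition sound (h : H) (s : table) (oy : option U) : Prop :=
  forall j z, occ s j = Some z ->
    [/\ j = hash h (choice s z) z, 0 < choice s z & Some z != oy].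

Inductive outcome := Done | Out of U | Fail.

(* The Type 1 and 2 moves that follow the eviction of y; failure is declared at
   the (f+1)-st eviction. *)
Fixpoint walk (h : H) (f : nat) (s : table) (y : U) : table * outcome * nat :=
  if choice s y < p then (s, Out y, 0) else
  let i := if choice s y == p.+1 then p else p.+1 in
  let s' := place h s y i in
  if occ s (hash h i y) is Some z then
    if f is f'.+1 then
      let: (s'', o, k) := walk h f' s' z in (s'', o, k.+1)
    else (s', Fail, 1)
  else (s', Done, 1).

Lemma free_place (h : H) s x i : free_slots (place h s x i) = free_slots s :\ hash h i x.
Proof. by apply/setP => j; rewrite !inE /=; case: eqP. Qed.

Lemma card_free_place (h : H) s x i :
  #|free_slots (place h s x i)| + ~~ occ s (hash h i x) = #|free_slots s|.
Proof. by rewrite free_place (cardsD1 (hash h i x) (free_slots s)) inE addnC. Qed.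

Lemma sound_place (h : H) s y i : 0 < i -> sound h s (Some y) ->
  sound h (place h s y i) (occ s (hash h i y)).
Proof.
move=> i0 ss j z /=; case: (j =P hash h i y) => [-> [<-]|jy oz].
  rewrite eqxx; split=> //; case E: (occ _ _) => [z'|] //.
  by have [_ _] := ss _ _ E; rewrite eq_sym.
have [jz cz zy] := ss _ _ oz.
have /negbTE zy' : z != y by apply: contraNneq zy => ->.
rewrite zy'; split=> //; apply/eqP => E; apply: jy.
by have [-> _ _] := ss _ _ (esym E).
Qed.

(** The walk moves only elements whose choice is already at least [p], and each eviction refills the
    slot. So the core stays the same, no smaller choice changes, and a free slot is used up exactly
    when the walk ends with [Done]. *)
Lemma walk_spec (h : H) f s y : sound h s (Some y) -> 0 < choice s y ->
  (forall z, choice s z <= p.+1) ->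
  let: (s', o, k) := walk h f s y in
  [/\ sound h s' (if o is Out z then Some z else None),
      forall z, choice s' z <= p.+1,
      forall z, choice s' z = choice s z \/ p <= choice s z /\ p <= choice s' z,
      if o is Out z then 0 < choice s' z < p else true
    & #|free_slots s'| + (if o is Done then 1 else 0) = #|free_slots s| /\ k <= f.+1].
Proof.
elim: f s y => [|f IH] s y ss c0 cs /=; case: (ltnP (choice s y) p) => cy;
  do ?[by split=> //; [move=> z; left | rewrite c0 | rewrite addn0]];
  set i := if _ then _ else _; have i0 : 0 < i by rewrite /i; case: ifP.
all: have ip : p <= i <= p.+1 by rewrite /i; case: ifP; rewrite ?leqnn ?leqnSn.
all: have cs' z : choice (place h s y i) z <= p.+1 by rewrite /=; case: eqP => //; case/andP: ip.
all: have ch z : choice (place h s y i) z = choice s z \/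
                  p <= choice s z /\ p <= choice (place h s y i) z
  by rewrite /=; case: (z =P y) => [->|_]; [right; case/andP: ip | left].
all: have := sound_place i0 ss; have := card_free_place h s y i.
all: case E: (occ s _) => [z|] /= cf sp.
- split=> //.
  by move=> j z' oz'; have [] := sp _ _ oz'.
- by split.
- have [_ cz _] := ss _ _ E.
  have := IH _ _ sp (_ : 0 < choice (place h s y i) z) cs'.
  have cz' : 0 < choice (place h s y i) z by rewrite /=; case: eqP.
  move/(_ cz'); case: walk => [[s' o] k] [sp' cs'' ch' nc [cf' kf]].
  split=> //; last by rewrite cf' -cf addn0.
  move=> z'; case: (ch z') (ch' z') => [<-|[c1 c2]] [->|[c3 c4]]; by [left|right].
- by split.
Qed.

End Walk.

(** * The machine that reveals hash values on demand *)

Section Machine.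
Local Open Scope nat_scope.
Variables (U : finType) (n p lim : nat).
Local Notation H := (hashes U n p).
Local Notation table := (table U n).
Hypothesis p_gt0 : 0 < p.

(* [hh] memorizes the hash values revealed so far; [cur] is the pending element
   with the index of its next fresh probe; [core] lists in order of arrival the
   elements that were ever moved to h_{d-1}. *)
Record mstate := MState {
  hh : H; tb : table; cur : option (U * nat); todo : seq U; core : seq U;
  dead : bool; time : nat }.

Definition ask (s : mstate) : {set 'I_p.+1 * U} :=
  if cur s is Some (x, i) then
    if i < p then [set (inord i.-1, x)] else [set (inord p.-1, x); (inord p, x)]
  else finset.set0.

(** Coordinate [q.1] holds the hash function numbered [q.1 + 1]. An element placed at h_i has had
    h_1, ..., h_i read, and a core element all of them, as h_{d-1} and h_d are read together. *)
Definition dom (s : mstate) : {set 'I_p.+1 * U} :=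
  [set q : 'I_p.+1 * U | [|| q.1 < choice (tb s) q.2, p <= choice (tb s) q.2
             | if cur s is Some (x, i) then (q.2 == x) && (q.1.+1 < i) else false]].

Definition upd (s : mstate) (h : H) : H := mix (ask s) h (hh s).

(* A join (i = p) reveals both h_{d-1}(x) and h_d(x), so that the walk which
   follows uses only memorized hash values. *)
Definition nxt (s : mstate) (h : H) : mstate :=
  let g := upd s h in
  match cur s with
  | None =>
      if todo s is x :: l then MState g (tb s) (Some (x, 1)) l (core s) (dead s) 0
      else s
  | Some (x, i) =>
      if i < p then
        if occ (tb s) (hash g i x) then
          MState g (tb s) (Some (x, i.+1)) (todo s) (core s) (dead s) (time s).+1
        else
          MState g (place g (tb s) x i) None (todo s) (core s) (dead s) (time s).+1
      else if occ (tb s) (hash g p x) is Some y then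
        let: (t, o, k) := walk g lim.-1 (place g (tb s) x p) y in
        MState g t (if o is Out z then Some (z, (choice t z).+1) else None)
          (if o is Fail then [::] else todo s) (rcons (core s) x)
          (if o is Fail then true else dead s) (time s + k).+1
      else MState g (place g (tb s) x p) None (todo s) (rcons (core s) x)
             (dead s) (time s).+1
  end.

(** [K] is the total number of insertions planned, so [minv_free] leaves more than n - K free slots
    while an element is pending. It is an inequality because a failure discards the elements still
    to come. *)
Record minv (K : nat) (s : mstate) : Prop := MInv {
  minv_sound : sound (hh s) (tb s) (omap fst (cur s));
  minv_le : forall y, choice (tb s) y <= p.+1;
  minv_core : uniq (core s) /\ forall y, (y \in core s) = (p <= choice (tb s) y);
  minv_cur : if cur s is Some (x, i) then choice (tb s) x < i <= p else true;
  minv_free : n + isSome (cur s) + size (todo s) <= #|free_slots (tb s)| + K;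
  minv_todo : uniq (todo s) /\ forall y, y \in todo s ->
                choice (tb s) y = 0 /\ Some y != omap fst (cur s) }.

Lemma ask_dom K s q : minv K s -> q \in ask s -> q \notin dom s.
Proof.
move=> Is; have := minv_cur Is; rewrite /ask /dom; case: (cur s) => [[x i]|]; rewrite ?inE //.
case/andP=> cx ip.
have pi := leq_ltn_trans (leq0n _) cx.
case: ifP => ipp; rewrite !inE.
  by move=> /eqP -> /=; rewrite eqxx inordK; lia.
have -> : i = p by lia.
by case/orP => /eqP -> /=; rewrite eqxx inordK; lia.
Qed.

Lemma sound_agree (g g' : H) t oy : 
  (forall j z, occ t j = Some z -> hash g (choice t z) z = hash g' (choice t z) z) ->
  sound g t oy -> sound g' t oy.
Proof. by move=> gg st j z oz; have [jz cz zy] := st _ _ oz; rewrite -(gg _ _ oz) in jz *. Qed.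

Lemma upd_dom K s h q : minv K s -> q \in dom s -> upd s h q = hh s q.
Proof.
move=> Is qd; rewrite ffunE; case: ifP => // /(ask_dom Is); by rewrite qd.
Qed.

Lemma upd_sound K s h : minv K s -> sound (upd s h) (tb s) (omap fst (cur s)).
Proof.
move=> Is; have ss := minv_sound Is; apply: sound_agree (ss) => j z /ss[_ cz _].
rewrite /hash (upd_dom h Is) //; rewrite inE /=; apply/orP; left.
by rewrite inordK; [rewrite prednK | have := minv_le Is z; lia].
Qed.

Lemma minv_nxt K s h : minv K s -> minv K (nxt s h).
Proof.
move=> Is; have us := upd_sound h Is; case: (Is) => ss cs [uc cc] cu fr [ut ct].
move: us ss cu fr ct; rewrite /nxt; case: (cur s) => [[x i]|] us ss /=; last first.
  move=> _ fr ct; case Et: (todo s) ut ct fr => [|y l] ut ct fr.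
    exact: Is.
  have /andP[yl ul] := ut.
  split=> //=.
  - move=> j z oz; have [jz cz _] := us _ _ oz; split=> //; apply/eqP => -[zy].
    by have [] := ct y (mem_head _ _); rewrite -zy; move: cz; case: (choice _ _).
  - by rewrite (ct y (mem_head _ _)).1 p_gt0.
  - by move: fr => /=; lia.
  - split=> // z zl; split; first by apply: (ct z _).1; rewrite inE zl orbT.
    by apply: contra yl => /eqP[<-].
move=> /andP[cx ip] fr ct.
have i0 := leq_ltn_trans (leq0n _) cx.
have xcore : (x \in core s) = false by rewrite cc; lia.
case: (ltnP i p) => ipp.
  case: ifP => [oc|ofr].
    split=> //=.
    by rewrite ltnW.
  have := sound_place i0 us; move/negbT: ofr; have := card_free_place (upd s h) (tb s) x i.
  case: (occ _ (hash _ i x)) => // cf _ sp.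
  split=> //=.
  - by move=> y; case: eqP => // _; lia.
  - by split=> // y; rewrite cc; case: (y =P x) => // ->; lia.
  - by move: cf; rewrite /= addn1; lia.
  - split=> // y yt; have [cy yx] := ct y yt; split=> //.
    by case: (y =P x) yx => // -> ; rewrite eqxx.
have {}ip : i = p by lia.
have cs' y : choice (place (upd s h) (tb s) x p) y <= p.+1 by rewrite /=; case: eqP => // _.
have := sound_place p_gt0 us; have := card_free_place (upd s h) (tb s) x p.
have cc' y : (y \in rcons (core s) x) = (p <= choice (place (upd s h) (tb s) x p) y).
  by rewrite mem_rcons inE /= cc; case: (y =P x) => //= _; rewrite leqnn.
have uc' : uniq (rcons (core s) x) by rewrite rcons_uniq xcore.
have ct' y : y \in todo s -> y != x by move=> /ct[_]; apply: contraNneq => ->.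
case Eo: (occ _ _) => [y|] cf sp; last first.
  split=> //=; first by move: cf => /=; lia.
  by split=> // y yt; have [cy yx] := ct y yt; rewrite (negbTE (ct' _ yt)).
have cy0 : 0 < choice (place (upd s h) (tb s) x p) y.
  by rewrite /=; case: eqP => // _; have [] := us _ _ Eo.
have := @walk_spec U n p p_gt0 (upd s h) lim.-1 _ y sp cy0 cs'.
case: walk => [[t o] k] [sp' cs'' ch nc [cf' _]].
have cc'' z : (z \in rcons (core s) x) = (p <= choice t z).
  by rewrite cc'; case: (ch z) => [->|[-> ->]].
split=> //=.
- by case: o sp' {nc cf'}.
- by case: o nc {sp' cf'} => //= z /andP[_ zp]; rewrite leqnn.
- by move: cf cf' => /=; case: o {sp' nc} => [|z|] /=; rewrite ?addn0; lia.
- suff ct'' z : z \in todo s -> choice t z = 0 /\ 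
      Some z != omap fst (if o is Out z0 then Some (z0, (choice t z0).+1) else None).
    by case: o ct'' {sp' nc cf'} => *; split.
  move=> zt; have [cz _] := ct z zt.
  have := ch z; rewrite /= (negbTE (ct' _ zt)) cz leqNgt p_gt0 /= => -[ctz|[]//].
  split=> //; case: o nc {sp' cf'} => //= z' /andP[cz' _].
  by apply: contraTneq cz' => -[<-]; rewrite ctz.
Qed.
End Machine.

(** * Agreement with the algorithm *)

Section Sim.
Local Open Scope nat_scope.
Variables (U : finType) (n p lim : nat).
Local Notation H := (hashes U n p).
Local Notation table := (table U n).
Local Notation mstate := (mstate U n p).
Local Notation nxt := (@nxt U n p lim).
Local Notation exec := (exec nxt).
Hypotheses (p_gt0 : 0 < p) (lim_gt0 : 0 < lim).
Implicit Types (s : mstate) (h g : H).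

Lemma nxt_ask s h g : {in ask s, h =1 g} -> nxt s h = nxt s g.
Proof.
move=> hg; rewrite /nxt; suff -> : upd s h = upd s g by [].
by apply/ffunP => q; rewrite !ffunE; case: ifP => // /hg.
Qed.

Lemma dom_nxtE K s h : minv K s -> dom (nxt s h) = dom s :|: ask s.
Proof.
move=> Is; have us := upd_sound p_gt0 h Is; case: (Is) => _ cs [_ cc] cu _ _.
move: us cu; rewrite /nxt /dom /ask; case Ec: (cur s) => [[x i]|] us /=; last first.
  move=> _; case: (todo s) => [|y l] /=; rewrite finset.setU0; last first.
    by apply/setP => q; rewrite !inE /= andbF.
  by rewrite Ec.
move=> /andP[cx ip]; have i0 := leq_ltn_trans (leq0n _) cx.
case: (ltnP i p) => ipp.
  have ini : (inord i.-1 : 'I_p.+1) = i.-1 :> nat by rewrite inordK; lia.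
  have qE (q : 'I_p.+1 * U) : (q == (inord i.-1, x)) = (q.2 == x) && (q.1.+1 == i).
    case: q => j y; rewrite xpair_eqE andbC -val_eqE /= ini; congr (_ && _); lia.
  case: ifP => _; apply/setP => q; rewrite !inE qE /=; case: (q.2 =P x) => [->|_] /=; lia.
have {}ip : i = p by lia.
have qE (q : 'I_p.+1 * U) : (q \in [set (inord p.-1, x); (inord p, x)]) =
    (q.2 == x) && (p <= q.1.+1).
  case: q => j y; rewrite !inE !xpair_eqE -andb_orl andbC -!val_eqE /= !inordK; try lia.
  by congr (_ && _); have := ltn_ord j; lia.
have qp (q : 'I_p.+1 * U) : q.1 < p.+1 by exact: ltn_ord.
case Eo: (occ _ _) => [y|]; last first.
  apply/setP => q; rewrite [in RHS]finset.inE qE !inE /=; have := qp q.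
  by case: (q.2 =P x) => [->|_] /=; lia.
have cs' z : choice (place (upd s h) (tb s) x p) z <= p.+1 by rewrite /=; case: eqP.
have cy0 : 0 < choice (place (upd s h) (tb s) x p) y.
  by rewrite /=; case: eqP => // _; have [] := us _ _ Eo.
have := sound_place p_gt0 us; rewrite Eo => sp.
have := @walk_spec U n p p_gt0 (upd s h) lim.-1 _ y sp cy0 cs'.
case: walk => [[t o] k] [_ cs'' ch _ _].
apply/setP => q; rewrite [in RHS]finset.inE qE !inE /=; have := qp q.
have := ch q.2; have := cs'' q.2 => /=.
have -> : (match (if o is Out z then Some (z, (choice t z).+1) else None) with
      | Some (x0, i0) => (q.2 == x0) && (q.1.+1 < i0) | None => false end)
   = (if o is Out z then (q.2 == z) && (q.1 < choice t z) else false) by case: o.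
case: o => [|z|]; rewrite ?orbF; first by case: (q.2 =P x) => [->|_] /=; lia.
- by case: (q.2 =P z) => [->|_]; case: (_ =P x) => [->|_] /=; lia.
- by case: (q.2 =P x) => [->|_] /=; lia.
Qed.

Lemma dom_nxt K s h q : minv K s -> q \in dom s -> q \in dom (nxt s h).
Proof. by move=> Is qs; rewrite (dom_nxtE h Is) inE qs. Qed.

Lemma ask_nxt K s h q : minv K s -> q \in ask s -> q \in dom (nxt s h).
Proof. by move=> Is qs; rewrite (dom_nxtE h Is) inE qs orbT. Qed.

Lemma minv_exec K h t s : minv K s -> minv K (exec h t s).
Proof. by apply: exec_inv => s' h'; apply: (minv_nxt lim p_gt0). Qed.

(** The algorithm sees all of [h], the machine only what it has revealed. Replacing the memory by
    [h] links the two: it commutes with steps as long as the memory agrees with [h] on [dom]. *)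
Definition sethh h s : mstate :=
  MState h (tb s) (cur s) (todo s) (core s) (dead s) (time s).

Lemma walk_agree h g f t y :
  (forall z, p <= choice t z -> hash g p z = hash h p z /\ hash g p.+1 z = hash h p.+1 z) ->
  walk g f t y = walk h f t y.
Proof.
elim: f t y => [|f IH] t y gh /=; case: (ltnP (choice t y) p) => // cy.
all: set i := if _ then _ else _.
all: have gi : hash g i y = hash h i y by have [] := gh y cy; rewrite /i; case: ifP.
all: have -> : place g t y i = place h t y i by rewrite /place gi.
all: rewrite gi; case: (occ _ _) => // z.
rewrite IH // => z' /=; case: (z' =P y) => [-> _|_]; exact: gh.
Qed.

Lemma nxt_sethh K s h : minv K s -> {in dom s, hh s =1 h} ->
  {in dom (nxt s h), hh (nxt s h) =1 h} /\ sethh h (nxt s h) = nxt (sethh h s) h.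
Proof.
move=> Is sh.
have uh : {in dom s :|: ask s, upd s h =1 h}.
  by move=> q; rewrite finset.inE orbC ffunE; case: ifP => //= _ /sh.
split.
  move=> q; rewrite (dom_nxtE h Is) => /uh <-; rewrite /nxt.
  case Ec: (cur s) => [[x i]|]; last first.
    case: (todo s) => //=; rewrite ffunE /ask Ec inE //.
  case: ifP => _; first by case: ifP.
  by case: (occ _ _) => // y; case: walk => [[]].
have hu : upd (sethh h s) h = h by apply/ffunP => q; rewrite ffunE; case: ifP.
case: (Is) => _ _ _ cu _ _; move: cu.
rewrite /nxt hu /=; case Ec: (cur s) => [[x i]|]; last by case: (todo s) => //= _; rewrite /sethh Ec.
move=> /andP[cx ip].
have i0 := leq_ltn_trans (leq0n _) cx.
case: (ltnP i p) => ipp.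
  have ux : hash (upd s h) i x = hash h i x.
    by apply: uh; apply/setUP; right; rewrite /ask Ec ipp; apply/set1P.
  by rewrite ux; case: ifP => _; rewrite /sethh /= /place ?ux.
have {}ip : i = p by lia.
have askE : ask s = [set (inord p.-1, x); (inord p, x)] by rewrite /ask Ec ip ltnn.
have u1 : hash (upd s h) p x = hash h p x.
  by apply: uh; apply/setUP; right; rewrite askE; apply/set2P; left.
have u2 : hash (upd s h) p.+1 x = hash h p.+1 x.
  by apply: uh; apply/setUP; right; rewrite askE; apply/set2P; right.
rewrite u1 /place u1 -/(place h (tb s) x p).
case: (occ _ _) => [y|]; last by [].
rewrite (@walk_agree h); first by case: walk => [[t o] k].
move=> z /=; case: (z =P x) => [-> _|_ cz] //.
by split; apply: uh; apply/setUP; left; rewrite inE /= cz orbT.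
Qed.

Lemma exec_sethh K s h t : minv K s -> {in dom s, hh s =1 h} ->
  {in dom (exec h t s), hh (exec h t s) =1 h} /\
  sethh h (exec h t s) = exec h t (sethh h s).
Proof.
move=> Is sh; elim: t => //= t [IH1 IH2].
by have [? ->] := nxt_sethh (minv_exec h t Is) IH1; rewrite IH2.
Qed.

Definition settle h (td cr : seq U) (dd : bool) (tau : nat) (r : table * outcome U * nat) :
    mstate :=
  let: (t, o, k) := r in
  MState h t (if o is Out z then Some (z, (choice t z).+1) else None)
    (if o is Fail then [::] else td) cr (if o is Fail then true else dd) (tau + k).

Definition settled (dd : bool) (td : seq U) (res : option table * nat) s : Prop :=
  [/\ cur s = None, time s = res.2
    & if res.1 is Some t then [/\ tb s = t, dead s = dd & todo s = td]
      else dead s /\ todo s = [::]].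

Lemma exec_probes h k s x i : hh s = h -> cur s = Some (x, i) -> i + k = p ->
  let j := find (fun i => ~~ isSome (occ (tb s) (hash h i x))) (iota i k) in
  exec h j s = MState h (tb s) (Some (x, i + j)) (todo s) (core s)
                 (dead s) (time s + j).
Proof.
elim: k s i => [|k IH] s i hs cs ik /=.
  by rewrite !addn0; case: s hs cs => /= *; subst.
have us : upd s h = h by apply/ffunP => q; rewrite ffunE hs if_same.
case: ifP => oc /=; first by rewrite !addn0; case: s hs cs {us oc} => /= *; subst.
have ip : i < p by lia.
set j := find _ _; have : nxt s h = MState h (tb s) (Some (x, i.+1)) (todo s)
  (core s) (dead s) (time s).+1.
  by rewrite /nxt us cs /= ip; move/negbFE: oc => ->.
move=> E; have := IH (nxt s h) i.+1; rewrite E /= -/j => IH'.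
by rewrite -[LHS]/(iter j.+1 (nxt^~ h) s) iterSr E [LHS]IH' //; [rewrite !addnS !addSn | lia].
Qed.

Definition noncores (t : table) := #|[pred z | choice t z < p]|.

Lemma noncores_place h t x i : p <= i -> noncores (place h t x i) + (choice t x < p) <= noncores t.
Proof.
move=> ip; have E : [pred z | choice (place h t x i) z < p] =i [predD1 [pred z | choice t z < p] & x].
  by move=> z; rewrite !inE /=; case: eqP => //= _; lia.
by rewrite /noncores (eq_card E) [X in _ <= X](cardD1 x) inE addnC.
Qed.

(** One machine step covers a whole walk, whereas the loop makes its moves one by one. The induction
    therefore compares the loop in the middle of a walk with the state in which [settle] has already
    completed it; after [r] counted evictions the walk survives [(lim - r).-1] more. *)
Lemma sim K h fuel r t y tau td cr dd :
  (choice t y < p \/ r < lim) -> (forall z, choice t z <= p.+1) ->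
  noncores t * lim.+1 + (lim - r) < fuel ->
  let s := settle h td cr dd tau (walk h (lim - r).-1 t y) in
  minv K s ->
  exists N, settled dd td (bubble_up_loop lim h fuel r t y tau) (exec h N s).
Proof.
elim: fuel r t y tau td cr => [|fuel IH] r t y tau td cr //.
move=> ry cs fu /=; rewrite /next_move /=.
have := cs y; case: (ltnP (choice t y) p) ry => cy ry csy.
  have -> : (choice t y == p.+1) = false by lia.
  have -> : (choice t y == p) = false by lia.
  set c := choice t y; have -> : walk h (lim - r).-1 t y = (t, Out y, 0).
    by case: (lim - r).-1 => [|f] /=; rewrite cy.
  rewrite /= -/c addn0; set s := MState _ _ _ _ _ _ _ => Is.
  have -> : (p.-1 - c) = p - c.+1 by lia.
  rewrite size_iota; set j := find _ _.
  have jle : j <= p - c.+1 by rewrite -[X in _ <= X](size_iota c.+1) find_size.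
  have := @exec_probes h (p - c.+1) s y c.+1 erefl erefl (subnKC cy).
  rewrite /= -/j => Ej; have := minv_exec h j Is; rewrite Ej => Ij.
  set sj := MState _ _ _ _ _ _ _ in Ej Ij.
  have uj : upd sj h = h by apply/ffunP => q; rewrite ffunE if_same.
  case: ltnP => jp.
    have oN : occ t (hash h (c.+1 + j) y) = None.
      have hs : has (fun i => ~~ isSome (occ t (hash h i y))) (iota c.+1 (p - c.+1)).
        by rewrite has_find size_iota.
      by have := nth_find 0 hs; rewrite -/j nth_iota //; case: (occ _ _).
    rewrite nth_iota // oN; exists j.+1.
    have -> : exec h j.+1 s = nxt sj h by rewrite /exec iterS -/(exec h j s) Ej.
    rewrite /nxt uj /sj /= (_ : c.+1 + j < p); last by lia.
    by rewrite oN /=; split=> //=; rewrite addnS.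
  have {jp jle} jE : j = p - c.+1 by lia.
  have nj : nxt sj h = if occ t (hash h p y) is Some z then
      settle h td (rcons cr y) dd (tau + j).+1 (walk h lim.-1 (place h t y p) z)
    else MState h (place h t y p) None td (rcons cr y) dd (tau + j).+1.
    rewrite /nxt uj /sj /= jE subnKC // ltnn.
    by case: (occ _ _) => // z; case: walk => [[? ?] ?]; rewrite addSn.
  have ej : exec h j.+1 s = nxt sj h by rewrite /exec iterS -/(exec h j s) Ej.
  case Eo: (occ _ _) nj => [z|] nj; last first.
    by exists j.+1; rewrite ej nj; split=> //=; rewrite jE addnS.
  have Isj := minv_nxt lim p_gt0 h Ij; rewrite nj in Isj.
  have [||||N HN] := IH 0 (place h t y p) z (tau + (p - c.+1).+1) td (rcons cr y).
  - by right.
  - by move=> z' /=; case: eqP.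
  (* A join lowers [noncores] by one, which pays for the reset of the counter [r]. *)
  - move: fu (noncores_place h t y (leqnn p)); rewrite cy addn1 subn0 => fu le.
    by have := leq_mul le (leqnn lim.+1); rewrite mulSn; lia.
  - by rewrite subn0 addnS -jE.
  exists (N + j.+1); rewrite /exec iterD -/(exec h _ _) -/(exec h _ _) ej nj.
  by move: HN; rewrite subn0 addnS -jE.
have {}ry : r < lim by case: ry => //; rewrite ltnNge cy.
set i := if choice t y == p.+1 then p else p.+1.
have -> : (if choice t y == p.+1 then (p, 1, true)
  else if choice t y == p then (p.+1, 1, true)
  else let c := choice t y in
    let cand := iota c.+1 (p.-1 - c) in
    let j := find (fun i0 => ~~ isSome (occ t (hash h i0 y))) cand in
    if j < size cand then (nth 0 cand j, j.+1, false) else (p, (size cand).+1, false))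
  = (i, 1, true).
  by rewrite /i; case: (choice t y =P p.+1) => // ?; case: (choice t y =P p) => // ?; lia.
have ip : p <= i by rewrite /i; case: ifP.
have nc := noncores_place h t y ip; rewrite [_ < p]ltnNge cy addn0 in nc.
case Ef: (lim - r).-1 => [|f] /=; rewrite ltnNge cy /= -/i.
  case: (occ _ _) => [z|] Is; last by exists 0; split.
  have -> : lim <= r.+1 by lia.
  by exists 0; split.
case: (occ _ _) => [z|] Is; last by exists 0; split.
have -> : (lim <= r.+1) = false by lia.
have Ef' : f = (lim - r.+1).-1 by lia.
have E : settle h td cr dd tau (let '(s'', o, k) := walk h f (place h t y i) z in (s'', o, k.+1))
   = settle h td cr dd (tau + 1) (walk h f (place h t y i) z).
  by case: walk => [[t' o] k]; rewrite /= addn1 addSn addnS.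
rewrite E Ef' in Is *; apply: (IH r.+1 (place h t y i) z (tau + 1) td cr _ _ _ Is).
- by right; lia.
- by move=> z' /=; case: eqP => // _; rewrite /i; case: ifP.
- by have := leq_mul nc (leqnn lim.+1); lia.
Qed.

Lemma sim_insert K h x td cr dd t :
  let s := MState h t (Some (x, 1)) td cr dd 0 in
  minv K s -> choice t x = 0 ->
  exists N, settled dd td (bubble_up lim h t x) (exec h N s).
Proof.
move=> s Is cx; have cs := minv_le Is.
have E : s = settle h td cr dd 0 (walk h (lim - 0).-1 t x).
  by case: (lim - 0).-1 => [|f] /=; rewrite cx p_gt0 /= cx.
rewrite E in Is *; apply: sim Is => //; first by left; rewrite cx.
rewrite subn0 mulSn addnC addSn ltnS leq_add2l leq_mul2r; apply/orP; right.
exact: max_card.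
Qed.

Definition start h (xs : seq U) : mstate :=
  MState h (empty_table U n) None xs [::] false 0.

Lemma minv_start h xs : uniq xs -> minv (size xs) (start h xs).
Proof.
move=> ux; split=> //=.
- by split=> // y; rewrite in_nil leqNgt p_gt0.
- suff -> : #|free_slots (empty_table U n)| = n by rewrite addn0.
  by rewrite -[RHS](card_ord n); apply: eq_card => j; rewrite !inE.
Qed.

Lemma exec_stop h N s : cur s = None -> todo s = [::] -> exec h N s = s.
Proof. by move=> cs ts; elim: N => //= N; rewrite /exec /= => ->; rewrite /nxt cs ts. Qed.

Lemma sim_run K h s : minv K s -> hh s = h -> cur s = None -> dead s = false ->
  exists N, let s' := exec h N s in
  [/\ cur s' = None, todo s' = [::] &
     foldl (fun os x => obind (fun t => (bubble_up lim h t x).1) os) (Some (tb s)) (todo s)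
     = if dead s' then None else Some (tb s')].
Proof.
elim: (todo s) {-2}s (erefl (todo s)) => [|x l IH] {}s ts Is hs cs ds.
  by exists 0; rewrite /= ds ts.
have [_ /(_ x)] := minv_todo Is; rewrite ts mem_head => -[//|cx _].
have ns : nxt s h = MState h (tb s) (Some (x, 1)) l (core s) false 0.
  by rewrite /nxt cs ts ds; congr MState; apply/ffunP => q; rewrite ffunE hs if_same.
have := minv_nxt lim p_gt0 h Is; rewrite ns => Is1.
have [N [cN _ fN]] := sim_insert Is1 cx.
set s1 := exec h N _ in cN fN.
have E M : exec h (M + N.+1) s = exec h M s1.
  by rewrite /exec iterD iterSr -/(exec h _ _) ns.
rewrite /= ; case: (bubble_up lim h (tb s) x) fN => [[t|] tau] /= fN; last first.
  exists (0 + N.+1); rewrite E /= /exec /= cN; case: fN => -> ->; split=> //.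
  by elim: l {IH ts ns Is1 s1 cN E}.
case: fN => tN dN tdN.
have Is2 : minv K s1 := minv_exec h N Is1.
have hs1 : hh s1 = h.
  rewrite /s1; elim: (N) => //= M; rewrite /exec /= => {}IH; rewrite -[RHS]IH.
  set s2 := iter _ _ _ in IH *; have us : upd s2 h = h.
    by apply/ffunP => q; rewrite ffunE IH if_same.
  rewrite /nxt us; case: (cur s2) => [[y i]|]; last by case: (todo s2).
  case: ifP => _; first by case: ifP.
  by case: (occ _ _) => // z; case: walk => [[? ?] ?].
have [M] := IH s1 tdN Is2 hs1 cN dN; rewrite -E tN tdN => HM.
by exists (M + N.+1).
Qed.

End Sim.

(** * The algorithm as an eviction policy *)

Section Policy.
Local Open Scope nat_scope.
Variables (U : finType) (n p lim : nat).
Local Notation H := (hashes U n p).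
Local Notation table := (table U n).
Hypothesis p_gt0 : 0 < p.

Lemma next_move_bound (h : H) t x i k b : choice t x <= p.+1 ->
  next_move h t x = (i, k, b) -> 1 <= i <= p.+1.
Proof.
move=> cx; rewrite /next_move; case: eqP => [_ [<- _ _] /=|/eqP c1]; first by lia.
case: eqP => [_ [<- _ _]|/eqP c2] //=; set cand := iota _ _.
case: ifP => [fc|_] [<- _ _]; last by lia.
move: fc; rewrite /cand size_iota => fc; rewrite nth_iota //; lia.
Qed.

(** The hypotheses describe a valid table with [x] taken out of its slot, which is what an eviction
    leaves behind and also what a new element finds. *)
Lemma loop_evictions (h : H) S fuel r t x tau t' :
  x \in S -> choice t x <= p.+1 ->
  (forall z, z \in S -> z != x ->
     1 <= choice t z <= p.+1 /\ occ t (hash h (choice t z) z) = Some z) ->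
  (forall z, z \notin S -> choice t z = 0) ->
  (forall j z, occ t j = Some z -> [/\ z \in S, z != x & j = hash h (choice t z) z]) ->
  (bubble_up_loop lim h fuel r t x tau).1 = Some t' ->
  evictions h t x t' /\ valid_table h t' S.
Proof.
elim: fuel r t x tau => // fuel IH r t x tau xS cx pl np oc /=.
case E: next_move => [[i k] b]; have i1 := next_move_bound cx E.
have np' z : z \notin S -> choice (place h t x i) z = 0.
  by move=> zS /=; case: eqP zS => [->|_ /np//]; rewrite xS.
case Eo: (occ _ _) => [y|] /=; last first.
  case=> <-; split; first exact: evictions_free.
  split=> // [z zS|j z] /=.
    case: (z =P x) => [->|/eqP zx]; first by rewrite eqxx.
    have [cz oz] := pl z zS zx; split=> //; case: eqP => // jz.
    by rewrite -jz oz in Eo.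
  case: (j =P _) => [-> [<-]|jx oz]; first by rewrite eqxx.
  by have [zS /negbTE zx jz] := oc _ _ oz; rewrite zx.
have [yS yx jy] := oc _ _ Eo.
case: ifP => //= _ Es'.
have [] := IH _ (place h t x i) y _ yS _ _ np' _ Es'.
- by rewrite /= (negbTE yx); have [/andP[]] := pl y yS yx.
- move=> z zS zy /=; case: (z =P x) => [->|/eqP zx]; first by rewrite eqxx.
  have [cz oz] := pl z zS zx; split=> //; case: eqP => // jz.
  by move: oz; rewrite jz Eo => -[yz]; rewrite yz eqxx in zy.
- move=> j z /=; case: (j =P _) => [-> [<-]|jx oz]; first by rewrite eqxx eq_sym.
  have [zS zx jz] := oc _ _ oz; rewrite (negbTE zx); split=> //.
  by apply/eqP => zy; apply: jx; rewrite jy jz zy.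
by move=> ev va; split=> //; apply: evictions_evict Eo ev.
Qed.

Lemma bubble_up_policy : eviction_policy (@bubble_up U n p lim).
Proof.
move=> h t S x t' [v1 v2 v3] xS; have cx := v2 x xS.
apply: loop_evictions; rewrite ?mem_head ?cx //.
- by move=> z; rewrite inE => /orP[/eqP->|/v1//]; rewrite eqxx.
- by move=> z; rewrite inE negb_or => /andP[_ /v2].
- move=> j z /v3[zS jz]; rewrite inE zS orbT; split=> //.
  by apply: contraNneq xS => <-.
Qed.

End Policy.

(** * Walks in the core graph *)

Section Trace.
Local Open Scope nat_scope.
Variables (U : finType) (n p : nat).
Local Notation H := (hashes U n p).
Local Notation table := (table U n).
Hypothesis p_gt0 : 0 < p.
Variable h : H.

Definition edge (y : U) : 'I_n * 'I_n := (hash h p y, hash h p.+1 y).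

Definition same_ends (q t : 'I_n * 'I_n) : bool := (q == t) || (q == (t.2, t.1)).

Definition fits (ys : seq U) (tau : seq ('I_n * 'I_n)) : bool :=
  all2 (fun y => same_ends (edge y)) ys tau.

(* The edges of the path that starts in v and then visits ws, listed from its
   end to its start. *)
Fixpoint path_edges (v : 'I_n) (ws : seq 'I_n) : seq ('I_n * 'I_n) :=
  if ws is w :: ws' then (head v ws', w) :: path_edges v ws' else [::].

(** Distinct elements realise the listed edges; distinctness makes the probabilities of the edges
    multiply. *)
Definition embeds (cs : pred U) (tau : seq ('I_n * 'I_n)) : Prop :=
  exists ys, [/\ uniq ys, {subset ys <= cs} & fits ys tau].

Definition flip c := if c == p.+1 then p else p.+1.
Definition loc (s : table) y := hash h (choice s y) y.
Definition oth (s : table) y := hash h (flip (choice s y)) y.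
Definition move (s : table) y := place h s y (flip (choice s y)).

Lemma size_path_edges v ws : size (path_edges v ws) = size ws.
Proof. by elim: ws => //= w ws ->. Qed.

Lemma flip_bound c : p <= flip c <= p.+1.
Proof. by rewrite /flip; case: ifP; rewrite ?leqnn ?leqnSn. Qed.

Lemma same_ends_loc s y : p <= choice s y <= p.+1 -> same_ends (edge y) (loc s y, oth s y).
Proof.
move=> cy; have {cy} : (choice s y == p.+1) || (choice s y == p) by lia.
rewrite /same_ends /edge /loc /oth /flip; case: eqP => [->|_] /=; first by rewrite eqxx orbT.
by move/eqP=> ->; rewrite eqxx.
Qed.

Lemma same_ends_oth s y u : p <= choice s y <= p.+1 -> same_ends (edge y) (u, loc s y) -> oth s y = u.
Proof.
move=> /same_ends_loc; move: (edge y) (loc s y) (oth s y) => [a b] L O.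
rewrite /same_ends !xpair_eqE /=.
by move=> /orP[] /andP[/eqP-> /eqP->] /orP[] /andP[/eqP E1 /eqP E2]; rewrite -?E1 -?E2.
Qed.

Variable C : pred U.

Record wf (s : table) (y : U) : Prop := Wf {
  wf_sound : sound h s (Some y);
  wf_le : forall z, choice s z <= p.+1;
  wf_core : forall z, C z = (p <= choice s z) }.

Lemma wf_cy s y z : wf s y -> C z -> p <= choice s z <= p.+1.
Proof. by move=> W; rewrite (wf_core W) (wf_le W) andbT. Qed.

Lemma wf_move s y z : wf s y -> C y -> occ s (oth s y) = Some z -> wf (move s y) z.
Proof.
move=> [ss cs cc] Cy oz; have /andP[p1 p2] := flip_bound (choice s y).
split=> [|z'|z'].
- by rewrite -oz; apply: sound_place => //; apply: leq_trans p1.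
- by rewrite /=; case: eqP.
- by rewrite /= cc; case: eqP => // ->; rewrite p1 -cc Cy.
Qed.

Lemma loc_move s y z : z != y -> loc (move s y) z = loc s z.
Proof. by rewrite /loc /= => /negbTE ->. Qed.

Lemma walkE f s y : walk h f s y =
  if choice s y < p then (s, Out y, 0) else
  if occ s (oth s y) is Some z then
    if f is f'.+1 then
      let: (s'', o, k) := walk h f' (move s y) z in (s'', o, k.+1)
    else (move s y, Fail U, 1)
  else (move s y, Done U, 1).
Proof. by case: f. Qed.

Lemma walk_fail f s y t k : walk h f s y = (t, Fail U, k) -> k = f.+1.
Proof.
elim: f s y k => [|f IH] s y k; rewrite walkE; case: ifP => // _; case: (occ _ _) => // z.
  by case.
by case E: walk => [[s' o] k'] [tE oF <-]; rewrite oF tE in E; rewrite (IH _ _ _ E).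
Qed.

Definition holds (s : table) (st : seq ('I_n * U)) :=
  forall u e, (u, e) \in st -> occ s u = Some e.

Lemma holds_uniq s y st : wf s y -> holds s st -> uniq (unzip1 st) ->
  uniq (unzip2 st) /\ y \notin unzip2 st.
Proof.
move=> W; elim: st => //= -[u e] st IH hst /andP[ust us].
have [//|ue ye] := IH _ us; first by move=> u' e' ue; apply: hst; rewrite inE ue orbT.
have oe : occ s u = Some e by apply: hst; rewrite mem_head.
have [ue' _ ey] := wf_sound W oe; split.
  rewrite ue andbT; apply: contra ust => /mapP[[u' e'] ue1 /= ee'].
  have /(wf_sound W)[u'e' _ _] : occ s u' = Some e' by apply: hst; rewrite inE ue1 orbT.
  by rewrite ue' ee' -u'e'; apply/mapP; exists (u', e').
by rewrite inE negb_or ye andbT; apply: contra ey => /eqP->.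
Qed.

Definition goodpath (v : 'I_n) (nw : seq ('I_n * U)) :=
  fits (unzip2 nw) (path_edges v (unzip1 nw)) /\ {subset unzip2 nw <= C}.

(* A stack lists visited slots with their occupants, the latest first. *)
Record finv st v s y nw : Prop := Finv {
  finv_wf : wf s y;
  finv_loc : loc s y = head v (unzip1 nw);
  finv_holds : holds s (nw ++ st);
  finv_uniq : uniq (unzip1 (nw ++ st));
  finv_path : goodpath v nw }.

Lemma goodpath_cons v nw s y : wf s y -> C y -> loc s y = head v (unzip1 nw) ->
  goodpath v nw -> goodpath v ((oth s y, y) :: nw).
Proof.
move=> W Cy ly [fn sn]; split.
  by rewrite /fits /= -ly same_ends_loc ?(wf_cy W Cy).
by move=> z; rewrite inE => /orP[/eqP->|/sn].
Qed.

(** Up to the first move into a visited slot, slots and moved elements are pairwise distinct, so the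
    moves trace a path in the core graph. The second case stops just before that move; the slots of
    [st], visited earlier, count as well. *)
Lemma walk_forward st v f s y nw t o k : finv st v s y nw ->
  walk h f s y = (t, o, k) ->
  (exists nw', [/\ size nw' = size nw + k, uniq (unzip1 (nw' ++ st)),
                uniq (unzip2 (nw' ++ st)) & goodpath v nw'])
  \/ (exists nw' s' y' f' k', [/\ finv st v s' y' nw', C y',
        oth s' y' \in unzip1 (nw' ++ st), walk h f' s' y' = (t, o, k')
      & size nw' + k' = size nw + k]).
Proof.
elim: f s y nw k => [|f IH] s y nw k F E; have [W ly hs us gp] := F.
all: have [ue ye] := holds_uniq W hs us.
all: case: (boolP (C y)) => Cy; last first.
1,3: left; exists nw; move: E; rewrite walkE ltnNge -(wf_core W) Cy /=.
1,2: by case=> _ _ <-; rewrite addn0.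
all: case: (boolP (oth s y \in unzip1 (nw ++ st))) => ov.
1: by right; exists nw, s, y, 0, k.
2: by right; exists nw, s, y, f.+1, k.
all: have gp' := goodpath_cons W Cy ly gp.
all: have us' : uniq (unzip1 (((oth s y, y) :: nw) ++ st)) by rewrite /= ov.
all: have ue' : uniq (unzip2 (((oth s y, y) :: nw) ++ st)) by rewrite /= ye.
all: move: E; rewrite walkE ltnNge -(wf_core W) Cy /=; case Eo: (occ _ _) => [z|].
1,2,4: by case=> _ _ <-; left; exists ((oth s y, y) :: nw); rewrite addn1.
case E: walk => [[t' o'] k'] [tE oE <-]; rewrite {}tE {}oE in E.
have F' : finv st v (move s y) z ((oth s y, y) :: nw).
  have W' := wf_move W Cy Eo; split=> //=.
  - have [zl _ zy] := wf_sound W Eo; rewrite loc_move //.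
  - move=> u e; rewrite inE => /orP[/eqP[-> ->] /=|ue1 /=]; first by rewrite eqxx.
    case: eqP => [uo|_]; last exact: hs.
    by case/negP: ov; rewrite /oth -uo; apply/mapP; exists (u, e).
have [] := IH _ _ _ _ F' E.
  by case=> nw' [sz *]; left; exists nw'; split=> //; rewrite sz /= addSnnS.
case=> nw' [s' [y' [f' [k2 [*]]]]]; right; exists nw', s', y', f', k2; split=> //.
by rewrite -addSnnS.
Qed.

(** Once a cycle is closed, the elements of [used] fill the slots [vis] with [y] left over, and
    moves inside [vis] only rearrange them. *)
Record winv (s : table) y (vis : seq 'I_n) (used : seq U) : Prop := Winv {
  winv_wf : wf s y;
  winv_mem : y \in used;
  winv_used : forall z, z \in used -> z != y -> loc s z \in vis /\ occ s (loc s z) = Some z;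
  winv_vis : forall w, w \in vis -> exists2 z, z \in used & occ s w = Some z }.

Lemma winv_move s y vis used : winv s y vis used -> C y -> oth s y \in vis ->
  exists z, occ s (oth s y) = Some z /\ winv (move s y) z vis used.
Proof.
move=> [W yu uu uv] Cy ov; have [z zu oz] := uv _ ov; exists z; split=> //.
have W' := wf_move W Cy oz; have [lz _ zy] := wf_sound W oz.
split=> // [z' z'u z'z | w wv].
  case: (z' =P y) => [->|/eqP z'y]; first by rewrite /loc /= !eqxx.
  rewrite loc_move // /move /=; have [lv ol] := uu _ z'u z'y; split=> //.
  case: eqP => // E; rewrite -/(oth s y) in E.
  by move: oz; rewrite -E ol => -[zz]; rewrite zz eqxx in z'z.
rewrite /=; case: eqP => _; [by exists y | exact: uv].
Qed.

(** Each stacked element came to its slot along the edge from the slot below it on the stack, so its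
    next move takes it back there and evicts the element below. Unless the walk fails on the way,
    this ends with [x] evicted from [a]. *)
Lemma walk_back a x vis used B s e w f t o k :
  winv s e vis used -> {subset used <= C} -> loc s e = w ->
  goodpath a ((w, e) :: B) ->
  holds s (B ++ [:: (a, x)]) -> uniq (unzip1 ((w, e) :: B ++ [:: (a, x)])) ->
  {subset unzip1 (B ++ [:: (a, x)]) <= vis} ->
  walk h f s e = (t, o, k) ->
  (o = Fail U /\ k <= (size B).+1) \/
  (exists s' f' k', [/\ winv s' x vis used, loc s' x = a,
     walk h f' s' x = (t, o, k') & k = (size B).+1 + k']).
Proof.
move=> + uC; elim: B s e w f k => [|[u' e'] B IH] s e w f k WI le [fw sw] hB uB vB E;
  have W := winv_wf WI; have Ce : C e by apply: sw; rewrite mem_head.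
  have oe : oth s e = a.
    by apply: same_ends_oth (wf_cy W Ce) _; move: fw; rewrite /fits /= andbT le.
  have ox : occ s a = Some x by apply: hB; rewrite mem_head.
  have av : a \in vis by apply: vB; rewrite mem_head.
  have := winv_move WI Ce; rewrite oe => /(_ av)[z []].
  rewrite ox => -[<-] WI'.
  move: E; rewrite walkE ltnNge -(wf_core W) Ce /= oe ox; case: f => [|f].
    by case=> _ <- <-; left.
  case E: walk => [[t' o'] k'] [tE oE <-]; rewrite {}tE {}oE in E; right.
  exists (move s e), f, k'; split=> //.
  by have [xl _ xe] := wf_sound W ox; rewrite loc_move //.
move: fw; rewrite /fits /= => /andP[fe fB].
have oe : oth s e = u' by apply: same_ends_oth (wf_cy W Ce) _; rewrite le.
have ox : occ s u' = Some e' by apply: hB; rewrite mem_head.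
have av : u' \in vis by apply: vB; rewrite mem_head.
have := winv_move WI Ce; rewrite oe => /(_ av)[z []].
rewrite ox => -[<-] WI'.
move: E; rewrite walkE ltnNge -(wf_core W) Ce /= oe ox; case: f => [|f].
  by case=> _ <- <-; left.
case E: walk => [[t' o'] k'] [tE oE <-]; rewrite {}tE {}oE in E.
have le' : loc (move s e) e' = u'.
  by have [xl _ xe] := wf_sound W ox; rewrite loc_move //.
move: uB => /= /and3P[_ uu' uB].
case: (IH _ _ _ _ _ WI' le' _ _ _ _ E).
- by split=> // z1 z1B; apply: sw; rewrite inE z1B orbT.
- move=> u1 e1 ue1; rewrite /= -/(oth s e) oe; case: eqP => [E1|_].
    by case/negP: uu'; rewrite -E1; apply/mapP; exists (u1, e1).
  by apply: hB; rewrite inE ue1 orbT.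
- by rewrite /= uu'.
- by move=> u1 u1B; apply: vB; rewrite inE u1B orbT.
- by case=> -> k'B; left; split.
- by case=> s' [f' [k2 [*]]]; right; exists s', f', k2; split=> //; lia.
Qed.

Lemma goodpath_drop v A B : goodpath v (A ++ B) -> goodpath v B.
Proof.
case=> fAB sAB; split; last by move=> z zB; apply: sAB; rewrite /unzip2 map_cat mem_cat zB orbT.
by elim: A fAB {sAB} => //= -[u e] A IH /andP[_ /IH].
Qed.

Lemma goodpath_embeds v nw : goodpath v nw -> uniq (unzip2 nw) ->
  embeds C (path_edges v (unzip1 nw)).
Proof. by case=> fn sn un; exists (unzip2 nw). Qed.

Lemma finv_start s x y a : wf s y -> occ s a = Some x -> loc s y = a ->
  finv [:: (a, x)] a s y [::].
Proof.
move=> W ox ly; split=> //.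
by move=> u e; rewrite inE => /eqP[-> ->].
Qed.

(* Two paths from v, closed at w1 and w2: the edges outnumber the vertices. *)
Definition lasso2 v ws1 w1 ws2 w2 :=
  ((head v ws2, w2) :: path_edges v ws2) ++ (head v ws1, w1) :: path_edges v ws1.

Lemma fits_cat ys zs sg tau : size ys = size sg ->
  fits (ys ++ zs) (sg ++ tau) = fits ys sg && fits zs tau.
Proof.
rewrite /fits; elim: ys sg => [|y ys IH] [|q sg] //= [/IH ->].
by rewrite andbA.
Qed.

(* When the walk first closes a cycle it retraces its steps to a, moves x to the
   other end of its edge and goes on from there; a second closure yields [lasso2]. *)
Lemma walk_fail_pattern f s x y a t k :
  wf s y -> occ s a = Some x -> loc s y = a -> C x ->
  walk h f s y = (t, Fail U, k) ->
  (exists v ws, embeds C (path_edges v ws) /\ f <= 3 * size ws) \/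
  (exists v ws1 w1 ws2 w2, [/\ w1 \in v :: ws1, w2 \in v :: ws1 ++ ws2
     & embeds C (lasso2 v ws1 w1 ws2 w2)]).
Proof.
move=> W ox ly Cx E; have kE := walk_fail E.
have uniqP (nw st : seq ('I_n * U)) : uniq (unzip2 (nw ++ st)) -> uniq (unzip2 nw).
  by rewrite /unzip2 map_cat cat_uniq => /and3P[].
case: (walk_forward (finv_start W ox ly) E) => [[nw [sz _ ue gp]]|].
  left; exists a, (unzip1 nw); split; last by rewrite size_map sz kE add0n; lia.
  exact: goodpath_embeds gp (uniqP _ _ ue).
case=> nw1 [s1 [y1 [f1 [k1 [F1 Cy1 o1 E1]]]]]; rewrite add0n kE => sz1.
have [W1 l1 h1 u1 g1] := F1; have [ue1 ye1] := holds_uniq W1 h1 u1.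
set st1 := nw1 ++ _ in o1 h1 u1 ue1 ye1.
have xst1 : (a, x) \in st1 by rewrite mem_cat mem_head orbT.
have path1 : f <= 3 * size nw1 ->
    exists v ws, embeds C (path_edges v ws) /\ f <= 3 * size ws.
  move=> fn; exists a, (unzip1 nw1); split; last by rewrite size_map.
  exact: goodpath_embeds g1 (uniqP _ _ ue1).
pose used := y1 :: unzip2 st1; pose vis := unzip1 st1.
have uC : {subset used <= C}.
  move=> z; rewrite inE => /orP[/eqP->//|]; rewrite /unzip2 map_cat mem_cat => /orP[/(proj2 g1)//|].
  by rewrite inE => /eqP->.
have WI1 : winv s1 y1 vis used.
  split=> // [|z|w]; first exact: mem_head.
    rewrite inE => /orP[/eqP->|/mapP[[u e] ue /= ->] _]; first by rewrite eqxx.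
    have oe := h1 _ _ ue; have [ul _ _] := wf_sound W1 oe; rewrite /loc -ul; split=> //.
    by apply/mapP; exists (u, e).
  case/mapP=> -[u e] ue /= ->; exists e; last exact: h1.
  by rewrite inE; apply/orP; right; apply/mapP; exists (u, e).
have [z [oz WIz]] := winv_move WI1 Cy1 o1.
move: E1; rewrite walkE ltnNge -(wf_core W1) Cy1 /= oz; case: f1 => [|f2].
  by case=> _ k1E; left; apply: path1; move: sz1 k1E; clear; lia.
case E2: walk => [[t' o'] k2] [tE oE k1E]; rewrite {}tE {}oE in E2.
have W2 := winv_wf WIz.
have zst : (oth s1 y1, z) \in st1.
  case/mapP: o1 => -[u e] ue /= uE; rewrite uE (h1 _ _ ue) in oz *.
  by case: oz => <-.
have xy1 : x != y1.
  by apply: contraNneq ye1 => <-; apply/mapP; exists (a, x).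
have : (k2 <= size nw1) \/ (exists s3 f3 k3, [/\ winv s3 x vis used, loc s3 x = a,
     walk h f3 s3 x = (t, Fail U, k3) & k2 <= size nw1 + k3]).
  move: (zst); rewrite mem_cat => /orP[znw|]; last first.
    rewrite inE => /eqP[_ zx]; rewrite zx in E2 WIz; right.
    exists (move s1 y1), f2, k2; split=> //; last exact: leq_addl.
    by rewrite loc_move //; have [] := wf_sound W1 (h1 _ _ xst1).
  have [A [B nw1E]] : exists A B, nw1 = A ++ (oth s1 y1, z) :: B.
    by case/splitPr: znw => A B; exists A, B.
  have uzB : uniq (unzip1 ((oth s1 y1, z) :: B ++ [:: (a, x)])).
    by move: u1; rewrite /st1 nw1E -catA /= /unzip1 map_cat cat_uniq => /and3P[].
  have stB q : q \in B ++ [:: (a, x)] -> q \in st1.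
    by rewrite /st1 nw1E -catA cat_cons => qB; rewrite mem_cat inE qB !orbT.
  have lz : loc (move s1 y1) z = oth s1 y1.
    by have [-> _ zy] := wf_sound W1 oz; rewrite loc_move.
  have gB : goodpath a ((oth s1 y1, z) :: B).
    by apply: (@goodpath_drop _ A); rewrite -nw1E.
  have hB : holds (move s1 y1) (B ++ [:: (a, x)]).
    move=> u e ue /=; case: eqP => [uE|_]; last by apply: h1; apply: stB.
    case/andP: uzB => /negP[]; rewrite /oth -uE; apply/mapP; exists (u, e) => //.
  have vB : {subset unzip1 (B ++ [:: (a, x)]) <= vis}.
    by move=> u /mapP[q qB ->]; apply/mapP; exists q => //; apply: stB.
  have sB : size B < size nw1 by rewrite nw1E size_cat /= addnS ltnS leq_addl.
  case: (walk_back WIz uC lz gB hB uzB vB E2) => [[_ k2B]|]; first by left; apply: leq_trans sB.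
  by case=> s3 [f3 [k3 [WI3 l3 E3 ->]]]; right; exists s3, f3, k3; rewrite leq_add2r.
have fE : f = size nw1 + k2 by move: sz1 k1E; clear; lia.
case=> [k2s|[s3 [f3 [k3 [WI3 l3 E3 k23]]]]].
  by left; apply: path1; move: fE k2s; clear; lia.
have W3 := winv_wf WI3.
(* Retracing has rearranged the occupants of [vis], so the stack is rebuilt from the current table;
   [winv_vis] rules out the default [x]. *)
pose st3 := [seq (u, odflt x (occ s3 u)) | u <- vis].
have st3E : unzip1 st3 = vis.
  by rewrite /st3 /unzip1 -map_comp -[RHS]map_id; apply: eq_map.
have F3 : finv st3 a s3 x [::].
  split=> //=; last by rewrite st3E.
  move=> u e /mapP[w wv [-> ->]]; by have [z' _ ->] := winv_vis WI3 wv.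
(* All elements of [used] but [x] sit in visited slots, hence differ from those moved by the second
   path, which starts with [x] itself. *)
have used3 z' : z' \in used -> z' != x -> z' \in unzip2 st3.
  move=> zu zx; have [lv ol] := winv_used WI3 zu zx.
  by apply/mapP; exists (loc s3 z', z') => //; apply/mapP; exists (loc s3 z'); rewrite ?ol.
case: (walk_forward F3 E3) => [[nw [sz _ ue gp]]|].
  (* Forward part, retracing and second part are each at most as long as the longer of the two
     paths, hence the factor 3. *)
  case: (leqP (size nw) (size nw1)) => sn.
    by left; apply: path1; move: fE k23 sz sn => /=; clear; lia.
  left; exists a, (unzip1 nw); split; last by rewrite size_map; move: fE k23 sz sn => /=; clear; lia.
  exact: goodpath_embeds gp (uniqP _ _ ue).
case=> nw2 [s4 [y4 [f4 [k4 [F4 Cy4 o4 _ _]]]]]; right.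
have [W4 l4 h4 u4 [f42 sub4]] := F4; have [ue4 ye4] := holds_uniq W4 h4 u4.
exists a, (unzip1 nw1), (oth s1 y1), (unzip1 nw2), (oth s4 y4); split.
- by move: o1; rewrite /st1 /unzip1 map_cat mem_cat /= !inE orbC.
- move: o4; rewrite /unzip1 map_cat mem_cat -/(unzip1 st3) st3E /vis /st1 /unzip1 map_cat.
  by rewrite !mem_cat !inE /= mem_cat; do 2![case: (_ \in map _ _) => //=]; rewrite ?orbT ?orbF.
have [f41 sub1] := g1.
exists ((y4 :: unzip2 nw2) ++ y1 :: unzip2 nw1); split.
- have d4 z' : z' \in y4 :: unzip2 nw2 -> z' \notin unzip2 st3.
    rewrite inE => /orP[/eqP->|zn].
      by move: ye4; rewrite /unzip2 map_cat mem_cat negb_or => /andP[].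
    by move: ue4; rewrite /unzip2 map_cat cat_uniq => /and3P[_ /hasPn d _]; apply: contraL zn => /d.
  rewrite cat_uniq; apply/and3P; split.
  + rewrite /= (uniqP _ _ ue4) andbT.
    by move: ye4; rewrite /unzip2 map_cat mem_cat negb_or => /andP[].
  + apply/hasPn => z' zn; apply: contraL (_ : z' \in unzip2 st3) => [/d4//|].
    apply: used3.
      move: zn; rewrite !inE => /orP[->//|zn]; rewrite /st1 /unzip2 map_cat mem_cat -/(unzip2 nw1) zn.
      by rewrite orbT.
    apply: contraTneq zn => ->; rewrite inE negb_or xy1 /=.
    move: ue1; rewrite /st1 /unzip2 map_cat cat_uniq => /and3P[_ /hasPn d _].
    by apply: d; rewrite mem_head.
  + rewrite /= (uniqP _ _ ue1) andbT.
    by move: ye1; rewrite /st1 /unzip2 map_cat mem_cat negb_or => /andP[].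
- move=> z'; rewrite mem_cat !inE => /orP[] /orP[/eqP->//|]; [exact: sub4|exact: sub1].
rewrite /lasso2 fits_cat; last by rewrite /= size_path_edges !size_map.
rewrite /fits /= -l4 -l1 !same_ends_loc ?(wf_cy W4) ?(wf_cy W1) //=.
by rewrite -/(fits _ _) f42.
Qed.
Definition reach (P : pred U) (a w : 'I_n) : Prop :=
  exists2 ws, w = head a ws & embeds P (path_edges a ws).

Definition closing (P : pred U) (a : 'I_n) : Prop :=
  exists ws w, w \in a :: ws /\ embeds P ((head a ws, w) :: path_edges a ws).

(** The first element of [N] along the path has an end that is reached by edges of [P] alone. As the
    list runs from the end of the path to its start, the tail is treated before the head. *)
Lemma goodpath_old (P N : pred U) a nw :
  goodpath a nw -> uniq (unzip2 nw) -> (forall y, y \in unzip2 nw -> P y \/ N y) ->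
  {subset unzip2 nw <= P} \/
  exists2 y, N y & reach P a (edge y).1 \/ reach P a (edge y).2.
Proof.
elim: nw => [|[w e] nw IH]; first by left.
move=> [/= /andP[ee fn] sn] /andP[en un] PN.
have gn : goodpath a nw by split=> // z zn; apply: sn; rewrite inE zn orbT.
have PNn z : z \in unzip2 nw -> P z \/ N z by move=> zn; apply: PN; rewrite inE zn orbT.
case: (IH gn un PNn); last by right.
move=> sP; case: (PN e (mem_head _ _)) => [Pe|Ne].
  by left=> z; rewrite inE => /orP[/eqP->|/sP].
have R : reach P a (head a (unzip1 nw)) by exists (unzip1 nw) => //; exists (unzip2 nw).
right; exists e => //; move: ee R; rewrite /same_ends /edge !xpair_eqE /=.
by case/orP => /andP[/eqP-> /eqP->]; [left|right].
Qed.

(** In use, [P] is the core before the current insertion and [N] what has joined since, apart from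
    [x], which has just been placed in [a]. Only the first case limits [k]; the other two are rare
    enough to be charged the maximal length of a walk. *)
Lemma walk_bound (P N : pred U) f s x y a t o k :
  wf s y -> occ s a = Some x -> loc s y = a ->
  (forall z, C z -> z = x \/ P z \/ N z) ->
  walk h f s y = (t, o, k) ->
  [\/ k < #|[pred w | `[< reach P a w >]]|, closing P a
    | exists2 y, N y & reach P a (edge y).1 \/ reach P a (edge y).2].
Proof.
move=> W ox ly PN E.
have PN' z : C z -> z != x -> P z \/ N z by move=> /PN[->|//]; rewrite eqxx.
have subx (nw : seq ('I_n * U)) : goodpath a nw -> uniq (unzip2 (nw ++ [:: (a, x)])) ->
    uniq (unzip2 nw) /\ forall z, z \in unzip2 nw -> P z \/ N z.
  case=> _ sn; rewrite /unzip2 map_cat cat_uniq => /and3P[un /hasPn d _]; split=> // z zn.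
  apply: PN' (sn _ zn) _; apply: contraTneq zn => ->; apply: d; exact: mem_head.
case: (walk_forward (finv_start W ox ly) E) => [[nw [sz us ue gp]]|].
  have [un PNn] := subx _ gp ue.
  case: (goodpath_old gp un PNn) => [sP|ex]; last by constructor 3.
  constructor 1; rewrite add0n in sz; rewrite -sz.
  have sP' w : w \in a :: unzip1 nw -> `[< reach P a w >].
    rewrite inE => /orP[/eqP->|/mapP[q qn ->]]; apply/asboolP.
      by exists [::] => //; exists [::].
    move: qn gp un sP; case/splitPr=> A B gp un sP.
    have [fB _] := goodpath_drop gp.
    exists (unzip1 (q :: B)); first by [].
    exists (unzip2 (q :: B)); split=> //.
      by move: un; rewrite /unzip2 map_cat cat_uniq => /and3P[].
    by move=> z zB; apply: sP; rewrite /unzip2 map_cat mem_cat zB orbT.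
  have ua : uniq (a :: unzip1 nw).
    move: us; rewrite /unzip1 map_cat cat_uniq => /and3P[u1 /hasPn d _].
    by rewrite /= u1 andbT; apply: d; rewrite mem_head.
  rewrite -(size_map fst nw) -[_ < _]/(size (a :: unzip1 nw) <= _) -(card_uniqP ua).
  by apply: subset_leq_card; apply/fintype.subsetP => w /sP'.
case=> nw [s4 [y4 [f4 [k4 [F4 Cy4 o4 _ _]]]]].
have [W4 l4 h4 u4 g4] := F4; have [ue4 ye4] := holds_uniq W4 h4 u4.
have [un PNn] := subx _ g4 ue4.
have ye4' : y4 \notin unzip2 nw /\ y4 != x.
  by move: ye4; rewrite /unzip2 map_cat mem_cat negb_or /= inE => /andP[].
case: (goodpath_old g4 un PNn) => [sP|ex]; last by constructor 3.
have ee : same_ends (edge y4) (head a (unzip1 nw), oth s4 y4).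
  by rewrite -l4 same_ends_loc ?(wf_cy W4).
case: (PN' _ Cy4 ye4'.2) => [Py|Ny].
  constructor 2; exists (unzip1 nw), (oth s4 y4); split.
    by move: o4; rewrite /unzip1 map_cat mem_cat /= !inE orbC.
  exists (y4 :: unzip2 nw); split; first by rewrite /= ye4'.1.
    by move=> z; rewrite inE => /orP[/eqP->|/sP].
  by rewrite /fits /= ee; case: g4.
have R : reach P a (head a (unzip1 nw)).
  by exists (unzip1 nw) => //; exists (unzip2 nw); split=> //; case: g4.
constructor 3; exists y4 => //; move: ee R; rewrite /same_ends /edge !xpair_eqE /=.
by case/orP => /andP[/eqP-> /eqP->]; [left|right].
Qed.

End Trace.

(** * Single steps of the machine *)

Section Steps.
Local Open Scope nat_scope.
Variables (U : finType) (n p lim : nat).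
Local Notation H := (hashes U n p).
Local Notation table := (table U n).
Local Notation mstate := (mstate U n p).
Local Notation nxt := (@nxt U n p lim).
Hypotheses (p_gt0 : 0 < p) (lim_gt0 : 0 < lim).
Implicit Types (s : mstate) (h g : H).

(* The number of fresh probes made so far. *)
Definition work s : nat :=
  \sum_y minn (choice (tb s) y) p
  + (if cur s is Some (x, i) then i.-1 - choice (tb s) x else 0).

Lemma hh_nxt s h : hh (nxt s h) = upd s h.
Proof.
rewrite /nxt; case Ec: (cur s) => [[x i]|]; last first.
  by case: (todo s) => //; apply/ffunP => q; rewrite ffunE /ask Ec inE.
case: ifP => _; first by case: ifP.
by case: (occ _ _) => // y; case: walk => [[? ?] ?].
Qed.

Lemma upd_probe s h x i : 0 < i -> i <= p -> cur s = Some (x, i) ->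
  hash (upd s h) i x = h (inord i.-1, x).
Proof.
move=> i0 ip cs; rewrite /hash ffunE /ask cs; case: (ltnP i p) => pi.
  by rewrite finset.inE eqxx.
by have -> : i = p by [lia]; rewrite !inE eqxx.
Qed.

Lemma upd_second s h x : cur s = Some (x, p) -> hash (upd s h) p.+1 x = h (inord p, x).
Proof. by move=> cs; rewrite /hash ffunE /ask cs ltnn !inE eqxx orbT. Qed.

Lemma sum_choice_place g t x i : choice t x <= i <= p ->
  \sum_y minn (choice (place g t x i) y) p = \sum_y minn (choice t y) p + (i - choice t x).
Proof.
move=> ci; rewrite (bigD1 x) //= [in RHS](bigD1 x) //= eqxx.
rewrite (eq_bigr (fun y => minn (choice t y) p)); last by move=> y /negbTE ->.
lia.
Qed.

(** The probed slot [v] is read from the new [h] and not from the memory, so averaging bounds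
    expressed by [v] reduces to a sum over slots. *)
Lemma nxt_probe K s h x i : minv K s -> cur s = Some (x, i) ->
  let v := h (inord i.-1, x) in
  [/\ work (nxt s h) = (work s).+1,
      #|free_slots (tb (nxt s h))| + ~~ occ (tb s) v <= #|free_slots (tb s)|,
      ~~ occ (tb s) v -> cur (nxt s h) = None,
      time (nxt s h) <= (time s).+1 + (if i < p then 0 else if occ (tb s) v then lim else 0)
    & i < p -> core (nxt s h) = core s /\ dead (nxt s h) = dead s].
Proof.
move=> Is cs v; have us := upd_sound p_gt0 h Is.
have := minv_cur Is; rewrite cs => /andP[ci ip].
have i0 := leq_ltn_trans (leq0n _) ci.
have := upd_probe h i0 ip cs; rewrite -/v /work => hv.
rewrite /nxt cs; case: (ltnP i p) => pi.
  rewrite hv; case Ev: (occ _ v) => [y|] /=.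
    by split=> //; rewrite ?addn0 //; lia.
  split=> //; rewrite ?addn0 //.
    by rewrite (sum_choice_place (upd s h)); lia.
  by have := card_free_place (upd s h) (tb s) x i; rewrite hv Ev /=; lia.
have {}ip : i = p by lia.
rewrite ip in hv ci *; rewrite hv; have ci' : choice (tb s) x <= p <= p by rewrite leqnn ltnW.
have := card_free_place (upd s h) (tb s) x p; rewrite hv.
case Ev: (occ _ v) => [y|] /= cf; last first.
  split=> //; rewrite ?addn0 //; last by lia.
  by rewrite (sum_choice_place (upd s h) ci'); lia.
have cs' z : choice (place (upd s h) (tb s) x p) z <= p.+1.
  by rewrite /=; case: eqP => // _; apply: minv_le Is _.
have cy0 : 0 < choice (place (upd s h) (tb s) x p) y.
  rewrite /=; case: eqP => // _; rewrite cs in us; have [] := us _ _ Ev; done.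
rewrite cs in us; have sp := sound_place p_gt0 us; rewrite hv Ev in sp.
have := @walk_spec U n p p_gt0 (upd s h) lim.-1 _ y sp cy0 cs'.
case: walk => [[t o] k] [_ cs'' ch nc [cf' kf]] /=.
have sE : \sum_z minn (choice t z) p = \sum_z minn (choice (place (upd s h) (tb s) x p) z) p.
  by apply: eq_bigr => z _; case: (ch z) => [->//|[c1 c2]]; rewrite (minn_idPr c1) (minn_idPr c2).
split=> //; try lia.
- rewrite sE (sum_choice_place (upd s h) ci').
  by case: o {nc cf'} => [|z|] /=; rewrite ?subnn; lia.
- by move: cf cf' => /=; lia.
Qed.

Lemma nxt_idle s h : cur s = None ->
  [/\ work (nxt s h) = work s, tb (nxt s h) = tb s, core (nxt s h) = core s
    & dead (nxt s h) = dead s].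
Proof.
move=> cs; rewrite /work /nxt cs; case: (todo s) => [|x l] /=; first by rewrite cs.
by rewrite sub0n.
Qed.

Lemma core_work K s : minv K s -> p * size (core s) <= work s.
Proof.
move=> Is; have [uc cc] := minv_core Is; apply: leq_trans (leq_addr _ _).
rewrite -(card_uniqP uc) mulnC -sum_nat_const [X in _ <= X](bigID [in core s]) /=.
apply: leq_trans (leq_addr _ _); apply: leq_sum => y; rewrite cc; lia.
Qed.

Lemma edge_nxt K s h y : minv K s -> y \in core s ->
  edge (hh (nxt s h)) y = edge (hh s) y.
Proof.
move=> Is; rewrite (proj2 (minv_core Is)) hh_nxt => cy.
by rewrite /edge /hash !(upd_dom p_gt0 h Is) // inE /= cy orbT.
Qed.

Lemma nxt_join K s h x : minv K s -> cur s = Some (x, p) ->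
  [/\ core (nxt s h) = rcons (core s) x, x \notin core s
    & edge (hh (nxt s h)) x = (h (inord p.-1, x), h (inord p, x))].
Proof.
move=> Is cs; have := minv_cur Is; rewrite cs => /andP[cx _].
rewrite hh_nxt /edge (upd_probe _ p_gt0 (leqnn p) cs) (upd_second _ cs).
rewrite (proj2 (minv_core Is)) -ltnNge cx; split=> //.
rewrite /nxt cs ltnn; case: (occ _ _) => // y.
by case: walk => [[]].
Qed.

Lemma core_nxt K s h y : minv K s -> y \in core s -> y \in core (nxt s h).
Proof.
move=> Is yc; case cs: (cur s) => [[x i]|]; last first.
  by have [_ _ -> _] := nxt_idle h cs.
case: (ltnP i p) => ip.
  by have [_ _ _ _ /(_ ip)[-> _]] := nxt_probe h Is cs.
have ipE : i = p by have := minv_cur Is; rewrite cs; lia.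
rewrite ipE in cs; have [-> _ _] := nxt_join h Is cs.
by rewrite mem_rcons inE yc orbT.
Qed.

Lemma nxt_join_walk K s h x y : minv K s -> cur s = Some (x, p) ->
  let v := h (inord p.-1, x) in let g := hh (nxt s h) in
  occ (tb s) v = Some y ->
  let t := place g (tb s) x p in
  [/\ wf g [pred z in core (nxt s h)] t y, occ t v = Some x, loc g t y = v
    & exists t' o k, [/\ walk g lim.-1 t y = (t', o, k),
         dead (nxt s h) = (if o is Fail then true else dead s)
       & time (nxt s h) = (time s + k).+1]].
Proof.
move=> Is cs v g Ev t; have [cE xc _] := nxt_join h Is cs.
have := upd_probe h p_gt0 (leqnn p) cs; rewrite -hh_nxt -/v -/g => hv.
have us := upd_sound p_gt0 h Is; rewrite cs -hh_nxt in us.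
have sp := sound_place p_gt0 us; rewrite hv Ev in sp.
have [lv _ yx] := us _ _ Ev.
have yx' : (y == x) = false by apply: contraNF yx => /eqP->.
split.
- split=> // z /=; first by case: eqP => // _; apply: (minv_le Is).
  rewrite cE mem_rcons inE (proj2 (minv_core Is)).
  by case: (z =P x) => //= _; rewrite leqnn.
- by rewrite /t /= hv eqxx.
- by rewrite /loc /t /= yx'.
rewrite {1 2}/nxt cs ltnn -hh_nxt -/g hv Ev.
case: walk => [[t' o] k]; exists t', o, k; split=> //.
Qed.

Lemma nxt_dead K s h : minv K s -> dead (nxt s h) ->
  dead s \/
  (exists v ws, embeds (hh (nxt s h)) [pred z in core (nxt s h)] (path_edges v ws)
     /\ lim.-1 <= 3 * size ws) \/
  (exists v ws1 w1 ws2 w2, [/\ w1 \in v :: ws1, w2 \in v :: ws1 ++ ws2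
     & embeds (hh (nxt s h)) [pred z in core (nxt s h)] (lasso2 v ws1 w1 ws2 w2)]).
Proof.
move=> Is; case cs: (cur s) => [[x i]|]; last first.
  by have [_ _ _ ->] := nxt_idle h cs; left.
have := minv_cur Is; rewrite cs => /andP[ci ip].
case: (ltnP i p) => pi.
  by have [_ _ _ _ /(_ pi)[_ ->]] := nxt_probe h Is cs; left.
have {}ip : i = p by lia.
rewrite ip in cs; case Ev: (occ (tb s) (h (inord p.-1, x))) => [y|]; last first.
  have hv := upd_probe h p_gt0 (leqnn p) cs.
  by rewrite {1}/nxt cs ltnn hv Ev /=; left.
have [W ox ly [t' [oc [k [E dE _]]]]] := nxt_join_walk Is cs Ev.
rewrite dE; case: oc E {dE} => [E|z E|E]; [by left|by left|move=> _; right].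
apply: walk_fail_pattern W ox ly _ E => //.
by have [-> _ _] := nxt_join h Is cs; rewrite /= mem_rcons mem_head.
Qed.

Lemma nxt_join_time K s h x (P N : pred U) : minv K s -> cur s = Some (x, p) ->
  let v := h (inord p.-1, x) in let g := hh (nxt s h) in
  (forall z, z \in core s -> P z \/ N z) -> occ (tb s) v ->
  exists k, [/\ time (nxt s h) = (time s + k).+1, k <= lim &
  [\/ k < #|[pred w | `[< reach g P v w >]]|, closing g P v
    | exists2 y, N y & reach g P v (edge g y).1 \/ reach g P v (edge g y).2]].
Proof.
move=> Is cs v g PN; case Ev: (occ (tb s) v) => [y|] // _.
have [W ox ly [t' [oc [k [E _ tE]]]]] := nxt_join_walk Is cs Ev.
exists k; split=> //.
  have [_ _ _] := nxt_probe h Is cs; rewrite -/v Ev ltnn /= tE; lia.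
apply: walk_bound W ox ly _ E => // z /=.
have [-> _ _] := nxt_join h Is cs; rewrite mem_rcons inE => /orP[/eqP|/PN]; [by left|by right].
Qed.

End Steps.

(** * Potentials and union bounds *)

Section MeanExec.
Variables (R : realType) (U : finType) (n p lim : nat).
Local Notation H := (hashes U n p).
Local Notation mstate := (mstate U n p).
Local Notation nxt := (@nxt U n p lim).
Local Notation exec := (exec nxt).
Local Notation mean := (@mean R ('I_p.+1 * U)%type 'I_n).
Hypotheses (n_gt0 : (0 < n)%N) (p_gt0 : (0 < p)%N) (lim_gt0 : (0 < lim)%N).
Implicit Types (s : mstate) (h g : H).

Let v0 : 'I_n := Ordinal n_gt0.

Lemma mean_nxt_exec K (P : mstate -> Prop) (Phi : mstate -> R) t s :
  (forall s h, minv K s -> P s -> P (nxt s h)) ->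
  (forall s, minv K s -> P s -> mean (fun h => Phi (nxt s h)) <= Phi s) ->
  minv K s -> P s -> mean (fun h => Phi (exec h t s)) <= Phi s.
Proof.
move=> Pn Phin Is Ps.
apply: (@mean_exec_le R _ _ v0 _ nxt (@ask U n p) (@dom U n p) (fun s => minv K s /\ P s)).
- by move=> s1 h h' _; apply: nxt_ask.
- by move=> s1 h [I1 P1]; split; [apply: minv_nxt | apply: Pn].
- by move=> s1 q [I1 _]; apply: ask_dom I1.
- by move=> s1 h q [I1 _]; apply: (dom_nxt p_gt0 lim_gt0 _ I1).
- by move=> s1 h q [I1 _]; apply: (ask_nxt p_gt0 lim_gt0 _ I1).
- by move=> s1 [I1 P1]; apply: Phin.
- by split.
Qed.

Lemma mean_exec_indep K (g : mstate -> H -> R) t s :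
  (forall s (h h' : H), minv K s -> {in [predC dom s], h =1 h'} -> g s h = g s h') ->
  minv K s ->
  mean (fun h => g (exec h t s) h) = mean (fun h => mean (g (exec h t s))).
Proof.
move=> gd Is; apply: (@mean_exec_resample R _ _ v0 _ nxt (@ask U n p) (@dom U n p) (minv K)) => //.
- by move=> s1 h h' _; apply: nxt_ask.
- by move=> s1 h I1; apply: minv_nxt.
- by move=> s1 q I1; apply: ask_dom I1.
- by move=> s1 h q I1; apply: (dom_nxt p_gt0 lim_gt0 _ I1).
- by move=> s1 h q I1; apply: (ask_nxt p_gt0 lim_gt0 _ I1).
Qed.

Lemma exec_indep K t s h h' : minv K s ->
  {in [predC dom s], h =1 h'} -> exec h t s = exec h' t s.
Proof.
apply: (@exec_off_dom _ _ _ nxt (@ask U n p) (@dom U n p) (minv K)).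
- by move=> s1 h1 h2 _; apply: nxt_ask.
- by move=> s1 h1 I1; apply: minv_nxt.
- by move=> s1 q I1; apply: ask_dom I1.
- by move=> s1 h1 q I1; apply: (dom_nxt p_gt0 lim_gt0 _ I1).
Qed.

Lemma mean_slot (q : 'I_p.+1 * U) (f : 'I_n -> R) :
  mean (fun h => f (h q)) = (\sum_v f v) / n%:R.
Proof. by rewrite (mean_at v0) card_ord. Qed.

Lemma mean_slot2 (q q' : 'I_p.+1 * U) (f : 'I_n -> 'I_n -> R) : q != q' ->
  mean (fun h => f (h q) (h q')) = (\sum_v \sum_w f v w) / n%:R ^+ 2.
Proof. by move=> qq'; rewrite (mean_at2 v0) // card_ord. Qed.

Lemma sum_free (t : table U n) (c d : R) :
  \sum_v (if ~~ occ t v then c else d) / n%:R =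
  (#|free_slots t|%:R / n%:R) * c + (1 - #|free_slots t|%:R / n%:R) * d.
Proof.
rewrite -mulr_suml (bigID (fun v => ~~ occ t v)) /=.
rewrite (eq_bigr (fun=> c)); last by move=> v ->.
rewrite [X in _ + X](eq_bigr (fun=> d)); last by move=> v /negbTE ->.
rewrite !sumr_const.
have -> : #|[pred v | ~~ occ t v]| = #|free_slots t|.
  by apply: eq_card => v; rewrite !inE.
have -> : #|[pred v | ~~ ~~ occ t v]| = (n - #|free_slots t|)%N.
  have := cardsC (free_slots t); rewrite card_ord => /(canRL (addKn _)) <-.
  by apply: eq_card => v; rewrite !inE.
have le : (#|free_slots t| <= n)%N by have := max_card (mem (free_slots t)); rewrite card_ord.
rewrite -[c *+ _]mulr_natr -[d *+ _]mulr_natr natrB //.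
by field; rewrite pnatr_eq0 -lt0n.
Qed.

Lemma pred_pow_le a f : (f.-1 ^ a * (f + a) <= f ^ a.+1)%N.
Proof.
case: f => [|f]; first by case: a => [|a] //=; rewrite !exp0n.
elim: a => [|a IH] /=; first by rewrite addn0 mul1n.
apply: (@leq_trans (f.+1 * (f ^ a * (f.+1 + a)))); last first.
  by rewrite [X in (_ <= X)%N]expnS leq_mul2l IH orbT.
have le : (f * (f.+1 + a.+1) <= f.+1 * (f.+1 + a))%N by nia.
have -> : (f ^ a.+1 * (f.+1 + a.+1) = f ^ a * (f * (f.+1 + a.+1)))%N by rewrite expnS; nia.
by rewrite [X in (_ <= X)%N]mulnCA leq_mul2l le orbT.
Qed.

(** Going from n to f free slots takes about n ln (n / f) probes. The logarithm of this product, lam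
    * work + a ln f, therefore stays about constant when lam is close to a / n. *)
Definition probe_potential (lam : R) (a : nat) s : R :=
  expR (lam * (work s)%:R) * #|free_slots (tb s)|%:R ^+ a.

(* Each fresh probe finds a free slot with probability f / n, f being the number
   of free slots, and (1 - 1/f)^a <= f / (f + a). *)
Lemma mean_probe_potential K lam a s : (K <= n)%N -> 0 <= lam ->
  (forall f, (n < f + K)%N -> lam * (n%:R * (f + a)%:R) <= (f * a)%:R) ->
  minv K s -> mean (fun h => probe_potential lam a (nxt s h)) <= probe_potential lam a s.
Proof.
move=> Kn lam0 lamP Is; case cs: (cur s) => [[x i]|]; last first.
  rewrite (eq_mean (g := fun=> probe_potential lam a s)) => [|h]; first by rewrite (@mean_cst R _ _ v0).
  by have [wE tE _ _] := nxt_idle lim h cs; rewrite /probe_potential wE tE.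
set f := #|free_slots (tb s)|.
have fK : (n < f + K)%N by have := minv_free Is; rewrite cs /= -/f; lia.
set E := expR (lam * (work s)%:R); pose q : 'I_p.+1 * U := (inord i.-1, x).
pose G v := expR lam * E * (if ~~ occ (tb s) v then f.-1%:R ^+ a else f%:R ^+ a).
apply: (@le_trans _ _ (mean (fun h => G (h q)))).
  apply: le_mean => h; have [wE fE _ _ _] := nxt_probe p_gt0 lim_gt0 h Is cs.
  rewrite -/q in fE; rewrite /probe_potential wE -natr1 mulrDr mulr1 expRD [_ * expR lam]mulrC -/E.
  rewrite /G ler_wpM2l ?mulr_ge0 ?expR_ge0 //.
  move: fE; rewrite -/f; case: (occ _ _) => [y|] /= fE; rewrite lerXn2r ?nnegrE ?ler0n // ler_nat; lia.
rewrite mean_slot /G -mulr_sumr -mulrA mulr_suml sum_free -/f.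
rewrite /probe_potential -/f -/E -mulrA mulrCA; apply: ler_wpM2l; first exact: expR_ge0.
have n0 : 0 < n%:R :> R by rewrite ltr0n.
have fa0 : 0 < f%:R + a%:R :> R.
  by rewrite -natrD ltr0n; lia.
have le1 : f.-1%:R ^+ a <= f%:R ^+ a * (f%:R / (f%:R + a%:R)) :> R.
  rewrite mulrA ler_pdivlMr // -exprSr -natrX -natrD -natrM -natrX ler_nat.
  exact: pred_pow_le.
have fn : 0 <= f%:R / n%:R :> R by rewrite divr_ge0 ?ler0n.
(* [lamP] says that lam is at most (f / n) * a / (f + a), the relative drop guaranteed for the mean
   of the a-th power of f. It remains to use expR lam * (1 - lam) <= 1. *)
apply: (@le_trans _ _ (expR lam * (f%:R ^+ a * (1 - lam)))).
  rewrite ler_wpM2l ?expR_ge0 //.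
  apply: (@le_trans _ _ (f%:R / n%:R * (f%:R ^+ a * (f%:R / (f%:R + a%:R)))
            + (1 - f%:R / n%:R) * f%:R ^+ a)).
    by rewrite lerD2r ler_wpM2l.
  rewrite -subr_ge0.
  have -> : f%:R ^+ a * (1 - lam) - (f%:R / n%:R * (f%:R ^+ a * (f%:R / (f%:R + a%:R)))
            + (1 - f%:R / n%:R) * f%:R ^+ a)
     = f%:R ^+ a * ((f * a)%:R - lam * (n%:R * (f + a)%:R)) / (n%:R * (f%:R + a%:R)) :> R.
    rewrite natrM natrD; field; rewrite gt_eqF //= gt_eqF //.
  by rewrite mulr_ge0 ?invr_ge0 ?mulr_ge0 ?exprn_ge0 ?ler0n ?subr_ge0 ?lamP // ltW.
rewrite mulrCA -[X in _ <= X]mulr1 ler_wpM2l ?exprn_ge0 ?ler0n //.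
rewrite -ler_pdivlMl ?expR_gt0 // mulr1 -expRN; have := expR_ge1Dx (- lam); lra.
Qed.

Definition prob (P : H -> Prop) : R := mean (fun h => (`[< P h >])%:R).

Lemma prob_le_mean (P : H -> Prop) (f : H -> R) :
  (forall h, 0 <= f h) -> (forall h, P h -> 1 <= f h) -> prob P <= mean f.
Proof. by move=> f0 f1; apply: le_mean => h; case: asboolP => [/f1|_]. Qed.

Lemma prob_or (P Q : H -> Prop) : prob (fun h => P h \/ Q h) <= prob P + prob Q.
Proof.
rewrite /prob -meanD; apply: le_mean => h.
do 3!case: asboolP => //=; rewrite ?(addr0, add0r, lexx, ler0n, ler01) // ?lerDl ?lerDr ?ler01 //; tauto.
Qed.

Lemma sub_prob (P Q : H -> Prop) : (forall h, P h -> Q h) -> prob P <= prob Q.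
Proof.
by move=> PQ; apply: prob_le_mean => [h|h /PQ Qh]; [apply: ler0n | case: asboolP].
Qed.

(** Markov's inequality for [probe_potential]: it starts at n ^ a, and at least n - K slots stay
    free throughout. *)
Lemma prob_work K lam a t xs (M : nat) h0 : uniq xs -> size xs = K -> (K < n)%N -> 0 <= lam ->
  (forall f, (n < f + K)%N -> lam * (n%:R * (f + a)%:R) <= (f * a)%:R) ->
  prob (fun h => (M <= work (exec h t (start h0 xs)))%N)
    <= expR (- (lam * M%:R)) * (n%:R / (n - K)%:R) ^+ a.
Proof.
move=> ux sK Kn lam0 lamP; have I0 := minv_start p_gt0 h0 ux; rewrite sK in I0.
have nK0 : 0 < (n - K)%:R :> R by rewrite ltr0n subn_gt0.
have S := @mean_nxt_exec K (fun=> True) (probe_potential lam a) t _ (fun _ _ _ _ => Logic.I)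
  (fun s Is _ => mean_probe_potential (ltnW Kn) lam0 lamP Is) I0 Logic.I.
have Phi0 : probe_potential lam a (start h0 xs) = n%:R ^+ a.
  rewrite /probe_potential /work /= big1 ?mulr0 ?expR0 ?mul1r; last by move=> y _; rewrite min0n.
  congr (_%:R ^+ _); rewrite -[RHS](card_ord n).
  by apply: eq_card => v; rewrite !inE.
rewrite expr_div_n mulrCA; rewrite Phi0 in S.
apply: le_trans (ler_wpM2r _ S); last by rewrite mulr_ge0 ?expR_ge0 ?invr_ge0 ?exprn_ge0 ?ler0n.
rewrite mulrC -meanZ; apply: prob_le_mean => h.
  by rewrite !mulr_ge0 ?expR_ge0 ?invr_ge0 ?exprn_ge0 ?ler0n.
move=> Mw; rewrite /probe_potential; set s := exec h t _ in Mw *.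
have fs : (n - K <= #|free_slots (tb s)|)%N.
  by have := minv_free (minv_exec lim p_gt0 h t I0); rewrite -/s; lia.
rewrite mulrACA -expRD -[X in X <= _](mulr1 1); apply: ler_pM; rewrite ?ler01 //.
  by rewrite -[X in X <= _]expR0 ler_expR addrC subr_ge0 ler_wpM2l ?ler_nat.
by rewrite ler_pdivlMl ?exprn_gt0 // mulr1 lerXn2r ?nnegrE ?ler0n // ler_nat.
Qed.

End MeanExec.

(** * Patterns in the core graph *)

Section Patterns.
Variables (R : realType) (U : finType) (n p lim : nat).
Local Notation H := (hashes U n p).
Local Notation mstate := (mstate U n p).
Local Notation nxt := (@nxt U n p lim).
Local Notation exec := (exec nxt).
Local Notation mean := (@mean R ('I_p.+1 * U)%type 'I_n).
Local Notation prob := (@prob R U n p).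
Hypotheses (n_gt0 : (0 < n)%N) (p_gt0 : (0 < p)%N) (lim_gt0 : (0 < lim)%N).
Implicit Types (s : mstate) (h g : H).

Let v0 : 'I_n := Ordinal n_gt0.

Definition edges s := [seq edge (hh s) y | y <- core s].

(** [x] is quantified before [h]: the past alone decides who joins next, so the new edge is uniform
    whatever the history. *)
Lemma edges_nxt K s : minv K s ->
  (forall h, edges (nxt s h) = edges s) \/
  (exists x, forall h, edges (nxt s h) = rcons (edges s) (h (inord p.-1, x), h (inord p, x))).
Proof.
move=> Is; have eq_edges h : core (nxt s h) = core s -> edges (nxt s h) = edges s.
  rewrite /edges => ->; apply/eq_in_map => y yc.
  exact: (edge_nxt lim p_gt0 h Is yc).
case cs: (cur s) => [[x i]|]; last first.
  by left=> h; apply: eq_edges; have [_ _ -> _] := nxt_idle lim h cs.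
case: (ltnP i p) => ip.
  by left=> h; apply: eq_edges; have [_ _ _ _ /(_ ip)[]] := nxt_probe p_gt0 lim_gt0 h Is cs.
have ipE : i = p by have := minv_cur Is; rewrite cs; lia.
rewrite ipE in cs; right; exists x => h.
have [cE xc xE] := nxt_join p_gt0 lim_gt0 h Is cs.
rewrite /edges cE map_rcons xE; congr rcons; apply/eq_in_map => y yc.
exact: (edge_nxt lim p_gt0 h Is yc).
Qed.

(* Bounds the conditional probability that the q.1-th element to join the core has
   the ends q.2; 2 / n^2 stands for an edge that is not revealed yet. *)
Definition pattern_weight (E : seq ('I_n * 'I_n)) (q : nat * ('I_n * 'I_n)) : R :=
  if (q.1 < size E)%N then (same_ends (nth (v0, v0) E q.1) q.2)%:R else 2 / n%:R ^+ 2.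

Lemma pattern_weight_ge0 E q : 0 <= pattern_weight E q.
Proof. by rewrite /pattern_weight; case: ifP; rewrite ?ler0n // divr_ge0 ?exprn_ge0 ?ler0n. Qed.

Lemma inord_neq (x : U) : (inord p.-1, x) != (inord p, x) :> 'I_p.+1 * U.
Proof. by rewrite xpair_eqE -val_eqE /= !inordK ?andbT; lia. Qed.

Lemma mean_same_ends (x : U) (t : 'I_n * 'I_n) :
  mean (fun h => (same_ends (h (inord p.-1, x), h (inord p, x)) t)%:R) <= 2 / n%:R ^+ 2.
Proof.
rewrite (mean_slot2 n_gt0 (fun v w => (same_ends (v, w) t)%:R) (inord_neq x)).
rewrite ler_wpM2r ?invr_ge0 ?exprn_ge0 ?ler0n //.
apply: (@le_trans _ _ (\sum_v \sum_w ((v == t.1)%:R * (w == t.2)%:R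
                                     + (v == t.2)%:R * (w == t.1)%:R))).
  apply: ler_sum => v _; apply: ler_sum => w _; rewrite /same_ends -!natrM -natrD ler_nat.
  by case: t => a b; rewrite !xpair_eqE /=; do 4!case: eqP.
have D (a b : 'I_n) : \sum_v \sum_w (v == a)%:R * (w == b)%:R = 1 :> R.
  rewrite (bigD1 a) //= [X in _ + X]big1 ?addr0; last first.
    by move=> v /negbTE ->; apply: big1 => w _; rewrite mul0r.
  rewrite (bigD1 b) //= !eqxx mulr1 [X in _ + X]big1 ?addr0 // => w /negbTE ->.
  by rewrite mulr0.
under eq_bigr do rewrite big_split.
by rewrite big_split /= !D.
Qed.

Definition pattern_potential zq s : R := \prod_(q <- zq) pattern_weight (edges s) q.

(** A step reveals at most one edge and the indices are distinct, so at most one factor changes, and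
    its mean does not exceed the weight 2 / n^2 that it had before. *)
Lemma mean_pattern_potential K zq s : uniq (unzip1 zq) -> minv K s ->
  mean (fun h => pattern_potential zq (nxt s h)) <= pattern_potential zq s.
Proof.
move=> + Is; case: (edges_nxt Is) => [eE _|[x eE]].
  rewrite (eq_mean (g := fun=> pattern_potential zq s)) => [|h]; first by rewrite (@mean_cst R _ _ v0).
  by rewrite /pattern_potential eE.
have wtE q h : q.1 != size (edges s) -> pattern_weight (edges (nxt s h)) q = pattern_weight (edges s) q.
  by rewrite eE /pattern_weight size_rcons nth_rcons ltnS leq_eqVlt => /negbTE ->; case: ltnP.
elim: zq => [_|q zq IH /= /andP[qz uz]].
  rewrite (eq_mean (g := fun=> 1)) => [|h]; last by rewrite /pattern_potential big_nil.
  by rewrite (@mean_cst R _ _ v0) /pattern_potential big_nil.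
have Psi0 s' : 0 <= pattern_potential zq s' by apply: prodr_ge0 => q' _; apply: pattern_weight_ge0.
case: (q.1 =P size (edges s)) => [qE|/eqP qE].
  have PE h : pattern_potential zq (nxt s h) = pattern_potential zq s.
    apply: eq_big_seq => q' q'z; apply: wtE.
    by apply: contraNneq qz => E; rewrite qE -E; apply/mapP; exists q'.
  rewrite (eq_mean (g := fun h => pattern_potential zq s * (same_ends (h (inord p.-1, x), h (inord p, x)) q.2)%:R)).
    rewrite meanZ /pattern_potential big_cons mulrC -/(pattern_potential _ _) ler_wpM2r //.
    by rewrite /pattern_weight qE ltnn mean_same_ends.
  move=> h; rewrite /pattern_potential big_cons mulrC -/(pattern_potential _ _) PE eE /pattern_weight size_rcons qE ltnSn.
  by rewrite nth_rcons ltnn eqxx.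
rewrite (eq_mean (g := fun h => pattern_weight (edges s) q * pattern_potential zq (nxt s h))).
  by rewrite meanZ /pattern_potential big_cons ler_wpM2l ?pattern_weight_ge0 // IH.
by move=> h; rewrite /pattern_potential big_cons wtE.
Qed.

Definition inC s : pred U := [pred z in core s].

(** The union bound runs over arrival indices below [m] and not over elements, so the size of [U]
    does not enter. *)
Lemma prob_embeds K t xs h0 m tau : uniq xs -> size xs = K ->
  prob (fun h => let s := exec h t (start h0 xs) in
          (size (core s) <= m)%N /\ embeds (hh s) (inC s) tau)
    <= (m%:R * (2 / n%:R ^+ 2)) ^+ size tau.
Proof.
move=> ux sK; have I0 := minv_start p_gt0 h0 ux; rewrite sK in I0.
pose zq (ids : (size tau).-tuple 'I_m) := zip (map val ids) tau.
have u1 ids : unzip1 (zq ids) = map val ids.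
  by rewrite unzip1_zip // size_map size_tuple.
pose f s : R := \sum_(ids : (size tau).-tuple 'I_m | uniq ids) pattern_potential (zq ids) s.
have f0 s : 0 <= f s.
  by apply: sumr_ge0 => ids _; apply: prodr_ge0 => q _; apply: pattern_weight_ge0.
apply: (@le_trans _ _ (mean (fun h => f (exec h t (start h0 xs))))).
  apply: prob_le_mean => h; first exact: f0.
  set s := exec _ _ _; case=> cm [ys [uy sy fy]].
  have sz : size ys = size tau by move: fy; rewrite /fits all2E => /andP[/eqP].
  have ic y : y \in ys -> (index y (core s) < m)%N.
    by move=> /sy yc; apply: leq_trans cm; rewrite index_mem.
  have [ids idsE] : exists ids : (size tau).-tuple 'I_m,
      map val ids = [seq index y (core s) | y <- ys].
    have sz' : size (pmap insub [seq index y (core s) | y <- ys] : seq 'I_m) == size tau.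
      rewrite size_pmap_sub (eq_in_count (a2 := predT)); first by rewrite count_predT size_map sz.
      by move=> _ /mapP[y yy ->]; apply: ic.
    exists (Tuple sz') => /=; rewrite pmap_filter; last exact: insubK.
    by apply/all_filterP/allP => _ /mapP[y yy ->] /=; rewrite /= insubT ?ic.
  have ui : uniq ids.
    rewrite -(map_inj_uniq val_inj) idsE map_inj_in_uniq // => y z /sy yc /sy zc E.
    by rewrite -(nth_index y yc) E nth_index.
  rewrite /f (bigD1 ids) //= -[1]addr0; apply: lerD; last first.
    by apply: sumr_ge0 => ids' _; apply: prodr_ge0 => q _; apply: pattern_weight_ge0.
  rewrite /pattern_potential /zq idsE big1_seq // => -[i tt] /= it.
  have {it} : exists2 y, y \in ys & i = index y (core s) /\ same_ends (edge (hh s) y) tt.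
    elim: ys (tau) fy it {uy sy sz ic idsE} => [|y ys IH] [|t' ta] //= /andP[et fy].
    rewrite inE => /orP[/eqP[-> ->]|/(IH _ fy)[z zy E]]; first by exists y; rewrite ?mem_head.
    by exists z => //; rewrite inE zy orbT.
  case=> y /sy yc [-> et]; rewrite /pattern_weight /= size_map index_mem yc.
  by rewrite (nth_map y) ?index_mem // nth_index // et.
apply: (@le_trans _ _ (f (start h0 xs))).
  rewrite mean_sum; apply: ler_sum => ids ui.
  apply: (@mean_nxt_exec R U n p lim n_gt0 p_gt0 lim_gt0 K (fun=> True)) => // s Is _.
  by apply: mean_pattern_potential Is; rewrite u1 (map_inj_uniq val_inj).
apply: (@le_trans _ _ (\sum_(ids : (size tau).-tuple 'I_m) (2 / n%:R ^+ 2) ^+ size tau)).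
  rewrite [X in _ <= X](bigID (fun ids : (size tau).-tuple 'I_m => uniq ids)) /= -[X in X <= _]addr0.
  apply: lerD; last by apply: sumr_ge0 => ids _; rewrite exprn_ge0 // divr_ge0 ?exprn_ge0 ?ler0n.
  apply: ler_sum => ids _; rewrite /pattern_potential /pattern_weight /edges /= big_const_seq count_predT.
  by rewrite size_zip size_map size_tuple minnn iter_mulr_1.
by rewrite sum_cst card_tuple card_ord natrX mulrC -exprMn.
Qed.

End Patterns.

(** * Geometric sums with ratio at most 4/5 *)

Section GeometricSums.
Variable R : realType.
Implicit Types (N : nat) (x : R).

Lemma geo0 N x : 0 <= x <= 4 / 5 -> \sum_(l < N) x ^+ l <= 5.
Proof.
move=> /andP[x0 x1]; suff -> : \sum_(l < N) x ^+ l = (1 - x ^+ N) / (1 - x).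
  by rewrite ler_pdivrMr; [have := exprn_ge0 N x0|]; lra.
elim: N => [|N IH]; first by rewrite big_ord0 expr0 subrr mul0r.
by rewrite big_ord_recr /= IH exprS; field; apply/eqP; lra.
Qed.

Lemma geo_tail N i x : 0 <= x <= 4 / 5 ->
  \sum_(l < N) (i <= l)%N%:R * x ^+ l <= 5 * x ^+ i.
Proof.
move=> xx; have /andP[x0 _] := xx; elim: i N => [|i IH] N.
  by rewrite mulr1; under eq_bigr do rewrite mul1r; apply: geo0.
case: N => [|N]; first by rewrite big_ord0 mulr_ge0 ?exprn_ge0.
rewrite big_ord_recl mul0r add0r; under eq_bigr do rewrite lift0 ltnS exprS mulrCA.
by rewrite -mulr_sumr exprS mulrCA ler_wpM2l.
Qed.

(** In use, [T l] is a closed form of the series of u (l + j) (4/5)^j over j, which is a polynomial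
    when [u] is one. Its recurrence makes the partial sums telescope. *)
Lemma geo_weight (u T : nat -> R) N x : 0 <= x <= 4 / 5 ->
  (forall l, 0 <= u l) -> (forall l, 0 <= T l) ->
  (forall l, u l + 4 / 5 * T l.+1 = T l) ->
  \sum_(l < N) u l * x ^+ l <= T 0%N.
Proof.
move=> /andP[x0 x1] u0 T0 uT.
suff : \sum_(l < N) u l * x ^+ l + T N * x ^+ N <= T 0%N.
  by apply: le_trans; rewrite lerDl mulr_ge0 ?exprn_ge0.
elim: N => [|N IH]; first by rewrite big_ord0 expr0 mulr1 add0r.
apply: le_trans IH; rewrite big_ord_recr /= -addrA lerD2l exprS mulrA -mulrDl.
rewrite ler_wpM2r ?exprn_ge0 // -(uT N) lerD2l mulrC ler_wpM2r //.
Qed.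

Lemma geo1 N x : 0 <= x <= 4 / 5 -> \sum_(l < N) l.+1%:R * x ^+ l <= 25.
Proof.
move=> xx; apply: (le_trans (@geo_weight (fun l => l.+1%:R) (fun l => 5 * l%:R + 25) N x xx _ _ _)).
- by move=> l; rewrite ler0n.
- by move=> l; rewrite addr_ge0 ?mulr_ge0 ?ler0n.
- by move=> l /=; rewrite -[l.+1%:R]natr1; lra.
- lra.
Qed.

Lemma geo2 N x : 0 <= x <= 4 / 5 -> \sum_(l < N) l.+1%:R ^+ 2 * x ^+ l <= 225.
Proof.
move=> xx.
apply: (le_trans (@geo_weight (fun l => l.+1%:R ^+ 2) (fun l => 5 * l%:R ^+ 2 + 50 * l%:R + 225) N x xx _ _ _)).
- by move=> l; rewrite exprn_ge0 ?ler0n.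
- by move=> l; rewrite !addr_ge0 ?mulr_ge0 ?exprn_ge0 ?ler0n.
- by move=> l /=; rewrite -[l.+1%:R]natr1; lra.
- lra.
Qed.

End GeometricSums.

Section TupleSum.
Variables (R : realType) (n m : nat).

(** Serves union bounds over the vertices of a path; a path embedded in a core of at most [m]
    elements has at most [m] edges. *)
Definition tsum (F : seq 'I_n -> R) : R :=
  \sum_(l < m.+1) \sum_(ws : l.-tuple 'I_n) F ws.

Lemma tsum_ge0 F : (forall ws, 0 <= F ws) -> 0 <= tsum F.
Proof. by move=> F0; apply: sumr_ge0 => l _; apply: sumr_ge0. Qed.

Lemma tsum_ge F ws : (forall ws, 0 <= F ws) -> (size ws <= m)%N -> F ws <= tsum F.
Proof.
move=> F0 wm; rewrite /tsum (bigD1 (Ordinal (wm : (size ws < m.+1)%N))) //=.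
rewrite (bigD1 (in_tuple ws)) //= -addrA lerDl addr_ge0 //; last first.
  by apply: sumr_ge0 => l _; apply: sumr_ge0.
by apply: sumr_ge0.
Qed.

Lemma le_tsum F G : (forall ws, (size ws <= m)%N -> F ws <= G ws) -> tsum F <= tsum G.
Proof.
move=> FG; apply: ler_sum => l _; apply: ler_sum => ws _; apply: FG.
by rewrite size_tuple -ltnS.
Qed.

Lemma tsum_size (G : nat -> R) :
  tsum (fun ws => G (size ws)) = \sum_(l < m.+1) n%:R ^+ l * G l.
Proof.
apply: eq_bigr => l _; under eq_bigr do rewrite size_tuple.
by rewrite sum_cst card_tuple card_ord natrX mulrC.
Qed.

Lemma sum_mem (l : seq 'I_n) (c : R) : 0 <= c ->
  \sum_w (w \in l)%:R * c <= (size l)%:R * c.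
Proof.
move=> c0; rewrite -mulr_suml ler_wpM2r // -natr_sum ler_nat.
rewrite -big_mkcond sum1_card; apply: leq_trans (card_size l); apply/eq_leq/eq_card.
by [].
Qed.

End TupleSum.

(** * First-moment bounds for the core graph *)

Section UnionBounds.
Variables (R : realType) (U : finType) (n p lim m : nat).
Local Notation H := (hashes U n p).
Local Notation mstate := (mstate U n p).
Local Notation nxt := (@nxt U n p lim).
Local Notation exec := (exec nxt).
Local Notation mean := (@mean R ('I_p.+1 * U)%type 'I_n).
Local Notation prob := (@prob R U n p).
Local Notation tsum := (@tsum R n m).
Hypotheses (n_gt0 : (0 < n)%N) (p_gt0 : (0 < p)%N) (lim_gt0 : (0 < lim)%N).
Implicit Types (s : mstate) (h g : H).

Let v0 : 'I_n := Ordinal n_gt0.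

Lemma mean_tsum (F : H -> seq 'I_n -> R) :
  mean (fun h => tsum (F h)) = tsum (fun ws => mean (F^~ ws)).
Proof. by rewrite /tsum mean_sum; apply: eq_bigr => l _; rewrite mean_sum. Qed.

Variables (t : nat) (xs : seq U) (h0 : H).
Hypothesis uniq_xs : uniq xs.
Hypothesis m_le : 2 * m%:R / n%:R <= 4 / 5 :> R.
Let st h := exec h t (start h0 xs).
(** [r] is the price of one prescribed edge, summed over the arrival index that realises it. With n
    choices for the next vertex it becomes [rho], the subcritical branching factor. *)
Let r : R := m%:R * (2 / n%:R ^+ 2).
Let rho : R := 2 * m%:R / n%:R.

Let r_ge0 : 0 <= r.
Proof. by rewrite /r mulr_ge0 ?divr_ge0 ?exprn_ge0 ?ler0n. Qed.

Let nr : n%:R * r = rho.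
Proof. by rewrite /r /rho; field; rewrite pnatr_eq0 -lt0n. Qed.

Let rho_bounds : 0 <= rho <= 4 / 5.
Proof. by rewrite m_le andbT /rho divr_ge0 ?mulr_ge0 ?ler0n. Qed.

Definition good_embeds s tau := (size (core s) <= m)%N /\ embeds (hh s) (inC s) tau.

Definition ind (P : Prop) : R := `[< P >]%:R.

Lemma ind_ge0 P : 0 <= ind P. Proof. exact: ler0n. Qed.

Lemma ind1 (P : Prop) : P -> ind P = 1. Proof. by move=> HP; rewrite /ind asboolT. Qed.

Lemma mean_embeds tau : mean (fun h => ind (good_embeds (st h) tau)) <= r ^+ size tau.
Proof. exact: (prob_embeds R n_gt0 p_gt0 lim_gt0 t h0 m tau uniq_xs erefl). Qed.

Lemma good_embeds_size s tau : good_embeds s tau -> (size tau <= m)%N.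
Proof.
case=> cm [ys [uy sy]]; rewrite /fits all2E => /andP[/eqP <- _].
by apply: leq_trans cm; apply: uniq_leq_size.
Qed.

Definition nreach s : nat :=
  \sum_a #|[pred w | `[< reach (hh s) (inC s) a w >]]|.

Definition nclosing s : nat := #|[pred a | `[< closing (hh s) (inC s) a >]]|.

Lemma card_ind (P : 'I_n -> Prop) : #|[pred w | `[< P w >]]|%:R = \sum_w ind (P w).
Proof. by rewrite -sum1_card natr_sum big_mkcond; apply: eq_bigr => w _; rewrite inE; case: ifP; rewrite /ind => ->. Qed.

Lemma mean_nreach :
  mean (fun h => (size (core (st h)) <= m)%N%:R * (nreach (st h))%:R) <= 5 * n%:R.
Proof.
pose F h := \sum_a tsum (fun ws => ind (good_embeds (st h) (path_edges a ws))).
apply: (@le_trans _ _ (mean F)).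
  apply: le_mean => h; rewrite /F; case: leqP => [cm|_]; last first.
    by rewrite mul0r; apply: sumr_ge0 => a _; apply: tsum_ge0 => ws; apply: ind_ge0.
  rewrite mul1r natr_sum; apply: ler_sum => a _; rewrite card_ind.
  apply: (@le_trans _ _ (\sum_w tsum (fun ws => (w == head a ws)%:R
                           * ind (good_embeds (st h) (path_edges a ws))))).
    apply: ler_sum => w _; rewrite {1}/ind; case: asboolP => [[ws wE e]|_]; last first.
      by apply: tsum_ge0 => ws; rewrite mulr_ge0 ?ler0n ?ind_ge0.
    have ge : good_embeds (st h) (path_edges a ws) by [].
    apply: le_trans (tsum_ge (ws := ws) _ _).
    - by rewrite -wE eqxx mul1r ind1.
    - by move=> ws'; rewrite mulr_ge0 ?ler0n ?ind_ge0.
    - by rewrite -(size_path_edges a); apply: good_embeds_size ge.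
  rewrite /tsum exchange_big /=; apply: ler_sum => l _; rewrite exchange_big /=.
  apply: ler_sum => ws _; rewrite -mulr_suml -[X in _ <= X]mul1r ler_wpM2r ?ind_ge0 //.
  by rewrite (bigD1 (head a ws)) //= eqxx big1 ?addr0 // => w /negbTE ->.
rewrite mean_sum; apply: (@le_trans _ _ (\sum_(a : 'I_n) 5)); last first.
  by rewrite sum_cst card_ord.
apply: ler_sum => a _; rewrite mean_tsum.
apply: (@le_trans _ _ (tsum (fun ws => r ^+ size ws))).
  by apply: le_tsum => ws _; rewrite -(size_path_edges a) mean_embeds.
rewrite (tsum_size n m (fun l => r ^+ l)).
by under eq_bigr do rewrite -exprMn nr; apply: geo0.
Qed.

(** A closing edge ends in one of the l + 1 slots already visited, so its factor [r] comes without
    the factor n for a new vertex. This saving cancels the n choices of the starting slot. *)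
Lemma mean_nclosing :
  mean (fun h => (size (core (st h)) <= m)%N%:R * (nclosing (st h))%:R) <= 25.
Proof.
pose F h := \sum_a tsum (fun ws => \sum_w (w \in a :: ws)%:R *
   ind (good_embeds (st h) ((head a ws, w) :: path_edges a ws))).
have F0 h a ws w : 0 <= (w \in a :: ws)%:R *
   ind (good_embeds (st h) ((head a ws, w) :: path_edges a ws)).
  by rewrite mulr_ge0 ?ler0n ?ind_ge0.
apply: (@le_trans _ _ (mean F)).
  apply: le_mean => h; rewrite /F; case: leqP => [cm|_]; last first.
    by rewrite mul0r; do 2![apply: sumr_ge0 => ? _]; apply: sumr_ge0 => ? _; apply: sumr_ge0.
  rewrite mul1r /nclosing card_ind; apply: ler_sum => a _.
  rewrite {1}/ind; case: asboolP => [[ws [w [ww e]]]|_]; last first.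
    by apply: tsum_ge0 => ws; apply: sumr_ge0.
  have ge : good_embeds (st h) ((head a ws, w) :: path_edges a ws) by [].
  apply: le_trans (tsum_ge (ws := ws) _ _).
  - rewrite (bigD1 w) //= ww mul1r ind1 // lerDl; exact: sumr_ge0.
  - by move=> ws'; apply: sumr_ge0.
  - by have := good_embeds_size ge; rewrite /= size_path_edges; apply: ltnW.
rewrite mean_sum.
apply: (@le_trans _ _ (\sum_(a : 'I_n) 25 * r)); last first.
  rewrite sum_cst card_ord -mulrA [r * _]mulrC nr; have := rho_bounds; lra.
apply: ler_sum => a _; rewrite mean_tsum.
apply: (@le_trans _ _ (tsum (fun ws => (size ws).+1%:R * r ^+ (size ws).+1))).
  apply: le_tsum => ws _; rewrite mean_sum.
  apply: le_trans (sum_mem (a :: ws) (exprn_ge0 (size ws).+1 r_ge0)).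
  apply: ler_sum => w _; rewrite meanZ ler_wpM2l ?ler0n //.
  by have := mean_embeds ((head a ws, w) :: path_edges a ws); rewrite /= size_path_edges.
rewrite (tsum_size n m (fun l => l.+1%:R * r ^+ l.+1)).
rewrite (eq_bigr (fun l : 'I_m.+1 => l.+1%:R * rho ^+ l * r)); last first.
  by move=> l _; rewrite -nr [(n%:R * r) ^+ l]exprMn exprSr; ring.
rewrite -mulr_suml; apply: ler_wpM2r => //; exact: geo1.
Qed.

Lemma prob_long_path i :
  prob (fun h => exists v ws, good_embeds (st h) (path_edges v ws) /\ (i <= size ws)%N)
    <= 5 * n%:R * (4 / 5) ^+ i.
Proof.
pose F h := \sum_v tsum (fun ws => (i <= size ws)%N%:R * ind (good_embeds (st h) (path_edges v ws))).
have F0 h v ws : 0 <= (i <= size ws)%N%:R * ind (good_embeds (st h) (path_edges v ws)).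
  by rewrite mulr_ge0 ?ler0n ?ind_ge0.
apply: (@le_trans _ _ (mean F)).
  apply: prob_le_mean => h; first by apply: sumr_ge0 => v _; apply: tsum_ge0.
  case=> v [ws [ge iw]]; rewrite /F (bigD1 v) //=.
  apply: (@le_trans _ _ (1 + 0)); first by rewrite addr0.
  apply: lerD; last by apply: sumr_ge0 => v' _; apply: tsum_ge0.
  apply: le_trans (tsum_ge (ws := ws) _ _) => //; first by rewrite iw mul1r ind1.
  by rewrite -(size_path_edges v); apply: good_embeds_size ge.
rewrite mean_sum; apply: (@le_trans _ _ (\sum_(v : 'I_n) 5 * (4 / 5) ^+ i)); last first.
  by rewrite sum_cst card_ord mulrAC.
apply: ler_sum => v _; rewrite mean_tsum.
apply: (@le_trans _ _ (tsum (fun ws => (i <= size ws)%N%:R * r ^+ size ws))).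
  by apply: le_tsum => ws _; rewrite meanZ ler_wpM2l ?ler0n // -(size_path_edges v) mean_embeds.
rewrite (tsum_size n m (fun l => (i <= l)%N%:R * r ^+ l)).
under eq_bigr do rewrite mulrCA -exprMn nr.
apply: le_trans (geo_tail _ _ rho_bounds) _.
rewrite ler_wpM2l //; apply: lerXn2r; rewrite ?nnegrE; by have := rho_bounds; lra.
Qed.

(** Two closing edges save two factors n, against one for the starting slot. With paths of lengths
    l1 and l2 there are at most l1 + 1 and l1 + l2 + 1 <= (l1 + 1) (l2 + 1) places to close, and the
    sums of (l1 + 1)^2 rho^l1 and (l2 + 1) rho^l2 contribute 225 and 25. *)
Lemma prob_lasso2 :
  prob (fun h => exists v ws1 w1 ws2 w2, [/\ w1 \in v :: ws1, w2 \in v :: ws1 ++ ws2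
     & good_embeds (st h) (lasso2 v ws1 w1 ws2 w2)]) <= 5625 / n%:R.
Proof.
pose G h v ws1 w1 ws2 w2 : R := (w2 \in v :: ws1 ++ ws2)%:R *
    ind (good_embeds (st h) (lasso2 v ws1 w1 ws2 w2)).
have G0 h v ws1 w1 ws2 w2 : 0 <= G h v ws1 w1 ws2 w2.
  by rewrite mulr_ge0 ?ler0n ?ind_ge0.
pose F h := \sum_v tsum (fun ws1 => \sum_w1 (w1 \in v :: ws1)%:R *
   tsum (fun ws2 => \sum_w2 G h v ws1 w1 ws2 w2)).
have F3 h v ws1 w1 : 0 <= (w1 \in v :: ws1)%:R * tsum (fun ws2 => \sum_w2 G h v ws1 w1 ws2 w2).
  by rewrite mulr_ge0 ?ler0n // tsum_ge0 // => ws2; apply: sumr_ge0.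
apply: (@le_trans _ _ (mean F)).
  apply: prob_le_mean => h; first by do 2![apply: sumr_ge0 => ? _]; do 2![apply: sumr_ge0 => ? _].
  case=> v [ws1 [w1 [ws2 [w2 [i1 i2 ge]]]]]; rewrite /F (bigD1 v) //=.
  have := good_embeds_size ge; rewrite /lasso2 /= size_cat /= !size_path_edges => sm.
  apply: (@le_trans _ _ (1 + 0)); first by rewrite addr0.
  apply: lerD; last by apply: sumr_ge0 => v' _; apply: tsum_ge0 => ws; apply: sumr_ge0.
  apply: le_trans (tsum_ge (ws := ws1) _ _); last by lia.
    rewrite (bigD1 w1) //= i1 mul1r; apply: (@le_trans _ _ (1 + 0)); first by rewrite addr0.
    apply: lerD; last exact: sumr_ge0.
    apply: le_trans (tsum_ge (ws := ws2) _ _); last by lia.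
      rewrite (bigD1 w2) //= {1}/G i2 mul1r ind1 // lerDl; exact: sumr_ge0.
    by move=> ws; apply: sumr_ge0.
  by move=> ws; apply: sumr_ge0.
have n0 : n%:R != 0 :> R by rewrite pnatr_eq0 -lt0n.
rewrite mean_sum; apply: (@le_trans _ _ (\sum_(v : 'I_n) (225 * 25) * r ^+ 2)); last first.
  have rE : r = rho / n%:R by rewrite -nr mulrAC mulfV ?mul1r.
  have -> : \sum_(v : 'I_n) 225 * 25 * r ^+ 2 = 5625 * rho ^+ 2 / n%:R.
    by rewrite sum_cst card_ord rE; field.
  apply: ler_wpM2r; first by rewrite invr_ge0 ler0n.
  have r2 : rho ^+ 2 <= 1 by rewrite exprn_ile1 //; have := rho_bounds; lra.
  lra.
apply: ler_sum => v _; rewrite mean_tsum.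
pose T2 := \sum_(l < m.+1) l.+1%:R * rho ^+ l.
apply: (@le_trans _ _ (tsum (fun ws1 => ((size ws1).+1%:R ^+ 2 * r ^+ size ws1) * (T2 * r ^+ 2)))).
  apply: le_tsum => ws1 _; rewrite mean_sum.
  apply: (@le_trans _ _ (\sum_w1 (w1 \in v :: ws1)%:R * 
           ((size ws1).+1%:R * r ^+ size ws1 * (T2 * r ^+ 2)))).
    apply: ler_sum => w1 _; rewrite meanZ ler_wpM2l ?ler0n // mean_tsum.
    apply: (@le_trans _ _ (tsum (fun ws2 => ((size ws1).+1%:R * (size ws2).+1%:R) *
       r ^+ ((size ws2).+1 + (size ws1).+1)))).
      apply: le_tsum => ws2 _; rewrite mean_sum.
      apply: (@le_trans _ _ (\sum_w2 (w2 \in v :: ws1 ++ ws2)%:R *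
           r ^+ ((size ws2).+1 + (size ws1).+1))).
        apply: ler_sum => w2 _; rewrite meanZ ler_wpM2l ?ler0n //.
        by have := mean_embeds (lasso2 v ws1 w1 ws2 w2); rewrite /lasso2 /= size_cat /= !size_path_edges.
      apply: le_trans (sum_mem _ _) _; first exact: exprn_ge0.
      rewrite ler_wpM2r ?exprn_ge0 // -natrM ler_nat /= size_cat; nia.
    rewrite (tsum_size n m (fun l => ((size ws1).+1%:R * l.+1%:R) * r ^+ (l.+1 + (size ws1).+1))).
    rewrite /T2 mulr_suml mulr_sumr; apply: ler_sum => l _; rewrite le_eqVlt; apply/orP; left; apply/eqP.
    rewrite -nr [(n%:R * r) ^+ l]exprMn exprD !exprSr; ring.
  apply: le_trans (sum_mem _ _) _.
    by rewrite !mulr_ge0 ?exprn_ge0 ?ler0n // sumr_ge0 // => l _; rewrite mulr_ge0 ?exprn_ge0 ?ler0n //; have /andP[] := rho_bounds.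
  by rewrite /= expr2 !mulrA.
rewrite (tsum_size n m (fun l => (l.+1%:R ^+ 2 * r ^+ l) * (T2 * r ^+ 2))).
rewrite (eq_bigr (fun l : 'I_m.+1 => l.+1%:R ^+ 2 * rho ^+ l * (T2 * r ^+ 2))); last first.
  by move=> l _; rewrite -nr [(n%:R * r) ^+ l]exprMn; ring.
rewrite -mulr_suml mulrA; apply: ler_wpM2r; first exact: exprn_ge0.
apply: ler_pM; [| |exact: geo2|exact: geo1]; apply: sumr_ge0 => l _.
all: by rewrite mulr_ge0 ?exprn_ge0 ?ler0n //; have /andP[] := rho_bounds.
Qed.

End UnionBounds.

(** * Expected time of one insertion *)

Section Time.
Variables (R : realType) (U : finType) (n p lim K : nat).
Local Notation H := (hashes U n p).
Local Notation mstate := (mstate U n p).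
Local Notation nxt := (@nxt U n p lim).
Local Notation exec := (exec nxt).
Local Notation mean := (@mean R ('I_p.+1 * U)%type 'I_n).
Local Notation ind := (@ind R).
Hypotheses (n_gt0 : (0 < n)%N) (p_gt0 : (0 < p)%N) (lim_gt0 : (0 < lim)%N).
Variables (P : pred U) (g0 : H) (delta : R).
Hypotheses (delta_gt0 : 0 < delta)
  (delta_free : forall f, (n < f + K)%N -> delta * n%:R <= f%:R).
Implicit Types (s : mstate) (h g : H).

Let v0 : 'I_n := Ordinal n_gt0.
Let n0 : 0 < n%:R :> R. Proof. by rewrite ltr0n. Qed.

Lemma embeds_edge g g' tau : (forall y, P y -> edge g y = edge g' y) ->
  embeds g P tau -> embeds g' P tau.
Proof.
move=> gg [ys [uy sy fy]]; exists ys; split=> //; move: fy; rewrite /fits.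
elim: ys tau sy {uy} => [|y ys IH] [|q tau] //= sy /andP[ey fy].
rewrite -gg ?ey ?IH //; first by move=> z zy; apply: sy; rewrite inE zy orbT.
by apply: sy; rewrite mem_head.
Qed.

Lemma reach_edge g g' a w : (forall y, P y -> edge g y = edge g' y) ->
  reach g P a w -> reach g' P a w.
Proof. by move=> gg [ws wE e]; exists ws => //; apply: embeds_edge e. Qed.

Lemma closing_edge g g' a : (forall y, P y -> edge g y = edge g' y) ->
  closing g P a -> closing g' P a.
Proof. by move=> gg [ws [w [ww e]]]; exists ws, w; split=> //; apply: embeds_edge e. Qed.

Definition reach_from (v : 'I_n) : R := \sum_w ind (reach g0 P v w).
Definition reach_into (w : 'I_n) : R := \sum_v ind (reach g0 P v w).
Definition sum_reach : R := \sum_v reach_from v.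
Definition sum_closing : R := \sum_v ind (closing g0 P v).

(** At least 1 as soon as the old core connects [v] to an end of an edge that joined during the
    insertion. *)
Definition touch s (v : 'I_n) : R :=
  \sum_(y <- core s | ~~ P y)
    (ind (reach g0 P v (edge (hh s) y).1) + ind (reach g0 P v (edge (hh s) y).2)).
Definition touch_weight s : R :=
  \sum_(y <- core s | ~~ P y) (reach_into (edge (hh s) y).1 + reach_into (edge (hh s) y).2).

Definition extends s :=
  todo s = [::] /\ forall y, P y -> y \in core s /\ edge (hh s) y = edge g0 y.

(** A unit of [touch_weight] makes each later join cost [lim] with probability 1 / n, and about 1 /
    delta probes are still expected. *)
Definition touch_cost : R := lim%:R / (n%:R * delta).
(** The expected cost of one probe times 1 / delta. The last summand is the growth of
    [touch_weight], on average 2 * sum_reach / n per join, at the price [touch_cost]. *)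
Definition time_bound : R :=
  (1 + sum_reach / n%:R + lim%:R * sum_closing / n%:R) / delta
  + 2 * lim%:R * sum_reach / (n%:R ^+ 2 * delta ^+ 2).

(* The term with [touch_weight] pays for walks that reach an edge added since the
   insertion began; the only bound on their length is lim. *)
Definition time_potential s : R := (time s)%:R + (if cur s then time_bound + touch_cost * touch_weight s else 0).

Lemma reach_from_ge0 v : 0 <= reach_from v. Proof. by apply: sumr_ge0 => w _; apply: ind_ge0. Qed.
Lemma reach_into_ge0 v : 0 <= reach_into v. Proof. by apply: sumr_ge0 => w _; apply: ind_ge0. Qed.
Lemma sum_reach_ge0 : 0 <= sum_reach. Proof. by apply: sumr_ge0 => w _; apply: reach_from_ge0. Qed.
Lemma sum_closing_ge0 : 0 <= sum_closing. Proof. by apply: sumr_ge0 => w _; apply: ind_ge0. Qed.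
Lemma touch_ge0 s v : 0 <= touch s v.
Proof. by apply: sumr_ge0 => w _; rewrite addr_ge0 ?ind_ge0. Qed.
Lemma touch_weight_ge0 s : 0 <= touch_weight s.
Proof. by apply: sumr_ge0 => w _; rewrite addr_ge0 ?reach_into_ge0. Qed.
Lemma touch_cost_ge0 : 0 <= touch_cost. Proof. by rewrite divr_ge0 ?mulr_ge0 ?ler0n // ltW. Qed.

Lemma sum_reach_into : \sum_v reach_into v = sum_reach.
Proof. by rewrite /sum_reach /reach_from exchange_big. Qed.

Lemma sum_touch s : \sum_v touch s v = touch_weight s.
Proof. by rewrite /touch exchange_big; apply: eq_bigr => y _; rewrite big_split. Qed.

Lemma time_bound_ge0 : 0 <= time_bound.
Proof.
rewrite addr_ge0 ?divr_ge0 ?mulr_ge0 ?exprn_ge0 ?ler0n ?sum_reach_ge0 ?(ltW delta_gt0) //.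
by rewrite !addr_ge0 ?divr_ge0 ?mulr_ge0 ?ler0n ?sum_reach_ge0 ?sum_closing_ge0.
Qed.

Lemma todo_nxt s h : todo s = [::] -> todo (nxt s h) = [::].
Proof.
rewrite /nxt; case: (cur s) => [[x i]|] ts; last by rewrite ts.
case: ifP => _; first by case: ifP.
by case: (occ _ _) => // y; case: walk => [[? oc] ?] /=; rewrite ts; case: oc.
Qed.

Lemma extends_nxt s h : minv K s -> extends s -> extends (nxt s h).
Proof.
move=> Is [ts Es]; split; first exact: todo_nxt.
move=> y Py; have [yc yE] := Es y Py; split; first exact: (core_nxt p_gt0 lim_gt0 h Is yc).
by rewrite (edge_nxt lim p_gt0 h Is yc).
Qed.

Lemma mean_time_potential s : minv K s -> extends s -> mean (fun h => time_potential (nxt s h)) <= time_potential s.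
Proof.
move=> Is Es; case cs: (cur s) => [[x i]|]; last first.
  rewrite (eq_mean (g := fun=> time_potential s)) => [|h]; first by rewrite (@mean_cst R _ _ v0).
  by rewrite /nxt cs Es.1.
have := minv_cur Is; rewrite cs => /andP[ci ip].
set f := #|free_slots (tb s)|; set phi : R := f%:R / n%:R.
have fd : delta <= phi.
  rewrite ler_pdivlMr //; apply: delta_free; have := minv_free Is; rewrite cs /= -/f; lia.
have WY0 : 0 <= time_bound + touch_cost * touch_weight s.
  by apply: addr_ge0; [exact: time_bound_ge0 | apply: mulr_ge0; [exact: touch_cost_ge0|exact: touch_weight_ge0]].
(* The remaining budget times [delta] equals the expected cost of one step, and a probe ends the
   insertion with probability [phi], which is at least [delta]. *)
have WY : delta * (time_bound + touch_cost * touch_weight s) = 1 + sum_reach / n%:R + lim%:R * sum_closing / n%:R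
    + 2 * touch_cost * sum_reach / n%:R + lim%:R * touch_weight s / n%:R.
  by rewrite /time_bound /touch_cost; field; rewrite !gt_eqF.
have sum_reach' := sum_reach_ge0; have k0' := sum_closing_ge0.
have tail0 : 0 <= sum_reach / n%:R + lim%:R * sum_closing / n%:R
    + 2 * touch_cost * sum_reach / n%:R + lim%:R * touch_weight s / n%:R.
  have [l0 N0] : 0 <= lim%:R :> R /\ 0 <= n%:R :> R by rewrite !ler0n.
  have L0 := touch_cost_ge0; have Y0 := touch_weight_ge0 s.
  do ![apply: addr_ge0 | apply: divr_ge0 | apply: mulr_ge0] => //; exact: ltW.
have phiW : delta * (time_bound + touch_cost * touch_weight s) <= phi * (time_bound + touch_cost * touch_weight s) by rewrite ler_wpM2r.
pose G v : R := if ~~ occ (tb s) v then 0 else time_bound + touch_cost * touch_weight s.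
have sumG : \sum_v G v / n%:R = (1 - phi) * (time_bound + touch_cost * touch_weight s).
  by rewrite /G (sum_free n_gt0) mulr0 add0r.
rewrite {2}/time_potential cs /=.
case: (ltnP i p) => pi.
  apply: (@le_trans _ _ (mean (fun h => (time s)%:R + 1 + G (h (inord i.-1, x))))).
    apply: le_mean => h.
    have [_ _ cN tN /(_ pi)[cE _]] := nxt_probe p_gt0 lim_gt0 h Is cs.
    have YE : touch_weight (nxt s h) = touch_weight s.
      rewrite /touch_weight cE big_seq_cond [RHS]big_seq_cond; apply: eq_bigr => y /andP[yc _].
      by rewrite (edge_nxt lim p_gt0 h Is yc).
    rewrite pi addn0 in tN; apply: lerD; first by rewrite natr1 ler_nat.
    rewrite YE /G; move: cN; case: (occ _ _) => [y|] /= cN; first by case: ifP.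
    by rewrite cN.
  rewrite meanD (@mean_cst R _ _ v0) (mean_slot n_gt0) mulr_suml sumG; lra.
have ipE : i = p by lia.
rewrite ipE in cs ci *.
set q1 : 'I_p.+1 * U := (inord p.-1, x); set q2 : 'I_p.+1 * U := (inord p, x).
pose F v := reach_from v + lim%:R * ind (closing g0 P v) + lim%:R * touch s v + G v + touch_cost * reach_into v.
have F0 v : 0 <= reach_from v + lim%:R * ind (closing g0 P v) + lim%:R * touch s v.
  by rewrite !addr_ge0 ?mulr_ge0 ?reach_from_ge0 ?touch_ge0 ?ind_ge0 ?ler0n.
apply: (@le_trans _ _ (mean (fun h => (time s)%:R + 1 + (F (h q1) + touch_cost * reach_into (h q2))))).
  apply: le_mean => h.
  have [_ _ cN tN _] := nxt_probe p_gt0 lim_gt0 h Is cs; rewrite -/q1 in cN tN.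
  have [cE xc xE] := nxt_join p_gt0 lim_gt0 h Is cs; rewrite -/q1 -/q2 in xE.
  have nPx : ~~ P x by apply: contra xc => /(Es.2)[].
  have YE : touch_weight (nxt s h) = touch_weight s + (reach_into (h q1) + reach_into (h q2)).
    rewrite /touch_weight cE -cats1 big_cat big_cons big_nil nPx xE /= addr0; congr (_ + _).
    rewrite big_seq_cond [RHS]big_seq_cond; apply: eq_bigr => y /andP[yc _].
    by move: (edge_nxt lim p_gt0 h Is yc) => -[-> ->].
  rewrite ltnn in tN; case oq: (occ (tb s) (h q1)) cN tN => [y|] cN tN; last first.
    rewrite addn0 in tN; rewrite /time_potential cN //= addr0.
    rewrite -[X in X <= _]addr0; apply: lerD; first by rewrite natr1 ler_nat.
    rewrite /F /G oq /= addr0 -addrA; apply: addr_ge0; first exact: F0.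
    by apply: addr_ge0; apply: mulr_ge0; rewrite ?touch_cost_ge0 ?reach_into_ge0.
  have PN z : z \in core s -> P z \/ [pred z in core s | ~~ P z] z.
    by move=> zc /=; rewrite zc; case: (P z); [left|right].
  have [|k [tE kl kb]] := @nxt_join_time U n p lim p_gt0 lim_gt0 K s h x P _ Is cs PN; first by rewrite -/q1 oq.
  rewrite -/q1 in kb; set g := hh (nxt s h) in kb.
  have gP z : P z -> edge g z = edge g0 z.
    by move=> Pz; have [zc <-] := Es.2 z Pz; rewrite (edge_nxt lim p_gt0 h Is zc).
  have kF : k%:R <= reach_from (h q1) + lim%:R * ind (closing g0 P (h q1)) + lim%:R * touch s (h q1).
    have i0 := ind_ge0 R (closing g0 P (h q1)); have t0 := touch_ge0 s (h q1).
    have l0 : 0 <= lim%:R :> R by rewrite ler0n.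
    have kl' : k%:R <= lim%:R :> R by rewrite ler_nat.
    have r0 := reach_from_ge0 (h q1).
    case: kb => [kr|kc|[y' /andP[yc nPy] ky]].
    - apply: (@le_trans _ _ (reach_from (h q1))); last by rewrite -addrA lerDl addr_ge0 ?mulr_ge0.
      rewrite /reach_from -card_ind ler_nat; apply: leq_trans (ltnW kr) _.
      apply: subset_leq_card; apply/fintype.subsetP => w; rewrite !inE.
      exact: reach_edge gP.
    - rewrite (ind1 R (closing_edge gP kc)) mulr1.
      by apply: le_trans kl' _; rewrite addrAC lerDr addr_ge0 ?mulr_ge0.
    - have t1 : 1 <= touch s (h q1).
        rewrite /touch (big_rem y') //= nPy -[X in X <= _]addr0.
        rewrite (edge_nxt lim p_gt0 h Is yc) in ky.
        apply: lerD; last by apply: sumr_ge0 => z _; rewrite addr_ge0 ?ind_ge0.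
        by case: ky => /(reach_edge gP) /(ind1 R) ->; rewrite ?lerDl ?lerDr ind_ge0.
      apply: le_trans kl' _; rewrite -[X in X <= _]mulr1.
      by apply: le_trans (ler_wpM2l l0 t1) _; rewrite lerDr addr_ge0 ?mulr_ge0.
  have c1 := reach_into_ge0 (h q1); have c2 := reach_into_ge0 (h q2); have LL := touch_cost_ge0.
  rewrite /time_potential tE -natr1 natrD -/g.
  have Vle : (if cur (nxt s h) then time_bound + touch_cost * touch_weight (nxt s h) else 0)
      <= G (h q1) + touch_cost * reach_into (h q1) + touch_cost * reach_into (h q2).
    rewrite /G oq /= YE; case: ifP => _; first by rewrite mulrDr mulrDr !addrA.
    by apply: addr_ge0; [apply: addr_ge0 => // |]; apply: mulr_ge0.
  move: kF Vle; rewrite /F; lra.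
rewrite (meanD (fun=> (time s)%:R + 1) (fun h : H => F (h q1) + touch_cost * reach_into (h q2))).
rewrite (meanD (fun h : H => F (h q1)) (fun h => touch_cost * reach_into (h q2))).
rewrite (@mean_cst R _ _ v0) (mean_slot n_gt0 q1 F) (mean_slot n_gt0 q2 (fun v => touch_cost * reach_into v)).
have -> : \sum_v F v = sum_reach + lim%:R * sum_closing + lim%:R * touch_weight s + \sum_v G v + touch_cost * sum_reach.
  by rewrite /F !big_split -!mulr_sumr sum_reach_into sum_touch.
rewrite -mulr_sumr sum_reach_into.
have -> : (sum_reach + lim%:R * sum_closing + lim%:R * touch_weight s + \sum_v G v + touch_cost * sum_reach) / n%:R =
   sum_reach / n%:R + lim%:R * sum_closing / n%:R + lim%:R * touch_weight s / n%:R
   + (1 - phi) * (time_bound + touch_cost * touch_weight s) + touch_cost * sum_reach / n%:R.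
  by rewrite -sumG -mulr_suml; ring.
lra.
Qed.

Lemma mean_time s t x : minv K s -> cur s = Some (x, 1%N) -> time s = 0%N -> todo s = [::] ->
  P =1 inC s -> hh s = g0 ->
  mean (fun h => (time (exec h t s))%:R) <= time_bound.
Proof.
move=> Is cs ts tds Ps hs.
have Es : extends s by split=> // y; rewrite Ps hs.
have Ys : touch_weight s = 0.
  by rewrite /touch_weight big_seq_cond big1 // => y /andP[yc /negP[]]; rewrite Ps.
apply: (@le_trans _ _ (time_potential s)); last by rewrite /time_potential cs ts Ys mulr0 addr0 add0r.
apply: le_trans (@mean_nxt_exec R U n p lim n_gt0 p_gt0 lim_gt0 K extends time_potential t s _ _ Is Es).
- apply: le_mean => h; rewrite /time_potential lerDl; case: ifP => _ //.
  by apply: addr_ge0; [exact: time_bound_ge0|apply: mulr_ge0; [exact: touch_cost_ge0|exact: touch_weight_ge0]].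
- by move=> s' h; apply: extends_nxt.
- by move=> s'; apply: mean_time_potential.
Qed.

End Time.

(** * The bounds for the algorithm *)

Section Assembly.
Variables (R : realType) (U : finType) (n p lim : nat).
Local Notation H := (hashes U n p).
Local Notation mstate := (mstate U n p).
Local Notation nxt := (@nxt U n p lim).
Local Notation exec := (exec nxt).
Local Notation mean := (@mean R ('I_p.+1 * U)%type 'I_n).
Local Notation prob := (@prob R U n p).
Local Notation A := (@bubble_up U n p lim).
Hypotheses (n_gt0 : (0 < n)%N) (p_gt0 : (0 < p)%N) (lim_gt0 : (0 < lim)%N).
Implicit Types (s : mstate) (h g : H).

Let v0 : 'I_n := Ordinal n_gt0.
Let h0 : H := [ffun=> v0].

Lemma embeds_nxt K s h tau : minv K s -> embeds (hh s) (inC s) tau ->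
  embeds (hh (nxt s h)) (inC (nxt s h)) tau.
Proof.
move=> Is e; have [ys [uy sy fy]] : embeds (hh (nxt s h)) (inC s) tau.
  apply: embeds_edge e => y yc; apply/esym; exact: (edge_nxt lim p_gt0 h Is yc).
by exists ys; split=> // y /sy yc; apply: (core_nxt p_gt0 lim_gt0 h Is yc).
Qed.

Lemma dead_exec K h t xs g0 : minv K (start g0 xs) -> let s := exec h t (start g0 xs) in dead s ->
  (exists v ws, embeds (hh s) (inC s) (path_edges v ws) /\ (lim.-1 <= 3 * size ws)%N) \/
  (exists v ws1 w1 ws2 w2, [/\ w1 \in v :: ws1, w2 \in v :: ws1 ++ ws2
     & embeds (hh s) (inC s) (lasso2 v ws1 w1 ws2 w2)]).
Proof.
move=> I0; elim: t => // t IH; rewrite -[exec h t.+1 _]/(nxt (exec h t (start g0 xs)) h).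
have It := minv_exec lim p_gt0 h t I0; set s := exec h t _ in IH It *.
move=> s1 /(nxt_dead p_gt0 lim_gt0 It)[|//].
case/IH => [[v [ws [e le]]]|[v [ws1 [w1 [ws2 [w2 [i1 i2 e]]]]]]].
  by left; exists v, ws; split=> //; apply: embeds_nxt It e.
by right; exists v, ws1, w1, ws2, w2; split=> //; apply: embeds_nxt It e.
Qed.

(** The number of machine steps needed depends on [h], but the potentials are averaged after a fixed
    number. There are finitely many [h], and a state that has stopped stays as it is. *)
Lemma uniform_time (Q : H -> nat -> Prop) :
  (forall h, exists N, forall N', (N <= N')%N -> Q h N') -> exists N, forall h, Q h N.
Proof.
move=> /boolp.choice[f fP]; exists (\max_h f h) => h; apply: fP.
exact: (leq_bigmax h).
Qed.

Lemma exec_stable h N N' s : cur (exec h N s) = None -> todo (exec h N s) = [::] ->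
  (N <= N')%N -> exec h N' s = exec h N s.
Proof.
move=> cN tN le; rewrite /exec -(subnK le) iterD -/(exec h N s).
by rewrite -[LHS]/(exec h (N' - N) (exec h N s)) exec_stop.
Qed.

Lemma start_agree h xs : {in dom (start h0 xs), hh (start h0 xs) =1 h}.
Proof. by move=> q; rewrite inE /= leqNgt p_gt0. Qed.

Lemma exec_run xs : uniq xs -> exists N, forall h, let s := exec h N (start h0 xs) in
  [/\ cur s = None, todo s = [::] & run A h xs = if dead s then None else Some (tb s)].
Proof.
move=> ux; apply: uniform_time => h.
have [N [cN tN rN]] := sim_run p_gt0 lim_gt0 (minv_start p_gt0 h ux) (h := h) erefl erefl erefl.
exists N => N' le.
have E : sethh h (exec h N' (start h0 xs)) = exec h N (start h xs).
  rewrite -(exec_stable cN tN le).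
  by case: (exec_sethh p_gt0 lim_gt0 (h := h) N' (minv_start p_gt0 h0 ux) (@start_agree h xs)).
by move: cN tN rN; rewrite -E.
Qed.

(** Cuts the run at the insertion to be timed: [x] starts alone with the clock at 0 and with the
    revealed values of [s]. *)
Definition load x s : mstate := MState (hh s) (tb s) (Some (x, 1%N)) [::] (core s) (dead s) 0.

Lemma minv_load K x s : minv K s -> cur s = None -> todo s = [::] ->
  Defs.choice (tb s) x = 0%N -> minv K.+1 (load x s).
Proof.
case=> ss cs [uc cc] cu fr [ut ct] cN tN cx; split=> //=.
- move=> j z oz; have [jz cz _] := ss _ _ oz; split=> //.
  by apply/eqP => -[zx]; rewrite zx cx in cz.
- by rewrite cx.
- by rewrite cN tN /= in fr; lia.
Qed.

Lemma dom_load x s : cur s = None -> dom (load x s) = dom s.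
Proof. by move=> cN; apply/setP => q; rewrite !inE cN /= ltnS ltn0 andbF. Qed.

Lemma run_valid h xs t : uniq xs -> run A h xs = Some t ->
  valid_table h t (rev xs).
Proof.
elim/last_ind: xs t => [|xs x IH] t; first by move=> _ [<-]; split.
rewrite rcons_uniq => /andP[xxs ux]; rewrite /run foldl_rcons.
case E: (foldl _ _ xs) => [t'|] //= Et; rewrite rev_rcons.
have vt := IH _ ux E.
by case: (bubble_up_policy p_gt0 vt _ Et); rewrite ?mem_rev.
Qed.

Lemma Pr_run xs N : (forall h, run A h xs = if dead (exec h N (start h0 xs)) then None
    else Some (tb (exec h N (start h0 xs)))) ->
  Pr R (fun h => isSome (run A h xs)) = 1 - prob (fun h => dead (exec h N (start h0 xs))).
Proof.
move=> rE; rewrite -[X in X - _](@mean_cst R ('I_p.+1 * U)%type _ v0) -mulN1r -meanZ -meanD.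
rewrite /Pr /mean -sum1_card natr_sum big_mkcond; congr (_ / _).
apply: eq_bigr => h _; rewrite unfold_in rE asboolb.
by case: (dead _); rewrite /= ?mulr1 ?mulr0 ?addr0 ?subrr.
Qed.

Definition insertion_bound (delta : R) s : R :=
  (1 + (nreach s)%:R / n%:R + lim%:R * (nclosing s)%:R / n%:R) / delta
  + 2 * lim%:R * (nreach s)%:R / (n%:R ^+ 2 * delta ^+ 2).

Lemma mean_insertion_time xs k delta : uniq xs -> (0 < k <= size xs)%N -> 0 < delta ->
  (forall f, (n < f + k)%N -> delta * n%:R <= f%:R) ->
  exists N, Ex R (fun h => insertion_time A h xs k)
    <= mean (fun h => insertion_bound delta (exec h N (start h0 (take k.-1 xs)))).
Proof.
move=> ux /andP[k0 kx] d0 dfree; set ys := take _ _.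
have uy : uniq ys by apply: take_uniq.
have sy : size ys = k.-1 by rewrite size_takel //; lia.
have [x [l xE]] : exists x l, drop k.-1 xs = x :: l.
  case E: (drop _ _) => [|x l]; last by exists x, l.
  by have := size_drop k.-1 xs; rewrite E => /esym/eqP; rewrite subn_eq0 leqNgt prednK // kx.
have xys : x \notin ys.
  have := ux; rewrite -(cat_take_drop k.-1 xs) xE cat_uniq => /and3P[_ /hasPn d _].
  by apply: d; rewrite mem_head.
have [N1 N1P] := exec_run uy; exists N1.
pose ok s := [&& cur s == None, todo s == [::], ~~ dead s & Defs.choice (tb s) x == 0%N].
have I0 := minv_start p_gt0 h0 uy; rewrite sy in I0.
have Iload s : minv k.-1 s -> ok s -> minv k (load x s).
  by move=> Is /and4P[/eqP c1 /eqP c2 _ /eqP c3]; rewrite -(prednK k0); apply: minv_load.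
have [N2 N2P] : exists N2, forall h, let s := exec h N1 (start h0 ys) in ok s ->
    time (exec h N2 (load x s)) = (A h (tb s) x).2.
  apply: uniform_time => h; set s := exec h N1 _.
  have Is : minv k.-1 s := minv_exec lim p_gt0 h N1 I0.
  case oks: (ok s); last by exists 0%N => N' _; rewrite -/s /= oks.
  have [sh _] := exec_sethh p_gt0 lim_gt0 (h := h) N1 I0 (@start_agree h ys).
  have sh' : {in dom (load x s), hh (load x s) =1 h}.
    by rewrite dom_load //; case/and4P: oks => /eqP.
  have Isl := Iload _ Is oks.
  have Ish : minv k (sethh h (load x s)).
    case: Isl => ss *; split=> //; apply: sound_agree ss => j z oz.
    have [_ cz _] := minv_sound (Iload _ Is oks) oz.
    apply: sh'; rewrite inE /= inordK; last by move: (minv_le Is z); clear; lia.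
    by rewrite prednK // leqnn.
  have cx : Defs.choice (tb s) x = 0%N by case/and4P: oks => _ _ _ /eqP.
  have [N [cN tN fN]] := sim_insert p_gt0 lim_gt0 Ish cx.
  have tdN : todo (exec h N (sethh h (load x s))) = [::].
    by move: fN; case: (_.1) => [t [_ _ ->]|[_ ->]].
  exists N => N' le /= _; rewrite -/s.
  have [_ E] := exec_sethh p_gt0 lim_gt0 (h := h) N' Isl sh'.
  have -> : time (exec h N' (load x s)) = time (sethh h (exec h N' (load x s))) by [].
  by rewrite E (exec_stable cN tdN le).
(* The value 0 outside [ok] matches the convention for the time of an insertion after a failure. *)
pose g s h : R := if ok s then (time (exec h N2 (load x s)))%:R else 0.
have -> : Ex R (fun h => insertion_time A h xs k) = mean (fun h => g (exec h N1 (start h0 ys)) h).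
  congr (_ / _); apply: eq_bigr => h _; have := N2P h; have := N1P h.
  rewrite /g /insertion_time -/ys xE; set s := exec h N1 _ => -[cN tN rN] /=.
  rewrite rN /ok cN tN /=; case ds: (dead s) => //= tE; rewrite ds in rN.
  have [_ v2 _] := run_valid uy rN.
  have cx : Defs.choice (tb s) x = 0%N by rewrite v2 ?mem_rev.
  by move: tE; rewrite cx eqxx => ->.
(* The values read by the timed insertion are independent of the table that it finds, so the bound
   for a fixed starting state applies. *)
rewrite (mean_exec_indep n_gt0 p_gt0 lim_gt0 (g := g) N1 _ I0); last first.
  move=> s h h' Is hh; rewrite /g; case oks: (ok s) => //.
  have Isl := Iload _ Is oks; congr (time _)%:R; apply: (exec_indep p_gt0 lim_gt0 N2 Isl).
  by rewrite dom_load //; case/and4P: oks => /eqP.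
apply: le_mean => h; set s := exec h N1 _.
have Is : minv k.-1 s := minv_exec lim p_gt0 h N1 I0.
have W0 : 0 <= insertion_bound delta s.
  by rewrite /insertion_bound !addr_ge0 ?divr_ge0 ?addr_ge0 ?mulr_ge0 ?exprn_ge0 ?divr_ge0 ?mulr_ge0 ?ler0n ?(ltW d0).
rewrite /g; case oks: (ok s); last by rewrite (@mean_cst R ('I_p.+1 * U)%type _ v0).
have -> : insertion_bound delta s = time_bound lim (inC s) (hh s) delta.
  rewrite /insertion_bound /time_bound /sum_reach /sum_closing /nreach /nclosing natr_sum !card_ind.
  congr ((1 + _ / _ + _) / _ + _ * _ / _); apply: eq_bigr => a _; exact: card_ind.
have Isl := Iload _ Is oks.
by have := @mean_time R U n p lim k n_gt0 p_gt0 lim_gt0 (inC s) (hh s) delta d0 dfree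
  (load x s) N2 x Isl erefl erefl erefl (fun=> erefl) erefl.
Qed.

Variables (m : nat) (pb : R).
Hypothesis m_le : 2 * m%:R / n%:R <= 4 / 5 :> R.

Lemma prob_fail xs i N : uniq xs ->
  prob (fun h => (m < size (core (exec h N (start h0 xs))))%N) <= pb ->
  (i <= (lim.-1 + 2) %/ 3)%N ->
  prob (fun h => dead (exec h N (start h0 xs)))
    <= pb + (5 * n%:R * (4 / 5) ^+ i + 5625 / n%:R).
Proof.
move=> ux pbP il.
pose st h := exec h N (start h0 xs).
pose E1 h := (m < size (core (st h)))%N.
pose E2 h := exists v ws, good_embeds m (st h) (path_edges v ws) /\ (i <= size ws)%N.
pose E3 h := exists v ws1 w1 ws2 w2, [/\ w1 \in v :: ws1, w2 \in v :: ws1 ++ ws2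
     & good_embeds m (st h) (lasso2 v ws1 w1 ws2 w2)].
have P2 : prob E2 <= 5 * n%:R * (4 / 5) ^+ i by apply: prob_long_path.
have P3 : prob E3 <= 5625 / n%:R by apply: prob_lasso2.
apply: le_trans (lerD pbP (lerD P2 P3)).
apply: (@le_trans _ _ (prob E1 + prob (fun h => E2 h \/ E3 h))); last first.
  by rewrite lerD2l; apply: prob_or.
apply: (@le_trans _ _ (prob (fun h => E1 h \/ (E2 h \/ E3 h)))); last exact: prob_or.
apply: sub_prob => h /(dead_exec (minv_start p_gt0 h0 ux)).
rewrite -/(st h); case: (ltnP m (size (core (st h)))) => [|cm]; first by left.
case=> [[v [ws [e le]]]|[v [ws1 [w1 [ws2 [w2 [i1 i2 e]]]]]]]; right.
  left; exists v, ws; split; first by [].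
  by apply: leq_trans il _; rewrite -ltnS ltn_divLR //; move: le; clear; lia.
by right; exists v, ws1, w1, ws2, w2.
Qed.

Lemma le_mean_nreach N xs : uniq xs ->
  prob (fun h => (m < size (core (exec h N (start h0 xs))))%N) <= pb ->
  mean (fun h => (nreach (exec h N (start h0 xs)))%:R) <= 5 * n%:R + n%:R ^+ 2 * pb
  /\ mean (fun h => (nclosing (exec h N (start h0 xs)))%:R) <= 25 + n%:R * pb.
Proof.
move=> ux pbP; set st := fun h => exec h N (start h0 xs).
(* The moment bounds hold only where the core is small; elsewhere the maximum [M] is paid with
   probability at most [pb]. *)
have E (f : mstate -> nat) (M : nat) (B : R) : (forall s, f s <= M)%N ->
    mean (fun h => (size (core (st h)) <= m)%N%:R * (f (st h))%:R) <= B ->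
    mean (fun h => (f (st h))%:R) <= B + M%:R * pb.
  move=> fM fB; apply: le_trans (lerD fB (ler_wpM2l (ler0n _ _) pbP)).
  rewrite -meanZ -meanD; apply: le_mean => h; rewrite -/(st h).
  case: (leqP (size (core (st h))) m) => cm.
    by rewrite mul1r lerDl mulr_ge0 ?ler0n.
  by rewrite mul0r add0r asboolT // mulr1 ler_nat.
rewrite -natrX; split; apply: E.
- move=> s; apply: leq_trans (_ : \sum_(a < n) n <= _)%N.
    by apply: leq_sum => a _; rewrite -[X in (_ <= X)%N](card_ord n) max_card.
  by rewrite sum_nat_const card_ord mulnn.
- exact: mean_nreach.
- by move=> s; rewrite -[X in (_ <= X)%N](card_ord n) max_card.
- exact: mean_nclosing.
Qed.

End Assembly.

(** * Numerical estimates *)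

Section Constants.
Variable R : realType.
Implicit Types x eps : R.

Lemma natceil_bounds x : 0 <= x -> x <= `|Num.ceil x|%N%:R < x + 1.
Proof.
move=> x0; have c0 : 0 <= Num.ceil x by rewrite ceil_ge0; lra.
have /andP[] := ceil_itv x; rewrite natr_absz ger0_norm // intrD => lb ->.
by move: lb; lra.
Qed.

Lemma natceil_gt0 x : 0 < x -> (0 < `|Num.ceil x|)%N.
Proof. by move=> x0; rewrite absz_gt0 gt_eqF // ceil_gt0. Qed.

Lemma nat_sqrt n : exists a, (a ^ 2 <= n < a.+1 ^ 2)%N.
Proof.
elim: n => [|n [a /andP[lo hi]]]; first by exists 0%N.
case: (ltnP n.+1 (a.+1 ^ 2)%N) => h; first by exists a; rewrite h ltnW.
exists a.+1; rewrite h /=; apply: leq_ltn_trans hi _.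
by rewrite ltn_exp2r.
Qed.

Lemma eps_pow4 n eps : (0 < n)%N -> n%:R `^ (- 4^-1) < eps ->
  n%:R ^+ 3 < (eps * n%:R) ^+ 4.
Proof.
move=> n0 lte; have N0 : 0 < n%:R :> R by rewrite ltr0n.
have e0 : 0 < eps by apply: le_lt_trans lte; apply: powR_ge0.
have : (n%:R `^ (- 4^-1)) ^+ 4 < eps ^+ 4 by rewrite ltrXn2r // ?nnegrE ?powR_ge0 // ltW.
rewrite -powR_mulrn ?powR_ge0 // -powRrM mulNr mulVf // powR_inv1 ?ler0n // => E.
rewrite exprMn; have -> : n%:R ^+ 3 = n%:R^-1 * n%:R ^+ 4 :> R.
  by rewrite [in RHS]exprS mulKf // gt_eqF.
by rewrite ltr_pM2r // exprn_gt0.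
Qed.

Lemma expR_sqr_le x : 0 <= x -> x ^+ 2 / 4 <= expR x.
Proof.
move=> x0; have := expR_ge1Dx (x / 2) => h.
have -> : expR x = expR (x / 2) ^+ 2 by rewrite -expRM_natl; congr expR; field.
have -> : x ^+ 2 / 4 = (x / 2) ^+ 2 by field.
by apply: lerXn2r; rewrite ?nnegrE ?expR_ge0 //; lra.
Qed.

(** The core threshold gives 2/5 * 10/11 = 4/11 per unit of a * pp, the growth of a * l takes at
    most 1/3, and 4/11 - 1/3 = 1/33. *)
Lemma exponent_le (N eps a pp M l : R) : 0 < N -> 0 < eps -> 0 <= a -> 1 <= pp ->
  10 * a <= eps * N -> 3 * l <= pp -> pp * (2 / 5 * N) <= M ->
  - (a * eps / (eps * N + a) * M) + a * l <= - (a / 33).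
Proof.
move=> N0 e0 a0 p1 aE lp MN; set E := eps * N in aE *.
have E0 : 0 < E by rewrite mulr_gt0.
have D0 : 0 < E + a by lra.
have lam0 : 0 <= a * eps / (E + a).
  by apply: divr_ge0; [apply: mulr_ge0 => //; exact: ltW | exact: ltW].
have h1 : a * eps / (E + a) * (pp * (2 / 5 * N)) <= a * eps / (E + a) * M by rewrite ler_wpM2l.
have h2 : a * eps / (E + a) * (pp * (2 / 5 * N)) = a * pp * (2 / 5) * (E / (E + a)).
  by rewrite /E; field; rewrite gt_eqF.
have h3 : 10 / 11 <= E / (E + a) by rewrite ler_pdivlMr //; lra.
have ap : 0 <= a * pp by rewrite mulr_ge0 //; lra.
have h4 : a * pp * (2 / 5) * (10 / 11) <= a * pp * (2 / 5) * (E / (E + a)).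
  by rewrite ler_wpM2l // mulr_ge0.
have h5 : a * (3 * l) <= a * pp by rewrite ler_wpM2l.
have h6 : a * 1 <= a * pp by rewrite ler_wpM2l.
by rewrite h2 in h1; lra.
Qed.

Lemma ln_le_pow (n : nat) (E : R) : (0 < n)%N -> 0 < E -> n%:R ^+ 3 < E ^+ 4 -> ln n%:R <= 4 * E.
Proof.
move=> n0 E0 h; have N0 : 0 < n%:R :> R by rewrite ltr0n.
have n1 : 1 <= n%:R :> R by rewrite ler1n.
apply: (@le_trans _ _ (ln (E ^+ 4))).
  rewrite ler_ln ?posrE ?exprn_gt0 //; apply: le_trans (ltW h).
  by rewrite exprS ler_peMr ?exprn_ege1 // ltW.
have := ltW (ln_sublinear E0); rewrite lnXn // -[ln E *+ 4]mulr_natl; lra.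
Qed.

End Constants.

(** * Size of the core *)

Section CoreBound.
Variables (R : realType) (U : finType) (n p lim : nat).
Local Notation prob := (@prob R U n p).
Local Notation exec := (exec (@nxt U n p lim)).
Hypotheses (n_gt0 : (0 < n)%N) (p_gt0 : (0 < p)%N) (lim_gt0 : (0 < lim)%N).

Lemma prob_le1 (P : hashes U n p -> Prop) : prob P <= 1.
Proof.
rewrite -(@mean_cst R ('I_p.+1 * U)%type _ (Ordinal n_gt0) 1).
by apply: le_mean => h; rewrite lern1 leq_b1.
Qed.

Lemma prob_core (eps : R) N xs (h0 : hashes U n p) : n%:R `^ (- 4^-1) < eps -> eps < 1 ->
  uniq xs -> (size xs)%:R <= (1 - eps) * n%:R -> 3 * ln eps^-1 <= p%:R ->
  prob (fun h => (2 * n %/ 5 < size (core (exec h N (start h0 xs))))%N)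
    <= 2 * 10 ^+ 4 / n%:R.
Proof.
move=> lte e1 ux sx lp; have e0 : 0 < eps by apply: le_lt_trans lte; apply: powR_ge0.
have N0 : 0 < n%:R :> R by rewrite ltr0n.
set NN : R := n%:R in sx N0 *.
(* From n = 10^4 on, 10 sqrt n <= n^(3/4) < eps n; for smaller n the claimed bound exceeds 1. *)
case: (leP (10 ^+ 4) NN) => nbig; last first.
  apply: le_trans (prob_le1 _) _; rewrite ler_pdivlMr // mul1r; lra.
(* [a] has to be small against eps n, to keep E / (E + a) near 1, and large against ln n, to make
   expR (- (a / 33)) at most of order 1 / n. The square root of n does both. *)
have [a /andP[alo ahi]] := nat_sqrt n.
pose E := eps * NN; have E0 : 0 < E by rewrite mulr_gt0.
have E4 := eps_pow4 n_gt0 lte; rewrite -/NN -/E in E4.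
have alo' : a%:R ^+ 2 <= NN by rewrite -natrX ler_nat.
have aE4 : (10 * a%:R) ^+ 4 <= E ^+ 4.
  apply/ltW/(le_lt_trans _ E4); apply: (@le_trans _ _ (10 ^+ 4 * NN ^+ 2)).
    have -> : (10 * a%:R) ^+ 4 = 10 ^+ 4 * (a%:R ^+ 2) ^+ 2 :> R by ring.
    rewrite ler_wpM2l ?exprn_ge0 //.
    by apply: lerXn2r; rewrite ?nnegrE ?exprn_ge0 ?ler0n ?(ltW N0).
  by rewrite [in leRHS]exprS ler_wpM2r // exprn_ge0 // ltW.
have aE : 10 * a%:R <= E.
  have a10 : 0 <= 10 * a%:R :> R by rewrite mulr_ge0.
  by move: aE4; rewrite ler_pXn2r // nnegrE; exact: ltW.
have nK : E <= (n - size xs)%:R.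
  have le : (size xs <= n)%N by rewrite -(ler_nat R) (le_trans sx) // -/NN; rewrite /E in E0; lra.
  by rewrite natrB // -/NN /E; lra.
have Kn : (size xs < n)%N by rewrite -subn_gt0 -(ltr_nat R) (lt_le_trans E0).
(* The condition on [lam] becomes an equality at f = eps n, the lower bound on the number of free
   slots. *)
pose lam := a%:R * eps / (E + a%:R).
have D0 : 0 < E + a%:R by rewrite ltr_wpDr.
have lam0 : 0 <= lam.
  by apply: divr_ge0; [apply: mulr_ge0; [exact: ler0n | exact: ltW] | exact: ltW].
apply: (@le_trans _ _ (prob (fun h => (p * (2 * n %/ 5).+1 <= work (exec h N (start h0 xs)))%N))).
  apply: sub_prob => h cm; apply: leq_trans (core_work p_gt0 lim_gt0 (minv_exec lim p_gt0 h N (minv_start p_gt0 h0 ux))).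
  by rewrite leq_mul2l cm orbT.
have lamP f : (n < f + size xs)%N -> lam * (n%:R * (f + a)%:R) <= (f * a)%:R.
  move=> nf; have Ef : E <= f%:R.
    by apply: le_trans nK _; rewrite ler_nat leq_subLR addnC ltnW.
  rewrite natrM natrD -/NN.
  have -> : lam * (NN * (f%:R + a%:R)) = a%:R * E * (f%:R + a%:R) / (E + a%:R).
    by rewrite /lam /E; field; rewrite gt_eqF.
  rewrite ler_pdivrMr //.
  have : a%:R ^+ 2 * E <= a%:R ^+ 2 * f%:R by rewrite ler_wpM2l // exprn_ge0.
  by rewrite expr2; lra.
apply: le_trans (@prob_work R U n p lim n_gt0 p_gt0 lim_gt0 (size xs) lam a N xs _ h0 ux erefl Kn lam0 lamP) _.
have M_ge : p%:R * (2 / 5 * NN) <= (p * (2 * n %/ 5).+1)%:R.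
  rewrite natrM ler_wpM2l // mulrAC ler_pdivrMr //.
  have := ltn_ceil (2 * n) (isT : 0 < 5)%N; rewrite -(ltr_nat R) !natrM -/NN; lra.
have p1 : 1 <= p%:R :> R by rewrite ler1n.
have ex := exponent_le N0 e0 (ler0n R a) p1 aE lp M_ge; rewrite -/E -/lam in ex.
apply: (@le_trans _ _ (expR (- (lam * (p * (2 * n %/ 5).+1)%:R)) * expR (a%:R * ln eps^-1))).
  rewrite ler_wpM2l ?expR_ge0 // expRM_natl lnK ?posrE ?invr_gt0 //.
  apply: lerXn2r; rewrite ?nnegrE ?divr_ge0 ?invr_ge0 ?ler0n ?(ltW e0) //.
  rewrite ler_pdivrMr ?(lt_le_trans E0) // -ler_pdivrMl ?invr_gt0 // invrK; exact: nK.
rewrite -expRD; apply: (@le_trans _ _ (expR (- (a%:R / 33)))); first by rewrite ler_expR.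
rewrite expRN -[leRHS]invrK lef_pV2 ?posrE ?expR_gt0 ?invr_gt0 ?divr_gt0 ?mulr_gt0 ?exprn_gt0 //.
(* The quadratic bound on [expR] gives 4 * 33^2 / a^2, and n <= 4 a^2 turns this into 17424 / n. *)
rewrite invf_div; apply: le_trans (expR_sqr_le _); last by rewrite divr_ge0.
have a1 : 1 <= a%:R :> R.
  rewrite ler1n lt0n; apply: contraTneq ahi => ->; rewrite -leqNgt //.
have ahi' : NN <= (a%:R + 1) ^+ 2 by rewrite natr1 -natrX ler_nat ltnW.
have : (a%:R + 1) ^+ 2 <= (2 * a%:R) ^+ 2 :> R.
  by apply: lerXn2r; rewrite ?nnegrE; lra.
rewrite exprMn => h; rewrite ler_pdivrMr ?mulr_gt0 ?exprn_gt0 //.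
rewrite !expr2 in h ahi' *; lra.
Qed.

End CoreBound.

(** * Collecting the constants *)

Section Conclusion.
Variables (R : realType) (c : R) (n : nat) (eps : R) (U : finType) (xs : seq U).
Variables (p lim : nat).
Hypotheses (c30 : 30 <= c) (n_gt0 : (0 < n)%N) (lte : n%:R `^ (- 4^-1) < eps)
  (e1 : eps < 1) (ux : uniq xs) (sx : (size xs)%:R <= (1 - eps) * n%:R)
  (p_gt0 : (0 < p)%N) (lp : 3 * ln eps^-1 <= p%:R)
  (lim_gt0 : (0 < lim)%N) (limP : c * ln n%:R <= lim%:R < c * ln n%:R + 1).
Local Notation A := (@bubble_up U n p lim).
Local Notation exec := (exec (@nxt U n p lim)).

Definition core_const : R := 2 * 10 ^+ 4.
(** Comes from [insertion_bound] with (5 + core_const) n for the mean of [nreach], 25 + core_const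
    for that of [nclosing], and the bounds (4 c + 1) eps n and (c + 1) n on [lim]. *)
Definition time_const : R := 1 + (5 + core_const) * (1 + 2 * (4 * c + 1)) + (c + 1) * (25 + core_const).

Let NN : R := n%:R.
Let N0 : 0 < NN. Proof. by rewrite /NN ltr0n. Qed.
Let N1 : 1 <= NN. Proof. by rewrite /NN ler1n. Qed.
Let e0 : 0 < eps. Proof. by apply: le_lt_trans lte; apply: powR_ge0. Qed.
Let m := (2 * n %/ 5)%N.
Let h0 : hashes U n p := [ffun=> Ordinal n_gt0].

Let m_le : 2 * m%:R / n%:R <= 4 / 5 :> R.
Proof.
rewrite ler_pdivrMr // mulrAC ler_pdivlMr //.
have : (5 * m <= 2 * n)%N by rewrite mulnC leq_divM.
by rewrite -(ler_nat R) !natrM -/NN; lra.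
Qed.

Let pbP ys N : uniq ys -> (size ys <= size xs)%N ->
  prob R (fun h => (m < size (core (exec h N (start h0 ys))))%N) <= core_const / n%:R.
Proof.
move=> uy sy; apply: (prob_core n_gt0 p_gt0 lim_gt0 N h0 lte e1 uy _ lp).
by apply: le_trans sx; rewrite ler_nat.
Qed.

Lemma success_prob : 1 - 3 * 10 ^+ 4 / n%:R <= Pr R (fun h => isSome (run A h xs)).
Proof.
have [N NP] := exec_run n_gt0 p_gt0 lim_gt0 ux.
have rE h : run A h xs = if dead (exec h N (start h0 xs)) then None
    else Some (tb (exec h N (start h0 xs))) by case: (NP h).
rewrite (Pr_run _ rE).
pose i := ((lim.-1 + 2) %/ 3)%N.
have := @prob_fail R U n p lim n_gt0 p_gt0 lim_gt0 m (core_const / n%:R) m_le xs i N ux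
  (pbP N ux (leqnn _)) (leqnn _).
(* The three causes of failure then add up to 20000 + 6 + 5625, which is below 3 * 10^4. *)
suff : 5 * n%:R * (4 / 5) ^+ i <= 6 / n%:R :> R.
  move=> X6 pf; rewrite lerD2l lerN2; apply: (le_trans pf); move: X6.
  have := N0; rewrite -invr_gt0 /core_const -/NN; lra.
have li : (lim <= 3 * i + 1)%N by rewrite /i; clear; lia.
have li' : lim%:R <= 3 * i%:R + 1 :> R by rewrite -natrM natr1 ler_nat -addn1.
have l0 : 0 <= ln n%:R :> R by apply: ln_ge0.
have il : 10 * ln n%:R - 1 / 3 <= i%:R :> R.
  have : 30 * ln n%:R <= c * ln n%:R by rewrite ler_wpM2r.
  have [lim1 _] := andP limP => c3; lra.
have h1 : (4 / 5) ^+ i <= expR (- (i%:R / 5)) :> R.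
  have -> : - (i%:R / 5) = i%:R * (- 5^-1) :> R by rewrite mulrN.
  rewrite expRM_natl; apply: lerXn2r; rewrite ?nnegrE ?expR_ge0 //.
  by have := expR_ge1Dx (- 5^-1 : R); lra.
have h2 : expR (- (i%:R / 5)) <= expR (- (2 * ln n%:R)) * expR (15^-1) :> R.
  by rewrite -expRD ler_expR; lra.
have h3 : expR (15^-1) <= 6 / 5 :> R.
  have := expR_ge1Dx (- 15^-1 : R); have := expRxMexpNx_1 (15^-1 : R).
  have := expR_gt0 (15^-1 : R); set x := expR _; set y := expR (- _) => x0 xy y1.
  have : x * (14 / 15) <= x * y by rewrite ler_wpM2l ?(ltW x0) //; lra.
  by rewrite xy; lra.
have h4 : expR (- (2 * ln n%:R)) = NN ^- 2 :> R.
  by rewrite expRN expRM_natl lnK ?posrE.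
have h5 : (4 / 5) ^+ i <= NN ^- 2 * (6 / 5) :> R.
  apply: le_trans h1 _; apply: le_trans h2 _; rewrite h4 ler_wpM2l // invr_ge0 exprn_ge0 // ltW.
have -> : 6 / n%:R = 5 * NN * (NN ^- 2 * (6 / 5)) :> R by rewrite -/NN; field; rewrite gt_eqF.
by rewrite ler_wpM2l // mulr_ge0 // ltW.
Qed.

Lemma insertion_mean_time delta (k := Num.truncn ((1 - delta) * n%:R)) :
  eps <= delta -> (0 < k)%N -> (k <= size xs)%N ->
  Ex R (fun h => insertion_time A h xs k) <= time_const * delta^-1.
Proof.
move=> ed k0 kx; have d0 : 0 < delta by apply: lt_le_trans ed.
have dn : 1 <= (1 - delta) * n%:R by rewrite -truncn_gt0.
have kd : k%:R <= (1 - delta) * n%:R by rewrite truncn_le; lra.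
have dfree f : (n < f + k)%N -> delta * n%:R <= f%:R.
  by move=> /ltnW; rewrite -(ler_nat R) natrD; lra.
have [|N] := @mean_insertion_time R U n p lim n_gt0 p_gt0 lim_gt0 xs k delta ux _ d0 dfree.
  by rewrite k0.
set ys := take _ _ => le1; apply: le_trans le1 _.
have uy : uniq ys by apply: take_uniq.
have sy : (size ys <= size xs)%N by rewrite size_take; case: ltnP => // /ltnW.
have [mX mK] := @le_mean_nreach R U n p lim n_gt0 p_gt0 lim_gt0 m (core_const / n%:R) m_le N ys uy (pbP N uy sy).
set X := mean _ in mX; set K := mean _ in mK.
pose al : R := (NN * delta)^-1 + 2 * lim%:R / (NN ^+ 2 * delta ^+ 2).
pose be : R := lim%:R / (NN * delta).
have Nn0 : NN != 0 by rewrite gt_eqF.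
have dn0 : delta != 0 by rewrite gt_eqF.
have -> : mean (fun h => insertion_bound lim delta (exec h N (start h0 ys))) = delta^-1 + (al * X + be * K).
  rewrite /X /K -!meanZ -meanD -[X in X + _](@mean_cst R ('I_p.+1 * U)%type _ (Ordinal n_gt0)) -meanD.
  apply: eq_mean => h; rewrite /insertion_bound /al /be -/NN; field.
  by rewrite Nn0 dn0.
have E0 : 0 < eps * NN by rewrite mulr_gt0.
have E4 := eps_pow4 n_gt0 lte; rewrite -/NN in E4.
have E1 : 1 <= eps * NN.
  rewrite leNgt; apply/negP => lt1; have : 1 < (eps * NN) ^+ 4.
    by apply: le_lt_trans E4; apply: exprn_ege1.
  by rewrite ltNge exprn_ile1 // ltW.
have lnE := ln_le_pow n_gt0 E0 E4.
have lnN := ltW (ln_sublinear N0).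
have [_ limU] := andP limP.
have c0 : 0 <= c by have := c30; lra.
(* From eps > n^(-1/4) one has ln n <= 4 eps n, so lim / (n delta) is bounded by a constant and
   charging [lim] for meeting a new edge costs only O(1 / delta). *)
have limE : lim%:R <= (4 * c + 1) * (eps * NN).
  have : c * ln n%:R <= c * (4 * (eps * NN)) by rewrite ler_wpM2l.
  by move: limU; lra.
have limN : lim%:R <= (c + 1) * NN.
  have : c * ln n%:R <= c * NN by rewrite ler_wpM2l.
  by move: limU N1; lra.
have dN : eps * NN <= NN * delta by rewrite mulrC ler_wpM2l // ltW.
have dN0 : 0 < NN * delta by rewrite mulr_gt0.
have r1 : lim%:R / (NN * delta) <= 4 * c + 1.
  rewrite ler_pdivrMr //; apply: le_trans limE _; rewrite ler_wpM2l //; lra.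
have r2 : lim%:R / NN <= c + 1 by rewrite ler_pdivrMr.
have Cb0 : 0 <= core_const by rewrite /core_const.
have al0 : 0 <= al.
  by rewrite addr_ge0 ?invr_ge0 ?divr_ge0 ?mulr_ge0 ?exprn_ge0 ?ler0n ?(ltW N0) ?(ltW d0).
have be0 : 0 <= be.
  by rewrite /be divr_ge0 ?mulr_ge0 ?ler0n ?(ltW N0) ?(ltW d0).
have aX := ler_wpM2l al0 mX; have bK := ler_wpM2l be0 mK.
have d' : 0 <= delta^-1 by rewrite invr_ge0 ltW.
have aE : al * (5 * n%:R + n%:R ^+ 2 * (core_const / n%:R))
    = delta^-1 * ((5 + core_const) * (1 + 2 * (lim%:R / (NN * delta)))).
  by rewrite /al -/NN; field; rewrite Nn0 dn0.
have bE : be * (25 + n%:R * (core_const / n%:R)) = delta^-1 * ((25 + core_const) * (lim%:R / NN)).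
  by rewrite /be -/NN; field; rewrite Nn0 dn0.
rewrite aE in aX; rewrite bE in bK.
have aX' : delta^-1 * ((5 + core_const) * (1 + 2 * (lim%:R / (NN * delta))))
    <= delta^-1 * ((5 + core_const) * (1 + 2 * (4 * c + 1))).
  by rewrite ler_wpM2l // ler_wpM2l; lra.
have bK' : delta^-1 * ((25 + core_const) * (lim%:R / NN)) <= delta^-1 * ((25 + core_const) * (c + 1)).
  by rewrite ler_wpM2l // ler_wpM2l; lra.
rewrite /time_const; lra.
Qed.

End Conclusion.

Theorem theorem6 (R : realType) :
  exists c0 : R, forall c : R, c0 <= c -> exists C : R,
  forall (n : nat) (eps : R) (U : finType) (xs : seq U),
    (0 < n)%N -> n%:R `^ (- 4^-1) < eps -> eps < 1 ->
    uniq xs -> size xs = Num.truncn ((1 - eps) * n%:R) ->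
    (* the arity is d = p + 1 *)
    let p := `|Num.ceil (3 * ln eps^-1)|%N in
    let lim := `|Num.ceil (c * ln n%:R)|%N in
    let A := @bubble_up U n p lim in
    [/\ eviction_policy A,
        1 - C / n%:R <= Pr R (fun h => isSome (run A h xs))
      & forall delta : R, eps <= delta ->
          let k := Num.truncn ((1 - delta) * n%:R) in
          (0 < k)%N ->
          Ex R (fun h => insertion_time A h xs k)
            <= C * (delta^-1 + ln eps^-1)].
Proof.
(* 30 makes (4/5)^(c ln n / 3) <= n^-2, since ln (5/4) >= 1/5. *)
exists 30 => c c30; exists (3 * 10 ^+ 4 + time_const c) => n eps U xs n0 lte e1 ux sx p lim A.
have e0 : 0 < eps by apply: le_lt_trans lte; apply: powR_ge0.
have N1 : 1 <= n%:R :> R by rewrite ler1n.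
have n1 : 1 < n%:R :> R.
  rewrite lt_neqAle N1 andbT; apply: contraTneq lte => <-.
  by rewrite powR1 -leNgt ltW.
have ln0 : 0 < ln n%:R :> R by apply: ln_gt0.
have le0 : 0 < ln eps^-1 by apply: ln_gt0; rewrite invf_gt1.
have cl : 0 < c * ln n%:R by rewrite mulr_gt0 //; lra.
have p0 : (0 < p)%N by apply: natceil_gt0; rewrite mulr_gt0.
have l0 : (0 < lim)%N by apply: natceil_gt0.
have /andP[lp _] : 3 * ln eps^-1 <= p%:R < 3 * ln eps^-1 + 1.
  by apply: natceil_bounds; rewrite mulr_ge0 // ltW.
have lP : c * ln n%:R <= lim%:R < c * ln n%:R + 1 by apply: natceil_bounds; apply: ltW.
have en : 0 <= (1 - eps) * n%:R by rewrite mulr_ge0 //; lra.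
have sx' : (size xs)%:R <= (1 - eps) * n%:R by rewrite sx truncn_le.
have Ct0 : 0 <= time_const c.
  rewrite /time_const /core_const !addr_ge0 ?mulr_ge0 ?addr_ge0 ?mulr_ge0 ?addr_ge0 ?exprn_ge0 //; lra.
have B0 : 0 <= 3 * 10 ^+ 4 :> R by rewrite mulr_ge0.
split.
- exact: bubble_up_policy.
- apply: le_trans (success_prob c30 n0 lte e1 ux sx' p0 lp l0 lP).
  rewrite lerD2l lerN2 ler_wpM2r ?invr_ge0 //; lra.
- move=> delta ed k k0.
  have kx : (k <= size xs)%N.
    rewrite sx truncn_ge_nat // (@le_trans _ _ ((1 - delta) * n%:R)) //.
      by rewrite truncn_le; move: k0; rewrite truncn_gt0; lra.
    by rewrite ler_wpM2r //; lra.
  apply: le_trans (insertion_mean_time c30 n0 lte e1 ux sx' p0 lp l0 lP ed k0 kx) _.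
  have d' : 0 <= delta^-1 by rewrite invr_ge0; lra.
  apply: (@le_trans _ _ (time_const c * (delta^-1 + ln eps^-1))).
    by apply: ler_wpM2l => //; rewrite lerDl ltW.
  have s0 : 0 <= delta^-1 + ln eps^-1 by apply: addr_ge0 => //; exact: ltW.
  by rewrite [X in _ <= X]mulrDl lerDr; exact: mulr_ge0.
Qed.
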